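(* Let $G$ be an abelian compactly generated locally compact group of polynomial growth, let $1<p<\infty$, and let $\omega$ be a continuous weight on $G$ such that $(G,\omega)$ satisfies (LPAlg). Assume that $\omega$ satisfies condition (S). Then $L^p(G,\omega)$ is a symmetric Banach $*$-algebra.
   Context: $G$ is of polynomial growth if there are a relatively compact neighbourhood $U$ of the identity with $G=\bigcup_n U^n$ (a ''generating'' neighbourhood) and constants $C,Q$ with $|U^n|\le Cn^Q$ for all $n\ge 1$, where $|\cdot|$ is Haar measure. Let $\frac1p+\frac1q=1$. $(G,\omega)$ satisfies (LPAlg) if $\omega:G\to[1,+\infty[$ is measurable and $\omega(xy)\le\omega(x)\omega(y)$, $\omega(x^{-1})=\omega(x)$ for all $x,y\in G$, and $\omega^{-q}*\omega^{-q}\le\omega^{-q}$ pointwise. $L^p(G,\omega)$ is the space of measurable $f:G\to\mathbb{C}$ with $\|f\|_{p,\omega}=\big(\int_G|f(x)|^p\omega(x)^p\,dx\big)^{1/p}<\infty$; under (LPAlg) it is a Banach $*$-algebra for the convolution $(f*g)(x)=\int_G f(y)g(y^{-1}x)\,dy$ and the involution $f^*(x)=\overline{f(x^{-1})}$. Condition (S): for every relatively compact generating neighbourhood $U$ of the identity, $\lim_{n\to\infty}\sup_{x\in U^n}\omega(x)^{1/n}=1$. A Banach $*$-algebra $\mathcal{A}$ is symmetric if $\sigma_{\mathcal{A}}(a^*a)\subset[0,+\infty[$ for all $a\in\mathcal{A}$, equivalently $\sigma_{\mathcal{A}}(a)\subset\mathbb{R}$ for all $a=a^*\in\mathcal{A}$.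 *)

(* Defs.v *)
From HB Require Import structures.
From mathcomp Require Import all_boot all_order all_algebra.
From mathcomp Require Import all_classical all_reals all_analysis.
From mathcomp Require Import measurable_realfun.
From mathcomp Require Import complex.

Set Implicit Arguments.
Unset Strict Implicit.
Unset Printing Implicit Defensive.

Import Order.TTheory GRing.Theory Num.Theory.
Import numFieldNormedType.Exports.
Import ComplexField.Normc.

Local Open Scope classical_set_scope.
Local Open Scope ring_scope.
Local Open Scope quotient_scope.

(* Abelian topological groups are [topologicalZmodType]s and are written
   additively: the neutral element is 0, the set U^n is the n-fold sumset of U
   and y^{-1}x is x - y. *)

(* A copy of G carrying its Borel sigma-algebra. *)
Definition borel (G : topologicalZmodType) : Type := G.

Section borel_instances.
Variable G : topologicalZmodType.

HB.instance Definition _ := TopologicalZmodule.on (borel G).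
HB.instance Definition _ := isPointed.Build (borel G) (0 : G).
HB.instance Definition _ := @isMeasurable.Build (sigma_display (@open G))
  (borel G) <<s @open G >> (@sigma_algebra0 _ setT (@open G))
  (@sigma_algebraC (borel G) (@open G))
  (@sigma_algebra_bigcup _ setT (@open G)).

End borel_instances.

Section groups.
Variables (R : realType) (G : topologicalZmodType).
Implicit Types (U A K : set G).

(* Inner regularity is required on open sets only, so that the definition also
   covers groups that are not sigma-compact. *)
Record haar_measure (mu : {measure set (borel G) -> \bar R}) : Prop :=
  HaarMeasure {
  haar_translation : forall (x : G) A,
    measurable (A : set (borel G)) -> mu [set x + y | y in A] = mu A;
  haar_neq0 : mu setT <> 0%E;
  haar_compact : forall K, compact K -> (mu K < +oo)%E;
  haar_outer_regular : forall A, measurable (A : set (borel G)) ->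
    mu A = ereal_inf [set mu U | U in [set U : set G | open U /\ A `<=` U]];
  haar_inner_regular : forall U, open U ->
    mu U = ereal_sup [set mu K | K in [set K : set G | compact K /\ K `<=` U]]
}.

Fixpoint nfold_sum U (n : nat) : set G :=
  if n is m.+1 then [set x + y | x in U & y in nfold_sum U m] else [set 0].

Definition compactly_generated : Prop :=
  exists2 K : set G, compact K &
    forall H : set G, H 0 -> (forall x y, H x -> H y -> H (x - y)) ->
      K `<=` H -> H = setT.

Definition generating_nbhs U : Prop :=
  [/\ nbhs (0 : G) U, precompact U & \bigcup_n nfold_sum U n = setT].

(* The sets U^n need not be Borel, whence the outer measure [mu^*], which is
   [mu] on Borel sets. *)
Definition polynomial_growth (mu : {measure set (borel G) -> \bar R}) : Prop :=
  exists (U : set G) (C Q : R), generating_nbhs U /\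
    forall n : nat, (0 < n)%N ->
      ((mu^*)%mu (nfold_sum U n) <= (C * n%:R `^ Q)%:E)%E.

Record weight := Weight {
  weight_fun :> G -> R;
  weight_ge1 : forall x, 1 <= weight_fun x;
  weight_measurable : measurable_fun [set: borel G] (weight_fun : borel G -> R);
  weight_submult : forall x y,
    weight_fun (x + y) <= weight_fun x * weight_fun y;
  weight_sym : forall x, weight_fun (- x) = weight_fun x
}.

(* The other requirements of (LPAlg) are part of [weight]. *)
Definition LPAlg (mu : {measure set (borel G) -> \bar R}) (omega : weight)
    (q : R) : Prop :=
  forall x : G, (\int[mu]_(y in [set: borel G])
      (omega y `^ (- q) * omega (x - y)%R `^ (- q))%:E
    <= (omega x `^ (- q))%:E)%E.

Definition condition_S (omega : weight) : Prop :=
  forall U, generating_nbhs U ->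
    ereal_sup [set (omega x `^ (n%:R^-1))%:E | x in nfold_sum U n]
      @[n --> \oo] --> 1%E.

End groups.

Section complex_functions.
Context {R : realType} {G : topologicalZmodType}.
Variable mu : {measure set (borel G) -> \bar R}.
Implicit Types (f g h F : G -> R[i]).

Definition cmeasurable f : Prop :=
  measurable_fun [set: borel G] (fun x : borel G => complex.Re (f x)) /\
  measurable_fun [set: borel G] (fun x : borel G => complex.Im (f x)).

Definition cintegrable F : Prop :=
  mu.-integrable [set: borel G] (fun x => (complex.Re (F x))%:E) /\
  mu.-integrable [set: borel G] (fun x => (complex.Im (F x))%:E).

Definition cintegral F : R[i] :=
  Complex (Rintegral mu [set: borel G] (fun x => complex.Re (F x)))
          (Rintegral mu [set: borel G] (fun x => complex.Im (F x))).

End complex_functions.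

Section Lp_functions.
Context {R : realType} {G : topologicalZmodType}.
Variables (mu : {measure set (borel G) -> \bar R}) (omega : weight R G).
Variable p : R.
Implicit Types (f g : G -> R[i]).

Definition Lp_integral f : \bar R :=
  (\int[mu]_(x in [set: borel G]) (normc (f x) `^ p * omega x `^ p)%:E)%E.

Definition finite_Lp f : Prop := cmeasurable f /\ (Lp_integral f < +oo)%E.

Definition Lp_norm f : R := (fine (Lp_integral f)) `^ p^-1.

Definition finite_Lp_pred : {pred G -> R[i]} := [pred f | `[< finite_Lp f >]].

Hypothesis p1 : 1 < p.

Let p0 : 0 < p. Proof. exact: lt_trans p1. Qed.

Let absw f : borel G -> R := fun x => normc (f x) * omega x.

Let normc_ge0 (z : R[i]) : 0 <= normc z.
Proof. by case: z => a b; exact: sqrtr_ge0. Qed.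

Let omega_ge0 x : 0 <= omega x.
Proof. by rewrite (le_trans _ (weight_ge1 omega x)). Qed.

Let measurableT_comp_powR (h : borel G -> R) (r : R) :
  measurable_fun setT h -> measurable_fun setT (fun x => h x `^ r).
Proof. exact: (@measurableT_comp _ _ _ _ _ _ (@powR R ^~ r)). Qed.

Let measurable_abs_powR (h : borel G -> R) (r : R) :
  measurable_fun setT h ->
  measurable_fun setT (fun x => (`|h x| `^ r)%:E).
Proof.
move=> mh; apply/measurable_EFinP.
apply: (@measurableT_comp_powR (fun x => `|h x|)).
exact: (@measurableT_comp _ _ _ _ _ _ (@Num.norm R R)).
Qed.

Lemma cmeasurable_normc f : cmeasurable f ->
  measurable_fun [set: borel G] (fun x : borel G => normc (f x)).
Proof.
move=> [mr mi].
rewrite (_ : (fun x : borel G => _) = (fun x : borel G =>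
  ((complex.Re (f x)) ^+ 2 + (complex.Im (f x)) ^+ 2) `^ 2^-1)).
  apply: (@measurableT_comp _ _ _ _ _ _ (fun t : R => t `^ 2^-1)) => //.
  by apply: measurable_funD; apply: measurable_funX.
apply/funext => x; case: (f x) => a b /=.
by rewrite powR12_sqrt // addr_ge0 ?sqr_ge0.
Qed.

Lemma measurable_absw f : cmeasurable f -> measurable_fun setT (absw f).
Proof.
move=> mf; apply: measurable_funM; first exact: cmeasurable_normc.
exact: weight_measurable.
Qed.

Lemma Lp_integralE f : Lp_integral f = (\int[mu]_x (absw f x `^ p)%:E)%E.
Proof. by apply: eq_integral => x _; rewrite powRM. Qed.

Lemma Lp_integral_ge0 f : (0 <= Lp_integral f)%E.
Proof.
by apply: integral_ge0 => x _; rewrite lee_fin mulr_ge0 // powR_ge0.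
Qed.

Lemma LnormE f : ('N[mu]_p%:E[EFin \o absw f] = Lp_integral f `^ p^-1)%E.
Proof.
rewrite unlock Lp_integralE; congr (_ `^ _)%E.
apply: eq_integral => x _ /=; rewrite ger0_norm //.
by rewrite /absw mulr_ge0.
Qed.

Lemma Lp_norm_Lnorm f : finite_Lp f ->
  (Lp_norm f)%:E = ('N[mu]_p%:E[EFin \o absw f])%E.
Proof.
move=> [_ fin]; rewrite LnormE /Lp_norm -poweR_EFin fineK //.
by rewrite ge0_fin_numE // Lp_integral_ge0.
Qed.

Lemma cmeasurableD f g : cmeasurable f -> cmeasurable g -> cmeasurable (f + g).
Proof.
move=> [fr fi] [gr gi]; split.
  rewrite (_ : (fun x : borel G => _) = (fun x : borel G =>
    complex.Re (f x) + complex.Re (g x))); first exact: measurable_funD.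
  by apply/funext => x; rewrite fctE; case: (f x) (g x) => [a b] [c d].
rewrite (_ : (fun x : borel G => _) = (fun x : borel G =>
  complex.Im (f x) + complex.Im (g x))); first exact: measurable_funD.
by apply/funext => x; rewrite fctE; case: (f x) (g x) => [a b] [c d].
Qed.

Lemma cmeasurableZ (k : R[i]) f : cmeasurable f -> cmeasurable (k *: f).
Proof.
move=> [fr fi]; split.
  rewrite (_ : (fun x : borel G => _) = (fun x : borel G =>
    complex.Re k * complex.Re (f x) - complex.Im k * complex.Im (f x))).
    by apply: measurable_funB; apply: measurable_funM.
  by apply/funext => x; rewrite fctE; case: (f x) k => [a b] [c d].
rewrite (_ : (fun x : borel G => _) = (fun x : borel G =>
  complex.Re k * complex.Im (f x) + complex.Im k * complex.Re (f x))).
  by apply: measurable_funD; apply: measurable_funM.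
by apply/funext => x; rewrite fctE; case: (f x) k => [a b] [c d].
Qed.

Lemma LnormD f g : cmeasurable f -> cmeasurable g ->
  ('N[mu]_p%:E[EFin \o absw (f + g)%R] <=
   'N[mu]_p%:E[EFin \o absw f] + 'N[mu]_p%:E[EFin \o absw g])%E.
Proof.
move=> mf mg.
apply: (@le_trans _ _ ('N[mu]_p%:E[EFin \o (absw f \+ absw g)%R])%E); last first.
  by apply: minkowski_EFin; [exact: measurable_absw..|exact: ltW].
have absD x : absw (f + g) x <= absw f x + absw g x.
  by rewrite /absw -mulrDl ler_wpM2r // fctE le_normcD.
have abs_ge0 h x : 0 <= absw h x by rewrite /absw mulr_ge0.
rewrite unlock; apply: gt0_ler_poweR.
- by rewrite invr_ge0 ltW.
- by rewrite in_itv/= leey andbT integral_ge0 // => x _; rewrite lee_fin powR_ge0.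
- by rewrite in_itv/= leey andbT integral_ge0 // => x _; rewrite lee_fin powR_ge0.
apply: ge0_le_integral => //=.
- apply: (@measurable_abs_powR (absw (f + g))).
  by apply: measurable_absw; exact: cmeasurableD.
- apply: (@measurable_abs_powR (absw f \+ absw g)).
  by apply: measurable_funD; apply: measurable_absw.
- move=> x _; rewrite lee_fin !ger0_norm ?addr_ge0 //.
  by rewrite ge0_ler_powR ?nnegrE ?addr_ge0 // ltW.
Qed.

Lemma Lp_integralZ (k : R[i]) f : cmeasurable f ->
  (Lp_integral (k *: f) = (normc k `^ p)%:E * Lp_integral f)%E.
Proof.
move=> mf; rewrite !Lp_integralE -ge0_integralZl_EFin ?powR_ge0 //=.
- apply: eq_integral => x _; rewrite -EFinM -powRM ?mulr_ge0 //.
  by rewrite /absw fctE normcM mulrA.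
- by move=> x _; rewrite lee_fin powR_ge0.
- apply/measurable_EFinP; apply: measurableT_comp_powR.
  by apply: measurable_absw.
Qed.

Lemma finite_Lp_submod_closed : submod_closed finite_Lp_pred.
Proof.
have lty f : finite_Lp f -> ('N[mu]_p%:E[EFin \o absw f] < +oo)%E.
  by move=> ff; rewrite -Lp_norm_Lnorm // ltry.
split=> [|k f g].
  apply/asboolP; split.
    by split; exact: measurable_cst.
  rewrite /Lp_integral; under eq_integral => x _.
    rewrite /= expr0n /= addr0 sqrtr0 powR0 ?gt_eqF // mul0r; over.
  by rewrite integral0 ltry.
move=> /asboolP ff /asboolP fg; apply/asboolP.
have [[mf fif] [mg _]] := (ff, fg).
have fkf : finite_Lp (k *: f).
  split; first exact: cmeasurableZ.
  rewrite Lp_integralZ //; apply: lte_mul_pinfty => //.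
  by rewrite lee_fin powR_ge0.
have mkfg : cmeasurable (k *: f + g).
  by apply: cmeasurableD => //; apply: cmeasurableZ.
split=> //; have := LnormD (cmeasurableZ k mf) mg.
rewrite [X in (X <= _)%E]LnormE => /le_lt_trans h.
have /h : ('N[mu]_p%:E[EFin \o absw (k *: f)%R] +
           'N[mu]_p%:E[EFin \o absw g] < +oo)%E.
  by apply: lte_add_pinfty; apply: lty.
by apply: lty_poweRy; rewrite gt_eqF // invr_gt0.
Qed.

Lemma Lp_normD f g : finite_Lp f -> finite_Lp g ->
  Lp_norm (f + g) <= Lp_norm f + Lp_norm g.
Proof.
move=> ff fg; have ffg : finite_Lp (f + g).
  have [_ /(_ 1 f g)] := finite_Lp_submod_closed.
  by rewrite scale1r => h; apply/asboolP/h; apply/asboolP.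
have [[mf _] [mg _]] := (ff, fg); have := LnormD mf mg.
rewrite -(Lp_norm_Lnorm ff).
rewrite -(Lp_norm_Lnorm fg).
rewrite -(Lp_norm_Lnorm ffg).
by rewrite -EFinD lee_fin.
Qed.

Lemma Lp_normZ (k : R[i]) f : finite_Lp f ->
  Lp_norm (k *: f) = normc k * Lp_norm f.
Proof.
move=> [mf fif]; rewrite /Lp_norm Lp_integralZ // fineM //; last first.
  by rewrite ge0_fin_numE // Lp_integral_ge0.
rewrite powRM ?powR_ge0 ?fine_ge0 ?Lp_integral_ge0 //.
by rewrite -powRrM divff ?gt_eqF // powRr1.
Qed.

Lemma Lp_norm_eq0 f : finite_Lp f -> Lp_norm f = 0 ->
  {ae mu, forall x : borel G, f x = 0}.
Proof.
move=> ff N0; have [mf _] := ff.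
have mE : measurable_fun [set: borel G] (EFin \o absw f).
  by apply/measurable_EFinP; exact: measurable_absw.
have L0 : ('N[mu]_p%:E[EFin \o absw f] = 0)%E by rewrite -(Lp_norm_Lnorm ff) N0.
have := Lnorm_eq0_eq0 mE _ L0; rewrite lte_fin => /(_ p0).
apply: filterS => x /(_ I) /= [] /eqP; rewrite mulf_eq0.
have w0 : 0 < omega x by rewrite (lt_le_trans _ (weight_ge1 omega x)).
by rewrite (gt_eqF w0) orbF => /eqP/eq0_normc.
Qed.

Lemma Lp_norm_ae f g : {ae mu, forall x : borel G, f x = g x} ->
  cmeasurable f -> cmeasurable g -> Lp_norm f = Lp_norm g.
Proof.
move=> fg mf mg; rewrite /Lp_norm; congr (fine _ `^ _).
have mI h : cmeasurable h ->
    measurable_fun [set: borel G] (fun x => (absw h x `^ p)%:E).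
  move=> mh; apply/measurable_EFinP; apply: measurableT_comp_powR.
  exact: measurable_absw.
rewrite !Lp_integralE; apply: ae_eq_integral => //; [exact: mI..|].
by apply: filterS fg => x fgx _; rewrite /absw fgx.
Qed.

End Lp_functions.

Section Lp_space.
Context {R : realType} {G : topologicalZmodType}.
Variables (mu : {measure set (borel G) -> \bar R}) (omega : weight R G).
Variables (p : R) (p1 : 1 < p).

(* The closure properties depend on 1 < p, which is therefore a parameter of
   the types. *)
Definition Lp_pred of 1 < p : {pred G -> R[i]} := finite_Lp_pred mu omega p.

HB.instance Definition _ := GRing.isSubmodClosed.Build R[i] (G -> R[i])
  (Lp_pred p1) (finite_Lp_submod_closed mu omega p1).

Record Lp_fun : Type := LpFun {
  Lp_fun_val :> G -> R[i];
  Lp_funP : Lp_fun_val \in Lp_pred p1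
}.

HB.instance Definition _ := [isSub for Lp_fun_val].
HB.instance Definition _ := [Choice of Lp_fun by <:].
HB.instance Definition _ := [SubChoice_isSubLmodule of Lp_fun by <:].

Lemma Lp_fun_finite (f : Lp_fun) : finite_Lp mu omega p f.
Proof. exact/asboolP/Lp_funP. Qed.

Definition Lp_eq (f g : Lp_fun) : bool :=
  `[< {ae mu, forall x : borel G, f x = g x} >].

Let Lp_eq_refl : reflexive Lp_eq.
Proof. by move=> f; apply/asboolP; apply: aeW. Qed.

Let Lp_eq_sym : symmetric Lp_eq.
Proof.
by move=> f g; apply/idP/idP => /asboolP fg; apply/asboolP;
  apply: filterS fg => x ->.
Qed.

Let Lp_eq_trans : transitive Lp_eq.
Proof.
move=> g f h /asboolP fg /asboolP gh; apply/asboolP.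
by apply: filterS2 fg gh => x ->.
Qed.

Canonical Lp_eq_equiv := EquivRel Lp_eq Lp_eq_refl Lp_eq_sym Lp_eq_trans.

Definition Lp : Type := {eq_quot Lp_eq}.

HB.instance Definition _ := Choice.on Lp.
HB.instance Definition _ := EqQuotient.on Lp.

Definition Lp_class (f : Lp_fun) : Lp := \pi_Lp f.

Lemma Lp_classP (f g : Lp_fun) :
  Lp_class f = Lp_class g <-> {ae mu, forall x : borel G, f x = g x}.
Proof.
split=> [/eqP|fg]; first by rewrite eqmodE => /asboolP.
by apply/eqP; rewrite eqmodE; apply/asboolP.
Qed.

Lemma Lp_reprK (a : Lp) : Lp_class (repr a) = a.
Proof. exact: reprK. Qed.

Lemma Lp_repr_class (f : Lp_fun) :
  {ae mu, forall x : borel G, repr (Lp_class f) x = f x}.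
Proof. by apply/Lp_classP; rewrite Lp_reprK. Qed.

Definition Lp_add (a b : Lp) : Lp := Lp_class (repr a + repr b).
Definition Lp_opp (a : Lp) : Lp := Lp_class (- repr a).
Definition Lp_scale (k : R[i]) (a : Lp) : Lp := Lp_class (k *: repr a).

Let pi_add (f g : Lp_fun) :
  Lp_add (Lp_class f) (Lp_class g) = Lp_class (f + g).
Proof.
apply/Lp_classP; apply: filterS2 (Lp_repr_class f) (Lp_repr_class g) => x.
by rewrite /= !fctE => -> ->.
Qed.

Let pi_opp (f : Lp_fun) : Lp_opp (Lp_class f) = Lp_class (- f).
Proof.
by apply/Lp_classP; apply: filterS (Lp_repr_class f) => x; rewrite /= !fctE => ->.
Qed.

Let pi_scale k (f : Lp_fun) : Lp_scale k (Lp_class f) = Lp_class (k *: f).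
Proof.
by apply/Lp_classP; apply: filterS (Lp_repr_class f) => x; rewrite /= !fctE => ->.
Qed.

Let Lp_ind (P : Lp -> Prop) : (forall f, P (Lp_class f)) -> forall a, P a.
Proof. by move=> Pf a; rewrite -(Lp_reprK a). Qed.

Let Lp_addA : associative Lp_add.
Proof.
by elim/Lp_ind => f; elim/Lp_ind => g; elim/Lp_ind => h; rewrite !pi_add addrA.
Qed.

Let Lp_addC : commutative Lp_add.
Proof. by elim/Lp_ind => f; elim/Lp_ind => g; rewrite !pi_add addrC. Qed.

Let Lp_add0 : left_id (Lp_class 0) Lp_add.
Proof. by elim/Lp_ind => f; rewrite pi_add add0r. Qed.

Let Lp_addN : left_inverse (Lp_class 0) Lp_opp Lp_add.
Proof. by elim/Lp_ind => f; rewrite pi_opp pi_add addNr. Qed.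

HB.instance Definition _ :=
  GRing.isZmodule.Build Lp Lp_addA Lp_addC Lp_add0 Lp_addN.

Lemma Lp_classD (f g : Lp_fun) : Lp_class (f + g) = Lp_class f + Lp_class g.
Proof. by rewrite -pi_add. Qed.

Let Lp_scaleA k l (a : Lp) : Lp_scale k (Lp_scale l a) = Lp_scale (k * l) a.
Proof. by elim/Lp_ind: a => f; rewrite !pi_scale scalerA. Qed.

Let Lp_scale1 : left_id 1 Lp_scale.
Proof. by elim/Lp_ind => f; rewrite pi_scale scale1r. Qed.

Let Lp_scaleDr : right_distributive Lp_scale +%R.
Proof.
move=> k; elim/Lp_ind => f; elim/Lp_ind => g.
by rewrite -Lp_classD !pi_scale scalerDr Lp_classD.
Qed.

Let Lp_scaleDl a : {morph Lp_scale^~ a : k l / k + l}.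
Proof.
by elim/Lp_ind: a => f k l; rewrite !pi_scale scalerDl Lp_classD.
Qed.

HB.instance Definition _ := GRing.Zmodule_isLmodule.Build R[i] Lp
  Lp_scaleA Lp_scale1 Lp_scaleDr Lp_scaleDl.

Lemma Lp_classZ k (f : Lp_fun) : Lp_class (k *: f) = k *: Lp_class f.
Proof. by rewrite -pi_scale. Qed.

(* Library norms take values in the scalar field. *)
Definition Lp_normC (a : Lp) : R[i] := (Lp_norm mu omega p (repr a))%:C%C.

Lemma Lp_normC_class (f : Lp_fun) :
  Lp_normC (Lp_class f) = (Lp_norm mu omega p f)%:C%C.
Proof.
have [mr _] := Lp_fun_finite (repr (Lp_class f)).
have [mf _] := Lp_fun_finite f.
have := Lp_norm_ae omega p (Lp_repr_class f) mr mf.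
by rewrite /Lp_normC => ->.
Qed.

Let Lp_normCD (a b : Lp) : Lp_normC (a + b) <= Lp_normC a + Lp_normC b.
Proof.
elim/Lp_ind: a => f; elim/Lp_ind: b => g; rewrite -Lp_classD !Lp_normC_class.
rewrite -rmorphD lecR; apply: Lp_normD => //; exact: Lp_fun_finite.
Qed.

Let Lp_normCZ k (a : Lp) : Lp_normC (k *: a) = `|k| * Lp_normC a.
Proof.
elim/Lp_ind: a => f; rewrite -Lp_classZ !Lp_normC_class.
rewrite (_ : Lp_norm _ _ _ _ = normc k * Lp_norm mu omega p f).
  by rewrite rmorphM.
by apply: Lp_normZ => //; exact: Lp_fun_finite.
Qed.

Let Lp_normC_eq0 (a : Lp) : Lp_normC a = 0 -> a = 0.
Proof.
elim/Lp_ind: a => f; rewrite Lp_normC_class => -[f0].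
by apply/Lp_classP; apply: Lp_norm_eq0 f0 => //; exact: Lp_fun_finite.
Qed.

HB.instance Definition _ := Lmodule_isNormed.Build R[i] Lp
  Lp_normCD Lp_normCZ Lp_normC_eq0.

End Lp_space.

Arguments Lp_class {R G mu omega p p1} f.

Lemma Lp_class_norm (R : realType) (G : topologicalZmodType)
    (mu : {measure set (borel G) -> \bar R}) (omega : weight R G)
    (p : R) (p1 : 1 < p) (f : Lp_fun mu omega p1) :
  `|Lp_class f| = (Lp_norm mu omega p f)%:C%C.
Proof. exact: Lp_normC_class. Qed.

Section Lp_operations.
Context {R : realType} {G : topologicalZmodType}.
Variables (mu : {measure set (borel G) -> \bar R}) (omega : weight R G).
Variables (p : R) (p1 : 1 < p).
Local Notation L := (Lp mu omega p1).
Local Notation LF := (Lp_fun mu omega p1).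

(* h = f * g: the convolution integral converges absolutely for almost every x
   and its value is h x. *)
Definition is_convolution (f g h : G -> R[i]) : Prop :=
  {ae mu, forall x : borel G,
    cintegrable mu (fun y : G => f y * g (x - y)) /\
    h x = cintegral mu (fun y : G => f y * g (x - y))}.

Definition involution (f : G -> R[i]) : G -> R[i] := fun x => (f (- x))^*%C.

(* [convolution_product] and [involution_map] determine [mul] and [star]
   uniquely, and contain the facts that L^p(G, omega) is stable under the two
   operations and that these do not depend on the choice of representatives. *)
Definition convolution_product (mul : L -> L -> L) : Prop :=
  forall f g : LF, exists h : LF,
    is_convolution f g h /\ mul (Lp_class f) (Lp_class g) = Lp_class h.

Definition involution_map (star : L -> L) : Prop :=
  forall f : LF, exists h : LF,
    (h : G -> R[i]) = involution f /\ star (Lp_class f) = Lp_class h.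

End Lp_operations.

(* Banach *-algebras need not have a unit, so the multiplication is not that
   of a library ring structure. *)
Record banach_star_algebra (R : realType) (A : normedModType R[i])
    (mul : A -> A -> A) (star : A -> A) : Prop := BanachStarAlgebra {
  bsa_complete : forall F : set_system A, ProperFilter F -> cauchy F -> cvg F;
  bsa_mulA : associative mul;
  bsa_mulDl : left_distributive mul +%R;
  bsa_mulDr : right_distributive mul +%R;
  bsa_mulZl : forall (k : R[i]) a b, mul (k *: a) b = k *: mul a b;
  bsa_mulZr : forall (k : R[i]) a b, mul a (k *: b) = k *: mul a b;
  bsa_normM : forall a b, `|mul a b| <= `|a| * `|b|;
  bsa_starK : involutive star;
  bsa_starD : {morph star : a b / a + b};
  bsa_starZ : forall (k : R[i]) a, star (k *: a) = (k^*)%C *: star a;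
  bsa_starM : forall a b, star (mul a b) = mul (star b) (star a);
  bsa_norm_star : forall a, `|star a| = `|a|
}.

Section spectrum.
Context {R : realType} {A : lmodType R[i]}.
Variable mul : A -> A -> A.

Definition is_unit_element (e : A) : Prop :=
  forall a, mul e a = a /\ mul a e = a.

(* The unitization A + C1, with unit (0, 1). *)
Definition unitization_mul (x y : A * R[i]) : A * R[i] :=
  (mul x.1 y.1 + x.2 *: y.1 + y.2 *: x.1, x.2 * y.2).

Definition invertible {B : Type} (m : B -> B -> B) (e x : B) : Prop :=
  exists y, m x y = e /\ m y x = e.

(* Spectrum in A if A has a unit, and in the unitization otherwise. *)
Definition spectrum (a : A) : set R[i] := [set l |
  (exists2 e, is_unit_element e & ~ invertible mul e (a - l *: e)) \/
  ((~ exists e, is_unit_element e) /\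
   ~ invertible unitization_mul (0, 1) (a, - l))].

(* In the order of R[i], 0 <= l means that l is real and nonnegative. *)
Definition symmetric_star_algebra (star : A -> A) : Prop :=
  forall a, spectrum (mul (star a) a) `<=` [set l | 0 <= l].

End spectrum.

(* Main.v *)
Require Import Defs.
From HB Require Import structures.
From mathcomp Require Import all_boot all_order all_algebra finmap.
From mathcomp Require Import all_classical all_reals all_analysis.
From mathcomp Require Import measurable_realfun complex.
From mathcomp Require Import ring lra.

(** Let [b] be the product of [star a] and [a], and let [l] be a scalar that is
    not a nonnegative real.  It suffices to solve [b c - l c = v] for every [v];
    this gives the inverse in the unital and in the non-unital case.  By (LPAlg)
    the masses J(n) of [omega^-q] on K^n, with K a compact symmetric generating
    neighbourhood, satisfy J(2n) >= J(n)^2; they grow subexponentially, so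
    J(n) <= 1 and the L^p norm dominates the L^1 norm.

    For bounded g with support in some K^N, convolution by g* g is a positive
    operator on L^2 of norm at most c^2, where c bounds the L^1 norm of g.  If z
    is such that |z| and |c^2 - z| are at most s, then (g* g - z)^n g* g is
    pointwise O(s^n) and supported in K^(2N(n+1)), where Haar measure and the
    weight are subexponential; hence its L^p norm is O(t^n) for every t > s.
    Approximating [a] by such g and using that the algebra is commutative,
    multiplication by [b - z] has spectral radius at most s, with
    s = max(|z|, |M - z|) and M = (|a| + 1)^2.  A disc that contains 0 and M but
    not [l] provides z with s < |l - z|, and a Neumann series concludes. *)

Set Implicit Arguments.
Unset Strict Implicit.
Unset Printing Implicit Defensive.

Import Order.TTheory GRing.Theory Num.Theory.
Import numFieldNormedType.Exports.
Import ComplexField.Normc.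

Local Open Scope classical_set_scope.
Local Open Scope ring_scope.

(** * Borel sets and Haar measure *)

(** Polynomial growth makes [G] a countable union of compact sets. Hence Haar measure is
    sigma-finite and Fubini's theorem applies, but only to functions measurable for the product of
    the Borel sigma-algebras; the hypothesis [diff_ae] of the later sections supplies such a version
    of f (x - y). Bounding the powers of b = g* g about 0 alone would confine its spectrum to a
    disc. The bound is therefore proved for b - z with a movable centre z: the closed discs that
    contain 0 and M meet exactly in the segment [0, M]. On L^2 it is one quadratic inequality
    between squared norms of functions of bounded support. The extra factor g* turns the L^2 bound
    into a pointwise bound, by Cauchy-Schwarz, and passing from there to L^p costs only powers of
    the measure and of the weight of the support, which are absorbed in t > s. The summand 1 in M =
    (|a| + 1)^2 makes the same M serve all g with |a - g| <= 1. *)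

Lemma compact_finite_cover (T : topologicalType) (K : set T) :
  compact K -> cover_compact K.
Proof.
move=> cK; have [->|/set0P[x0 _]] := eqVneq K set0.
  by move=> I D f _ _; exists fset0.
(* A point of [K] serves as the base point that [compact_cover] asks for. *)
pose T' : ptopologicalType := HB.pack (Topological.sort T) (isPointed.Build T x0).
by have := cK; rewrite -[compact K]/(@compact T' K) compact_cover.
Qed.

(** * Interpolation between compact and open sets *)

Section locally_compact_spaces.
Context {T : topologicalType}.
Hypothesis T_hausdorff : hausdorff_space T.
Hypothesis T_locally_compact : locally_compact [set: T].

Lemma compact_nbhs_sub (x : T) (U : set T) : open U -> U x ->
  exists V, [/\ nbhs x V, compact V & V `<=` U].
Proof.
move=> oU Ux; have [B] := T_locally_compact (I : [set: T] x).
rewrite withinET => Bx [cB clB].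
have [V Vx VU] := compact_regular T_hausdorff cB Bx (open_nbhs_nbhs (conj oU Ux)).
exists (closure V `&` B); split.
- by apply: filterI => //; apply: filterS Vx; exact: subset_closure.
- by apply: (subclosed_compact _ cB); [apply: closedI => //; exact: closed_closure|apply: subIsetr].
- by move=> y [/VU].
Qed.

Lemma compact_interpolation (K U : set T) : compact K -> open U -> K `<=` U ->
  exists L, [/\ compact L, K `<=` L° & L `<=` U].
Proof.
move=> cK oU KU.
have /choice[V VP] : forall x, exists V, U x -> [/\ nbhs x V, compact V & V `<=` U].
  move=> x; have [/(compact_nbhs_sub oU)[V VP]|nU] := pselect (U x).
    by exists V.
  by exists set0.
have /compact_finite_cover/(_ T K (fun x => (V x)°)) := cK.
case.
- by move=> x _; exact: open_interior.
- by move=> x Kx; exists x => //; have [Vx _ _] := VP _ (KU _ Kx).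
move=> D DK KD.
have DVP x : x \in D -> [/\ nbhs x (V x), compact (V x) & V x `<=` U].
  by move=> /DK/set_mem/KU/VP.
exists (\bigcup_(x in [set` D]) V x); split.
- rewrite bigcup_fset; rewrite big_seq.
  by apply: bigsetU_compact => x /DVP[].
- move=> x /KD[y Dy Vyx]; apply: filterS Vyx => z Vyz; by exists y.
- by move=> x [y /DVP[_ _ VU] /VU].
Qed.

(** Interpolation is iterated from [K]: each compact set lies in the interior of the next one, which
    makes the union open. *)
Lemma sigma_compact_interpolation (K U : set T) :
    compact K -> open U -> K `<=` U ->
  exists L : (set T)^nat, [/\ forall n, compact (L n),
    open (\bigcup_n L n), K `<=` \bigcup_n L n & \bigcup_n L n `<=` U].
Proof.
move=> cK oU KU.
have /choice[f fP] : forall K, exists L, compact K -> K `<=` U ->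
    [/\ compact L, K `<=` L° & L `<=` U].
  move=> K'; have [[cK' K'U]|nU] := pselect (compact K' /\ K' `<=` U).
    by have [L LP] := compact_interpolation cK' oU K'U; exists L.
  by exists set0 => ? ?; case: nU.
have iP n : compact (iter n f K) /\ iter n f K `<=` U.
  by elim: n => [//|n [cn nU]] /=; have [] := fP _ cn nU.
exists (fun n => iter n f K); split.
- by move=> n; exact: (iP n).1.
- rewrite openE => x [n _ nx]; rewrite /interior.
  have [_ /(_ _ nx) + _] := fP _ (iP n).1 (iP n).2.
  by apply: filterS => y ny; exists n.+1.
- by move=> x Kx; exists 0%N.
- by move=> x [n _ nx]; exact: (iP n).2.
Qed.

End locally_compact_spaces.

Section sigma_compact_boxes.
Context {T U : topologicalType}.
Implicit Types (O : set (T * U)).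

Lemma open_box O (z : T * U) : open O -> O z ->
  exists A B, [/\ open A, open B, A z.1, B z.2 & A `*` B `<=` O].
Proof.
move=> oO Oz; have [[P Q] /= [Pz Qz] PQO] := open_nbhs_nbhs (conj oO Oz).
exists P°, Q°; split; [exact: open_interior|exact: open_interior|exact: Pz|
  exact: Qz|].
move=> [a b] /= [Pa Qb]; apply: PQO; split => /=.
  exact: interior_subset Pa.
exact: interior_subset Qb.
Qed.

(** Each compact piece is covered by finitely many of the open boxes inside [O], so countably many
    boxes fill [O]. This puts [O] into the product sigma-algebra. *)
Lemma sigma_compact_open_boxes (J : countType) O (C : J -> set (T * U)) : open O ->
    (forall n, compact (C n)) -> O = \bigcup_n C n ->
  exists D : set (set T * set U), [/\ countable D,
    forall P, D P -> open P.1 /\ open P.2 & O = \bigcup_(P in D) (P.1 `*` P.2)].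
Proof.
move=> oO cC OE.
pose I := (set T * set U)%type.
pose B := [set P : I | [/\ open P.1, open P.2 & P.1 `*` P.2 `<=` O]].
have /choice[D DP] : forall n, exists D : set I, [/\ finite_set D, D `<=` B &
    C n `<=` \bigcup_(P in D) (P.1 `*` P.2)].
  move=> n; have /compact_finite_cover := cC n.
  move=> /(_ I B (fun P => P.1 `*` P.2)); case.
  - move=> [P Q] [/= oP oQ _].
    rewrite openE => -[x y] [/= Px Qy]; exists (P, Q) => //=.
    by split; exact: open_nbhs_nbhs.
  - move=> z Cz; have Oz : O z by rewrite OE; exists n.
    by have [P [Q [oP oQ Pz Qz PQ]]] := open_box oO Oz; exists (P, Q).
  - move=> D DB CD; exists [set` D]; split => //; first exact: finite_fset.
    by move=> P /DB/set_mem.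
exists (\bigcup_n D n); split.
- apply: bigcup_countable => // n _; apply: finite_set_countable.
  by have [] := DP n.
- by move=> P [n _ nP]; have [_ /(_ _ nP)[]] := DP n.
- apply/seteqP; split=> [z|z [P [n _ nP] Pz]].
    rewrite {1}OE => -[n _ Cz]; have [_ _ /(_ _ Cz)[P DP' Pz]] := DP n.
    by exists P => //; exists n.
  by have [_ /(_ _ nP)[_ _ PO] _] := DP n; exact: PO.
Qed.

End sigma_compact_boxes.

Section borel_group.
Variable G : topologicalZmodType.

Lemma borel_open (A : set G) : open A -> measurable (A : set (borel G)).
Proof. by move=> oA; apply: sub_sigma_algebra. Qed.

Lemma borel_closed (A : set G) : closed A -> measurable (A : set (borel G)).
Proof.
by move=> cA; rewrite -(setCK A); apply: measurableC; apply: borel_open;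
  exact: closed_openC.
Qed.

Lemma borel_continuous (f : G -> G) : continuous f ->
  measurable_fun [set: borel G] (f : borel G -> borel G).
Proof.
move=> cf; apply: (@measurability _ _ (borel G) (borel G) setT f (@open G)) => //.
move=> _ [B oB <-]; rewrite setTI; apply: borel_open.
by apply: open_comp => // x _; exact: cf.
Qed.

Lemma continuous_addr (a : G) : continuous (fun x : G => x + a).
Proof.
move=> x; apply: (@continuous_comp _ _ _ (fun x : G => (x, a))
  (fun z : G * G => z.1 + z.2)); last exact: add_continuous.
by apply: cvg_pair => /=; [exact: cvg_id|exact: cvg_cst].
Qed.

Lemma continuous_subl (a : G) : continuous (fun x : G => a - x).
Proof.
move=> x; apply: (@continuous_comp _ _ _ (fun x : G => (a, x))
  (fun z : G * G => z.1 - z.2)); last exact: sub_continuous.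
by apply: cvg_pair => /=; [exact: cvg_cst|exact: cvg_id].
Qed.

Lemma measurable_addr (a : G) :
  measurable_fun [set: borel G] ((fun x : G => x + a) : borel G -> borel G).
Proof. by apply: borel_continuous; exact: continuous_addr. Qed.

Lemma measurable_addl (a : G) :
  measurable_fun [set: borel G] ((fun x : G => a + x) : borel G -> borel G).
Proof.
by rewrite (_ : (fun _ => _) = (fun x => x + a)); [exact: measurable_addr|
  apply/funext => x; exact: addrC].
Qed.

Lemma measurable_subl (a : G) :
  measurable_fun [set: borel G] ((fun x : G => a - x) : borel G -> borel G).
Proof. by apply: borel_continuous; exact: continuous_subl. Qed.

Lemma measurable_oppr_borel :
  measurable_fun [set: borel G] ((fun x : G => - x) : borel G -> borel G).
Proof. by apply: borel_continuous; exact: opp_continuous. Qed.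

End borel_group.

Lemma countable_bigcup_measurable d (T : sigmaRingType d) (I : Type)
    (D : set I) (F : I -> set T) : countable D ->
  (forall i, D i -> measurable (F i)) -> measurable (\bigcup_(i in D) F i).
Proof.
move=> /countable_injP[f finj] mF.
(* The union is regrouped along an injection [f] of [D] into the natural numbers; each inner union
   has at most one member. *)
rewrite (_ : \bigcup_(i in D) F i =
  \bigcup_n \bigcup_(i in D `&` f @^-1` [set n]) F i); last first.
  apply/seteqP; split=> [x [i Di Fix]|x [n _ [i [Di _] Fix]]].
    by exists (f i) => //; exists i.
  by exists i.
apply: bigcupT_measurable => n.
have [[i [Di fin]]|h] := pselect (exists i, D i /\ f i = n).
  rewrite (_ : \bigcup_(_ in _) _ = F i); first exact: mF.
  apply/seteqP; split=> [x [j [Dj fj] Fjx]|x Fix]; last by exists i.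
  have /finj -> // : f i = f j by rewrite fin fj.
    exact: mem_set.
  exact: mem_set.
rewrite (_ : \bigcup_(_ in _) _ = set0); first exact: measurable0.
by rewrite -subset0 => x [i [Di fin] _]; apply: h; exists i.
Qed.

(** * Sets and functions measurable after subtraction *)

Section difference_measurable.
Variable G : topologicalZmodType.
Hypothesis G_hausdorff : hausdorff_space G.
Implicit Types A : set G.

(* [borel G * borel G] carries the product sigma-algebra, which can be smaller than
   the Borel sigma-algebra of G * G, so that subtraction need not be measurable.
   Unions of sequences of compact sets that are open are nevertheless difference
   measurable, and up to null sets they generate all Borel sets. *)
Definition diff_measurable A :=
  measurable [set z : borel G * borel G | A (z.1 - z.2)].

(** [A] is the section at second coordinate 0 of its preimage under subtraction. *)
Lemma diff_measurable_borel A : diff_measurable A -> measurable (A : set (borel G)).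
Proof.
move=> mA; have := @measurable_ysection _ _ (borel G) (borel G) _ 0 mA.
congr measurable.
by apply/seteqP; split=> x; rewrite ysectionE /= subr0.
Qed.

Lemma diff_measurableC A : diff_measurable A -> diff_measurable (~` A).
Proof. exact: measurableC. Qed.

Lemma diff_measurable_bigcup (F : (set G)^nat) :
  (forall n, diff_measurable (F n)) -> diff_measurable (\bigcup_n F n).
Proof.
move=> mF; rewrite /diff_measurable.
rewrite (_ : [set z : borel G * borel G | _] =
  \bigcup_n [set z : borel G * borel G | F n (z.1 - z.2)]) //.
by apply: bigcup_measurable => n _; exact: mF.
Qed.

(** The preimage of the union under subtraction is open in G * G. It is also a countable union of
    compact sets, the closed preimages of the [L n] cut by the products C k * C l, so it is a
    countable union of open boxes. *)
Lemma sigma_compact_diff_measurable (C L : (set G)^nat) :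
    (forall n, compact (C n)) -> \bigcup_n C n = setT ->
    (forall n, compact (L n)) -> open (\bigcup_n L n) ->
  diff_measurable (\bigcup_n L n).
Proof.
move=> cC CT cL oL; set O := [set z : G * G | (\bigcup_n L n) (z.1 - z.2)].
have oO : open O by apply: open_comp => // z _; exact: sub_continuous.
have cO (i : nat * (nat * nat)) :
    compact ((C i.2.1 `*` C i.2.2) `&` [set z : G * G | L i.1 (z.1 - z.2)]).
  apply: (@subclosed_compact _ _ (C i.2.1 `*` C i.2.2)).
  - have cl1 : closed [set z : G * G | C i.2.1 z.1].
      apply: (@closed_comp _ _ fst); last exact: compact_closed.
      by move=> z _; exact: cvg_fst.
    have cl2 : closed [set z : G * G | C i.2.2 z.2].
      apply: (@closed_comp _ _ snd); last exact: compact_closed.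
      by move=> z _; exact: cvg_snd.
    apply: closedI; first exact: closedI.
    apply: (@closed_comp _ _ (fun z : G * G => z.1 - z.2)).
      by move=> z _; exact: sub_continuous.
    exact: compact_closed.
  - exact: compact_setX.
  - exact: subIsetl.
have [|D [cD oD OD]] := sigma_compact_open_boxes oO cO.
  apply/seteqP; split=> [z [n _ Lz]|z [i _ [_ Lz]]]; last by exists i.1.
  have [k _ Ck] : (\bigcup_n C n) z.1 by rewrite CT.
  have [l _ Cl] : (\bigcup_n C n) z.2 by rewrite CT.
  by exists (n, (k, l)).
rewrite /diff_measurable -/O OD; apply: countable_bigcup_measurable => //.
by move=> P /oD[oP1 oP2]; apply: measurableX; exact: borel_open.
Qed.

End difference_measurable.

Section translation_invariant_measure.
Context {R : realType} {G : topologicalZmodType}.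
Variable mu : {measure set (borel G) -> \bar R}.
Hypothesis mu_addr : forall (a : G) (A : set (borel G)), measurable A ->
  mu ((fun y : G => y + a) @^-1` A) = mu A.
Local Open Scope ereal_scope.

Lemma ge0_integral_addr (f : G -> \bar R) (a : G) :
    measurable_fun [set: borel G] f -> (forall x, 0 <= f x) ->
  \int[mu]_(x in [set: borel G]) f (x + a)%R = \int[mu]_(x in [set: borel G]) f x.
Proof.
move=> mf f0.
have := @ge0_integral_pushforward _ _ (borel G) (borel G) R _
  (measurable_addr a) mu setT f measurableT mf (fun x _ => f0 x).
rewrite preimage_setT => <-; apply: eq_measure_integral => [|? A mA _].
  by move=> *; exact: measurable_addr.
exact: mu_addr.
Qed.

End translation_invariant_measure.

Section reflection_invariant_measure.
Context {R : realType} {G : topologicalZmodType}.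
Variable mu : {measure set (borel G) -> \bar R}.
Hypothesis mu_oppr : forall (A : set (borel G)), measurable A ->
  mu ((fun y : G => - y) @^-1` A) = mu A.
Local Open Scope ereal_scope.

Lemma ge0_integral_oppr (f : G -> \bar R) :
    measurable_fun [set: borel G] f -> (forall x, 0 <= f x) ->
  \int[mu]_(x in [set: borel G]) f (- x)%R = \int[mu]_(x in [set: borel G]) f x.
Proof.
move=> mf f0.
have := @ge0_integral_pushforward _ _ (borel G) (borel G) R _
  (@measurable_oppr_borel G) mu setT f measurableT mf (fun x _ => f0 x).
rewrite preimage_setT => <-; apply: eq_measure_integral => [|? A mA _].
  by move=> *; exact: measurable_oppr_borel.
exact: mu_oppr.
Qed.

End reflection_invariant_measure.

Section difference_measurable_fun.
Context {d : measure_display} {S : measurableType d} {G : topologicalZmodType}.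

Definition diff_measurable_fun (f : G -> S) :=
  measurable_fun [set: borel G * borel G] (fun z => f (z.1 - z.2)).

Lemma diff_measurable_fun_add (f : G -> S) : diff_measurable_fun f ->
  measurable_fun [set: borel G * borel G] (fun z => f (z.1 + z.2)).
Proof.
move=> mf; rewrite (_ : (fun _ => _) = (fun z : borel G * borel G => f (z.1 - z.2))
  \o (fun z : borel G * borel G => (z.1, - z.2) : borel G * borel G)).
  apply: measurableT_comp => //; apply: measurable_fun_pair => //=.
  by apply: measurableT_comp => //; exact: measurable_oppr_borel.
by apply/funext => z /=; rewrite opprK.
Qed.

Lemma diff_measurable_fun_borel (f : G -> S) : diff_measurable_fun f ->
  measurable_fun [set: borel G] (f : borel G -> S).
Proof.
move=> mf; rewrite (_ : f = (fun z : borel G * borel G => f (z.1 - z.2))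
  \o (fun z : borel G => (z, 0) : borel G * borel G)).
  by apply: measurableT_comp => //; exact: measurable_fun_pair.
by apply/funext => z /=; rewrite subr0.
Qed.

End difference_measurable_fun.

Lemma diff_measurable_indic (R : realType) (G : topologicalZmodType) (A : set G) :
  diff_measurable A -> diff_measurable_fun (\1_A : G -> R).
Proof.
move=> mA; rewrite /diff_measurable_fun.
rewrite (_ : (fun _ => _) =
  \1_([set z : borel G * borel G | A (z.1 - z.2)]) :> (borel G * borel G -> R)).
  exact: measurable_indic.
by apply/funext => z; rewrite !indicE; congr (_ _)%:R; apply/idP/idP => /set_mem ?;
  apply/mem_set.
Qed.

(** * Tonelli's theorem for convolutions, and reflection *)

Section reflection_invariance.
Context {R : realType} {G : topologicalZmodType}.
Variable mu : {sigma_finite_measure set (borel G) -> \bar R}.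
Hypothesis mu_addr : forall (a : G) (A : set (borel G)), measurable A ->
  mu ((fun y : G => y + a) @^-1` A) = mu A.
Local Open Scope ereal_scope.

Lemma tonelli_swap (f : borel G * borel G -> \bar R) :
    measurable_fun setT f -> (forall z, 0 <= f z) ->
  \int[mu]_(x in [set: borel G]) \int[mu]_(y in [set: borel G]) f (x, y) =
  \int[mu]_(y in [set: borel G]) \int[mu]_(x in [set: borel G]) f (x, y).
Proof. by move=> mf f0; exact: (@fubini_tonelli _ _ _ _ _ mu mu f mf f0). Qed.

Lemma measurable_conv_integrand (f h : G -> \bar R) :
    measurable_fun [set: borel G] (f : borel G -> \bar R) -> diff_measurable_fun h ->
  measurable_fun [set: borel G * borel G] (fun z => f z.2 * h (z.1 - z.2)%R).
Proof. by move=> mf mh; apply: emeasurable_funM => //; exact: measurableT_comp. Qed.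

Lemma measurable_conv_ge0 (f h : G -> \bar R) :
    measurable_fun [set: borel G] (f : borel G -> \bar R) -> diff_measurable_fun h ->
    (forall x, 0 <= f x) -> (forall x, 0 <= h x) ->
  measurable_fun [set: borel G]
    (fun x : borel G => \int[mu]_(y in [set: borel G]) (f y * h (x - y)%R)).
Proof.
move=> mf mh f0 h0.
have mfh := measurable_conv_integrand mf mh.
apply: (@measurable_fun_fubini_tonelli_F _ _ _ _ _ mu _ mfh).
by move=> z; rewrite mule_ge0.
Qed.

Lemma integral_conv_diff (f h : G -> \bar R) :
    measurable_fun [set: borel G] (f : borel G -> \bar R) -> diff_measurable_fun h ->
    (forall x, 0 <= f x) -> (forall x, 0 <= h x) ->
  \int[mu]_(x in [set: borel G]) \int[mu]_(y in [set: borel G]) (f y * h (x - y)%R) =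
  (\int[mu]_(x in [set: borel G]) f x) * (\int[mu]_(x in [set: borel G]) h x).
Proof.
move=> mf mh f0 h0; have mh' := diff_measurable_fun_borel mh.
have := tonelli_swap (measurable_conv_integrand mf mh).
rewrite /= => -> => [|z]; last by rewrite mule_ge0.
rewrite muleC -ge0_integralZl //; last exact: integral_ge0.
apply: eq_integral => y _; rewrite muleC -ge0_integralZl //.
rewrite -(@ge0_integral_addr _ _ mu mu_addr (fun x => f y * h x) (- y)%R) //.
  exact: emeasurable_funM.
by move=> x; rewrite mule_ge0.
Qed.

(* Both iterated integrals of [f y * h (x - y)] are computed by translation:
   one is the product of the integrals of [f] and [h], the other that of the
   integrals of [f] and of [h] reflected. *)
Lemma integral_reflect_diff (f h : G -> \bar R) :
    diff_measurable_fun f -> diff_measurable_fun h ->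
    (forall x, 0 <= f x) -> (forall x, 0 <= h x) ->
    0 < \int[mu]_(x in [set: borel G]) f x < +oo ->
  \int[mu]_(x in [set: borel G]) h (- x)%R = \int[mu]_(x in [set: borel G]) h x.
Proof.
move=> mf mh f0 h0 /andP[If0 Ifoo].
have mf' := diff_measurable_fun_borel mf; have mh' := diff_measurable_fun_borel mh.
have mhN : measurable_fun [set: borel G] ((fun x => h (- x)%R) : borel G -> \bar R).
  by apply: measurableT_comp => //; exact: measurable_oppr_borel.
pose I := \int[mu]_(x in [set: borel G]) f x; have Ifin : I \is a fin_num.
  by rewrite ge0_fin_numE ?integral_ge0.
(* The integral of [f] is finite and positive, so it suffices to prove the equality after
   multiplication by it. *)
apply: (inc_inj (lee_pmul2r Ifin If0)); rewrite /I.
rewrite [RHS]muleC -[RHS](integral_conv_diff mf' mh f0 h0).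
transitivity (\int[mu]_(x in [set: borel G])
    \int[mu]_(y in [set: borel G]) (f (y + x)%R * h (- y)%R)); last first.
  apply: eq_integral => x _.
  rewrite -(@ge0_integral_addr _ _ mu mu_addr (fun y => f y * h (x - y)%R) x) //.
  - by apply: eq_integral => y _; rewrite opprD addrCA subrr addr0.
  - apply: emeasurable_funM => //.
    by apply: measurableT_comp => //; exact: measurable_subl.
  - by move=> y; rewrite mule_ge0.
rewrite (tonelli_swap (f := fun z => f (z.2 + z.1)%R * h (- z.2)%R)) /=.
- rewrite -ge0_integralZr //.
  apply: eq_integral => y _; rewrite ge0_integralZr //; last first.
    by apply: measurableT_comp => //; exact: measurable_addl.
  rewrite muleC; congr (_ * _).
  rewrite -(@ge0_integral_addr _ _ mu mu_addr f y) //.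
  by apply: eq_integral => x _; rewrite addrC.
- exact: integral_ge0.
- apply: emeasurable_funM; last first.
    exact: (measurableT_comp mhN (@measurable_snd _ _ (borel G) (borel G))).
  rewrite (_ : (fun _ => _) = fun z => f (z.1 + z.2)%R).
    exact: diff_measurable_fun_add.
  by apply/funext => z; rewrite addrC.
- by move=> z; rewrite mule_ge0.
Qed.

End reflection_invariance.

(** * Haar measure on a sigma-compact group *)

Section haar.
Context {R : realType} {G : topologicalZmodType}.
Variable mu : {measure set (borel G) -> \bar R}.
Hypothesis G_hausdorff : hausdorff_space G.
Hypothesis G_locally_compact : locally_compact [set: G].
Hypothesis mu_haar : haar_measure mu.
Variable C : (set G)^nat.
Hypothesis C_compact : forall n, compact (C n).
Hypothesis C_cover : \bigcup_n C n = setT.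
Local Open Scope ereal_scope.

Lemma compact_measurable (K : set G) : compact K -> measurable (K : set (borel G)).
Proof. by move=> cK; apply: borel_closed; exact: compact_closed. Qed.

Lemma haar_addr (a : G) (A : set (borel G)) : measurable A ->
  mu ((fun y : G => y + a)%R @^-1` A) = mu A.
Proof.
move=> mA; rewrite -(haar_translation mu_haar (- a)%R mA); congr (mu _).
apply/seteqP; split=> [y /= Ay|_ [y Ay <-] /=]; last by rewrite addrC addNKr.
by exists (y + a)%R => //; rewrite addrC addrK.
Qed.

Lemma haar_sigma_finite : sigma_finite [set: borel G] mu.
Proof.
exists C; first by rewrite C_cover.
by move=> i; split; [exact: compact_measurable|exact: haar_compact].
Qed.

Let sigma_mu := isSigmaFinite.Build _ _ _ mu haar_sigma_finite.
Let sfin_mu := isSFinite.Build _ _ _ mu (sfinite_measure_sigma_finite haar_sigma_finite).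
Definition haar_sigma_finite_measure : {sigma_finite_measure set (borel G) -> \bar R} :=
  HB.pack (Measure.sort mu) sigma_mu sfin_mu.

Lemma sigma_compact_between (K U : set G) : compact K -> open U -> K `<=` U ->
  exists A, [/\ diff_measurable A, K `<=` A, A `<=` U & exists L : (set G)^nat,
     (forall n, compact (L n)) /\ A = \bigcup_n L n].
Proof.
move=> cK oU KU.
have [L [cL oL KL LU]] := sigma_compact_interpolation G_hausdorff G_locally_compact cK oU KU.
exists (\bigcup_n L n); split => //; last by exists L.
exact: (sigma_compact_diff_measurable G_hausdorff C_compact).
Qed.

(** If the open set has finite measure, inner regularity gives compact subsets of almost full
    measure, each of which is enlarged to a difference measurable set that still lies in the open
    set. In general [U] is cut by the interiors of compact sets that cover [G]. *)
Lemma open_diff_measurable_ae (U : set G) : open U ->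
  exists2 A, diff_measurable A & {ae mu, forall x : borel G, U x <-> A x}.
Proof.
move=> oU.
have finite_case (V : set G) : open V -> mu V < +oo -> exists A : set G, [/\ diff_measurable A,
    A `<=` V & mu (V `\` A : set (borel G)) = 0].
  move=> oV Voo; have mV := borel_open oV.
  have Vfin : mu V \is a fin_num by rewrite ge0_fin_numE.
  have /choice[A AP] : forall n : nat, exists A : set G, [/\ diff_measurable A,
      A `<=` V & mu V - n.+1%:R^-1%:E < mu A].
    move=> n; have : mu V - n.+1%:R^-1%:E < mu V.
      by rewrite lteBlDr // lteDl // lte_fin invr_gt0.
    rewrite {2}(haar_inner_regular mu_haar oV) => /ereal_sup_gt[_ [K [cK KV] <-]] nK.
    have [A [dA KA AV _]] := sigma_compact_between cK oV KV.
    exists A; split => //; apply: (lt_le_trans nK); apply: le_measure => //.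
    - by rewrite inE; exact: compact_measurable.
    - by rewrite inE; exact: diff_measurable_borel.
  exists (\bigcup_n A n); split.
  - by apply: diff_measurable_bigcup => n; have [] := AP n.
  - by move=> x [n _]; have [_ AV _] := AP n; exact: AV.
  - apply/eqP; rewrite eq_le measure_ge0 andbT; apply/lee_addgt0Pr => _/posnumP[e].
    rewrite add0e; have [n ne] : exists n, (n.+1%:R^-1 < e%:num)%R.
      by have [n _ /(_ n (leqnn n))] := near_infty_natSinv_lt e; exists n.
    have [dA AV nA] := AP n; have mA := diff_measurable_borel dA.
    apply: (@le_trans _ _ (mu (V `\` A n : set (borel G)))).
      apply: le_measure; rewrite ?inE.
      - apply: measurableD => //; apply: diff_measurable_borel.
        by apply: diff_measurable_bigcup => m; have [] := AP m.
      - exact: measurableD.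
      - by apply: setDS; exact: bigcup_sup.
    rewrite measureD // (setIidr AV).
    apply: (@le_trans _ _ (n.+1%:R^-1%:E)); last by rewrite lee_fin ltW.
    have Afin : mu (A n) \is a fin_num.
      by rewrite ge0_fin_numE //; apply: le_lt_trans Voo; apply: le_measure; rewrite ?inE.
    by rewrite leeBlDr // addeC -leeBlDr // ltW.
have /choice[L LP] : forall n, exists L, [/\ compact L, C n `<=` L° & L `<=` setT].
  by move=> n; apply: (compact_interpolation G_hausdorff G_locally_compact) => //; exact: openT.
have /choice[A AP] : forall n, exists A : set G, [/\ diff_measurable A,
    A `<=` U `&` (L n)° & mu ((U `&` (L n)°) `\` A : set (borel G)) = 0].
  move=> n; apply: finite_case; first by apply: openI => //; exact: open_interior.
  have [cL _ _] := LP n; apply: (le_lt_trans _ (haar_compact mu_haar cL)).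
  apply: le_measure; rewrite ?inE.
  - by apply: borel_open; apply: openI => //; exact: open_interior.
  - exact: compact_measurable.
  - by move=> x [_ /interior_subset].
exists (\bigcup_n A n); first by apply: diff_measurable_bigcup => n; have [] := AP n.
have : mu.-negligible (\bigcup_n ((U `&` (L n)°) `\` A n : set (borel G))).
  apply: negligible_bigcup => n; apply/negligibleP; last by have [] := AP n.
  apply: measurableD; first by apply: borel_open; apply: openI => //; exact: open_interior.
  by apply: diff_measurable_borel; have [] := AP n.
apply: negligibleS => x /=; apply: contra_notP => nx; split => [Ux|[n _ Anx]].
  have [n _ Cnx] : (\bigcup_n C n) x by rewrite C_cover.
  have [_ /(_ _ Cnx) Lnx _] := LP n.
  by apply: contrapT => nA; apply: nx; exists n => //; split=> // Ax; apply: nA; exists n.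
by have [_ /(_ _ Anx)[]] := AP n.
Qed.

(** The sets that agree almost everywhere with a difference measurable one form a sigma-algebra, and
    it contains the open sets. *)
Lemma diff_measurable_ae (B : set (borel G)) : measurable B ->
  exists2 A, diff_measurable A & {ae mu, forall x : borel G, B x <-> A x}.
Proof.
move: B; apply: smallest_sub; last by move=> U /open_diff_measurable_ae.
split.
- exists set0; last exact: aeW.
  rewrite /diff_measurable (_ : mkset _ = set0) //; exact: measurable0.
- move=> B [A dA AB]; exists (~` A); first exact: diff_measurableC.
  apply: filterS AB => x xAB; split; [move=> [_ nB] /xAB //|].
  by move=> nA; split => // /xAB.
- move=> F /= FP.
  have /choice[A AP] n : exists A, diff_measurable A /\
    {ae mu, forall x : borel G, F n x <-> A x} by have [A] := FP n; exists A.
  exists (\bigcup_n A n); first by apply: diff_measurable_bigcup => n; have [] := AP n.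
  have : {ae mu, forall x : borel G, forall n, F n x <-> A n x}.
    by apply/ae_foralln => n; have [] := AP n.
  by apply: filterS => x h; split => -[n _ /h]; exists n.
Qed.

Lemma diff_measurable_fun_ae (f : G -> R) :
    measurable_fun [set: borel G] (f : borel G -> R) ->
  exists2 g : G -> R, diff_measurable_fun g & {ae mu, forall x : borel G, f x = g x}.
Proof.
move=> mf.
have /choice[A AP] : forall r : rat, exists A : set G, diff_measurable A /\
    {ae mu, forall x : borel G, (ratr r < f x)%R <-> A x}.
  move=> r; have [|A] := @diff_measurable_ae [set x : borel G | (ratr r < f x)%R].
    by rewrite -[X in measurable X]setTI; apply: measurable_fun_ltr.
  by exists A.
(* Off a null set this is the supremum of the rationals below [f x], hence [f x] itself; elsewhere
   it can be infinite, whence [fine] below. *)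
pose h (x : G) : \bar R := ereal_sup [set (ratr r)%:E | r in [set r | A r x]].
exists (fine \o h).
  apply: (@measurableT_comp _ _ _ _ _ _ fine) => //.
  apply: (@measurability _ _ (borel G * borel G)%type (\bar R) setT
    (fun z => h (z.1 - z.2)%R) _ (ErealGenOInfty.measurableE R)) => _ [_ [t ->] <-].
  rewrite setTI (_ : _ @^-1` _ = \bigcup_(r : rat) (if (t < ratr r)%R then
    [set z : borel G * borel G | A r (z.1 - z.2)%R] else set0)).
    apply: bigcupT_measurable_rat => r; case: ifPn => // _.
    by have [] := AP r.
  apply/seteqP; split=> z /=.
    rewrite in_itv /= andbT => /ereal_sup_gt[_ [r Ar <-]].
    by rewrite lte_fin => tr; exists r => //; rewrite tr.
  move=> [r _]; case: ifPn => // tr Ar; rewrite in_itv /= andbT.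
  apply: (@lt_le_trans _ _ (ratr r)%:E); first by rewrite lte_fin.
  by apply: ereal_sup_ubound; exists r.
(* The conditions for all rationals are collected along the enumeration [unpickle], so that one null
   set serves them all. *)
have : {ae mu, forall x : borel G, forall n, if (@choice.unpickle rat n) is Some r
    then (ratr r < f x)%R <-> A r x else True}.
  by apply/ae_foralln => n; case: choice.unpickle => [r|]; [have [] := AP r|exact: aeW].
apply: filterS => x Ax; have {}Ax r : (ratr r < f x)%R <-> A r x.
  by have := Ax (choice.pickle r); rewrite choice.pickleK.
suff hx : h x = (f x)%:E by rewrite /= hx.
apply/eqP; rewrite eq_le; apply/andP; split.
  by apply: ge_ereal_sup => _ [r /= /Ax rf <-]; rewrite lee_fin ltW.
apply/lee_subgt0Pr => e e0; have /rat_in_itvoo[r] : (f x - e < f x)%R.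
  by rewrite ltrBlDr ltrDl.
rewrite in_itv /= => /andP[er rf].
apply: (@le_trans _ _ (ratr r)%:E); first by rewrite -EFinB lee_fin ltW.
by apply: ereal_sup_ubound; exists r => //; apply/Ax.
Qed.

(** On difference measurable sets this is [integral_reflect_diff], tested against the indicator of a
    set of finite positive measure. Inner regularity then gives an inequality for open sets, which
    becomes an equality when applied to both U and -U, and outer regularity extends it to Borel
    sets. *)
Lemma haar_oppr (A : set (borel G)) : measurable A ->
  mu ((fun y : G => - y)%R @^-1` A) = mu A.
Proof.
have oppo (U : set G) : open U -> open ((fun y : G => - y)%R @^-1` U).
  by move=> oU; apply: open_comp => // x _; exact: opp_continuous.
have [B [dB B0 Boo]] : exists B : set G, [/\ diff_measurable B, 0 < mu B & mu B < +oo].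
  have [n Cn0] : exists n, 0 < mu (C n).
    apply: contrapT => h; apply: (haar_neq0 mu_haar); rewrite -C_cover.
    apply/negligibleP; first by apply: bigcup_measurable => n _; exact: compact_measurable.
    apply: negligible_bigcup => n; apply/negligibleP; first exact: compact_measurable.
    by apply/eqP; rewrite eq_le measure_ge0 andbT leNgt; apply/negP => Cn; apply: h; exists n.
  have [L [cL CL _]] := compact_interpolation G_hausdorff G_locally_compact
    (@C_compact n) openT (@subsetT _ _).
  have [B [dB CB BL _]] := sigma_compact_between (@C_compact n) (open_interior L) CL.
  have mB := diff_measurable_borel dB.
  exists B; split => //.
    by apply: (lt_le_trans Cn0); apply: le_measure; rewrite ?inE //; exact: compact_measurable.
  apply: (le_lt_trans _ (haar_compact mu_haar cL)); apply: le_measure; rewrite ?inE //.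
    exact: compact_measurable.
  by apply: subset_trans BL _; exact: interior_subset.
have diff_case (D : set G) : diff_measurable D -> mu ((fun y : G => - y)%R @^-1` D) = mu D.
  move=> dD.
  have := @integral_reflect_diff _ _ haar_sigma_finite_measure haar_addr
    (EFin \o \1_B) (EFin \o \1_D).
  have mi (E : set G) : diff_measurable E -> diff_measurable_fun (EFin \o (\1_E : G -> R)).
    by move=> dE; apply/measurable_EFinP; exact: diff_measurable_indic.
  move=> /(_ (mi _ dB) (mi _ dD)) /=.
  have mD := diff_measurable_borel dD.
  have mDN : measurable ((fun y : G => - y)%R @^-1` D : set (borel G)).
    by rewrite -[X in measurable X]setTI; exact: measurable_oppr_borel.
  rewrite !integral_indic ?setIT //; last exact: diff_measurable_borel.
  by apply; rewrite ?B0 ?Boo // => x; rewrite lee_fin.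
have open_case (U : set G) : open U -> mu U <= mu ((fun y : G => - y)%R @^-1` U).
  move=> oU; rewrite {1}(haar_inner_regular mu_haar oU).
  apply: ge_ereal_sup => _ [K [cK KU] <-].
  have [D [dD KD DU _]] := sigma_compact_between cK oU KU.
  have mD := diff_measurable_borel dD.
  apply: (@le_trans _ _ (mu D)).
    by apply: le_measure; rewrite ?inE //; exact: compact_measurable.
  rewrite -diff_case //; apply: le_measure; rewrite ?inE.
  - by rewrite -[X in measurable X]setTI; exact: measurable_oppr_borel.
  - by apply: borel_open; exact: oppo.
  - by move=> x /DU.
move=> mA; rewrite (haar_outer_regular mu_haar mA) haar_outer_regular //; last first.
  by rewrite -[X in measurable X]setTI; exact: measurable_oppr_borel.
have invol (E : set G) : (fun y : G => - y)%R @^-1` ((fun y : G => - y)%R @^-1` E) = E.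
  by apply/seteqP; split => x /=; rewrite opprK.
have openE (U : set G) : open U -> mu ((fun y : G => - y)%R @^-1` U) = mu U.
  move=> oU; apply/eqP; rewrite eq_le open_case // andbT.
  by rewrite -[X in _ <= mu X]invol; apply: open_case; exact: oppo.
congr ereal_inf; apply/seteqP; split=> _ [U [oU AU] <-].
  exists ((fun y : G => - y)%R @^-1` U); last exact: openE.
  by split; [exact: oppo|move=> x Ax; apply: AU => /=; rewrite opprK].
exists ((fun y : G => - y)%R @^-1` U); last exact: openE.
by split; [exact: oppo|move=> x /AU].
Qed.

End haar.

(** * Powers of a generating neighbourhood *)

Section sumsets.
Context {G : topologicalZmodType}.
Implicit Types U V : set G.

Lemma nfold_sumD U m n x y : nfold_sum U m x -> nfold_sum U n y ->
  nfold_sum U (m + n) (x + y).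
Proof.
elim: m x => [x -> ny|m IH x [u Uu [v mv <-]] ny]; first by rewrite add0r.
by exists u => //; exists (v + y); [exact: IH|rewrite addrA].
Qed.

Lemma nfold_sum_le U m n : U 0 -> (m <= n)%N -> nfold_sum U m `<=` nfold_sum U n.
Proof.
move=> U0 /subnKC <- x mx; rewrite -(addr0 x); apply: nfold_sumD => //.
by elim: (n - m)%N => [//|k IH]; exists 0 => //; exists 0 => //; rewrite addr0.
Qed.

Lemma nfold_sumM U m n x : nfold_sum (nfold_sum U m) n x -> nfold_sum U (n * m) x.
Proof.
elim: n x => [x -> //|n IH x [u Uu [v mv <-]]].
by rewrite mulSn; apply: nfold_sumD => //; exact: IH.
Qed.

Lemma nfold_sumS U V n : U `<=` V -> nfold_sum U n `<=` nfold_sum V n.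
Proof.
move=> UV; elim: n => [//|n IH] x [u Uu [v nv <-]].
by exists u; [exact: UV|exists v => //; exact: IH].
Qed.

Lemma nfold_sumN U n x : (forall y, U y -> U (- y)) ->
  nfold_sum U n x -> nfold_sum U n (- x).
Proof.
move=> UN; elim: n x => [x ->|n IH x [u Uu [v nv <-]]]; first by rewrite oppr0.
by exists (- u); [exact: UN|exists (- v); [exact: IH|rewrite opprD]].
Qed.

Lemma nfold_sum_compact U n : compact U -> compact (nfold_sum U n).
Proof.
move=> cU; elim: n => [|n IH]; first exact: compact_set1.
rewrite (_ : nfold_sum _ _ = (fun z : G * G => z.1 + z.2) @` (U `*` nfold_sum U n)).
  apply: continuous_compact; last exact: compact_setX.
  by apply: continuous_subspaceT => z; exact: add_continuous.
apply/seteqP; split => [x [u Uu [v nv <-]]|x [[u v] [/= Uu nv] <-]].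
  by exists (u, v).
by exists u => //; exists v.
Qed.

Lemma nfold_sum_interior U n : nbhs 0 U -> nfold_sum U n `<=` (nfold_sum U n.+1)°.
Proof.
move=> U0 x nx; have : nbhs x ((fun y => y - x) @^-1` U).
  by apply: continuous_addr; rewrite subrr.
by apply: filterS => y /= Uyx; exists (y - x) => //; exists x => //; rewrite subrK.
Qed.

Lemma compact_sub_nfold_sum U (K : set G) : nbhs 0 U ->
  \bigcup_n nfold_sum U n = setT -> compact K -> exists m, K `<=` nfold_sum U m.
Proof.
move=> U0 UT /compact_finite_cover /(_ nat setT (fun n => (nfold_sum U n)°)).
case.
- by move=> n _; exact: open_interior.
- move=> x _; have [n _ nx] : (\bigcup_n nfold_sum U n) x by rewrite UT.
  by exists n.+1 => //; exact: nfold_sum_interior.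
move=> D _ KD; exists (\max_(i <- D) i)%N => x /KD [n /= nD /interior_subset].
by apply: nfold_sum_le; [exact: nbhs_singleton|exact: leq_bigmax_seq].
Qed.

End sumsets.

(** * Subexponential growth of the sumsets *)

Section growth.
Context {R : realType}.

(** Bernoulli's inequality: n (s - 1) is at most [s ^+ n]. *)
Lemma natr_le_exp (s : R) : 1 < s -> exists2 c : R, 0 < c & forall n, n%:R <= c * s ^+ n.
Proof.
move=> s1; exists (s - 1)^-1 => [|n]; first by rewrite invr_gt0 subr_gt0.
rewrite mulrC ler_pdivlMr ?subr_gt0 //.
elim: n => [|n IH]; first by rewrite mul0r expr0 ler01.
rewrite exprS -natr1 mulrDl mul1r.
have : 1 <= s ^+ n by rewrite exprn_ege1 // ltW.
have := ltW s1; nra.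
Qed.

(** The exponent [Q] is at most some natural number [N.+1], and the linear bound is applied to the
    root of order [N.+1] of [t]. *)
Lemma powR_le_exp (C Q t : R) (m : nat) : 1 < t ->
  exists c : R, forall n, C * (n * m)%:R `^ Q <= c * t ^+ n.
Proof.
move=> t1; have [N QN] : exists N : nat, `|Q| <= N.+1%:R.
  exists (Num.truncn `|Q|); exact/ltW/truncnS_gt.
have t0 : 0 < t by exact: lt_trans t1.
pose s := t `^ (N.+1%:R^-1).
have s1 : 1 < s.
  have := @gt0_ltr_powR R (N.+1%:R^-1) _ 1 t; rewrite powR1; apply => //.
    by rewrite nnegrE.
  by rewrite nnegrE ltW.
have sE n : (s ^+ n) ^+ N.+1 = t ^+ n.
  have sN : s ^+ N.+1 = t.
    by rewrite -powR_mulrn ?powR_ge0 // /s -powRrM mulVf // powRr1 // ltW.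
  by rewrite -exprM mulnC exprM sN.
have [c c0 cn] := natr_le_exp s1.
(* The summand 1 covers n * m = 0, where the power is 1 for Q = 0 and 0 otherwise. *)
exists (`|C| * (1 + (c * m%:R) ^+ N.+1)) => n.
apply: (@le_trans _ _ (`|C| * (n * m)%:R `^ Q)).
  by rewrite ler_wpM2r ?powR_ge0 // ler_norm.
rewrite -mulrA ler_wpM2l //.
have tn : 1 <= t ^+ n by rewrite exprn_ege1 // ltW.
apply: (@le_trans _ _ (1 + (n * m)%:R ^+ N.+1)).
  have [->|] := posnP (n * m).
    rewrite (@le_trans _ _ 1) ?lerDl ?exprn_ge0 //.
    by have [->|Q0] := eqVneq Q 0; [rewrite powRr0|rewrite powR0 // ler01].
  rewrite -(ler_nat R) => nm1.
  rewrite (le_trans (ler_powR nm1 (y := N.+1%:R) _)) //.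
    by apply: le_trans QN; exact: ler_norm.
  by rewrite powR_mulrn ?ler0n // lerDr.
rewrite mulrDl mul1r lerD // natrM.
have -> : (c * m%:R) ^+ N.+1 * t ^+ n = ((c * s ^+ n) * m%:R) ^+ N.+1.
  by rewrite -sE -exprMn mulrAC.
have s0 : 0 <= s by rewrite (le_trans _ (ltW s1)).
rewrite lerXn2r ?nnegrE ?mulr_ge0 ?exprn_ge0 ?(ltW c0) //.
by rewrite ler_wpM2r.
Qed.

End growth.

Section compact_generation.
Context {R : realType} {G : topologicalZmodType}.
Variable mu : {measure set (borel G) -> \bar R}.
Hypothesis G_hausdorff : hausdorff_space G.
Hypothesis mu_growth : polynomial_growth mu.

(** K is the union of the closure of U and its negative. Being compact, it lies in some U^m, so that
    K^n lies in U^(n m) and inherits the growth bound. *)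
Lemma symmetric_generating_compact : exists K : set G,
  [/\ compact K, generating_nbhs K, forall x, K x -> K (- x) &
      forall t : R, 1 < t -> exists c : R, forall n,
        (mu (nfold_sum K n : set (borel G)) <= (c * t ^+ n)%:E)%E].
Proof.
have [U [C [Q [[U0 pU UT] muU]]]] := mu_growth.
have cU : compact (closure U) by rewrite -precompactE.
pose V := (fun x : G => - x) @` closure U.
have cV : compact V.
  apply: continuous_compact => //; apply: continuous_subspaceT => z.
  exact: opp_continuous.
pose K := closure U `|` V.
have cK : compact K by exact: compactU.
have UK : U `<=` K by move=> x /subset_closure; left.
have K0 : nbhs 0 K by exact: filterS U0.
exists K; split => //.
- split => //; first exact: compact_precompact.
  rewrite -subTset => x _; have [n _ nx] : (\bigcup_n nfold_sum U n) x by rewrite UT.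
  by exists n => //; apply: nfold_sumS nx.
- by move=> x [Ux|[y Uy <-]]; [right; exists x|left; rewrite opprK].
- move=> t t1; have [m KUm] := compact_sub_nfold_sum U0 UT cK.
  have [c cP] := powR_le_exp C Q m.+1 t1.
  have mK n : measurable (nfold_sum K n : set (borel G)).
    by apply: borel_closed; apply: compact_closed => //; exact: nfold_sum_compact.
  (* The growth bound holds for positive exponents only; passing to [n.+1] and [m.+1] keeps the
     exponent positive and costs a factor [t]. *)
  exists (c * t) => n; rewrite -mulrA -exprS.
  apply: (@le_trans _ _ (mu^* (nfold_sum K n : set (borel G)))%mu).
    by rewrite (measurable_mu_extE mu (mK n)).
  apply: (@le_trans _ _ ((mu^*)%mu (nfold_sum U (n.+1 * m.+1)))); last first.
    by rewrite (le_trans (muU _ _)) // lee_fin.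
  apply: le_outer_measure => x nx.
  apply: nfold_sumM; apply: (@nfold_sum_le _ _ n) => //.
    by apply: (nfold_sum_le _ (leq0n _)) => //; exact: nbhs_singleton.
  apply: nfold_sumS nx => y /KUm; apply: nfold_sum_le => //.
  exact: nbhs_singleton.
Qed.

End compact_generation.

(** * Complex-valued integrals *)

Section complex_numbers.
Context {R : realType}.
Implicit Types z w : R[i].

Lemma normc_ge0 z : 0 <= normc z.
Proof. by case: z => a b; exact: sqrtr_ge0. Qed.

Lemma sqr_normc z : normc z ^+ 2 = complex.Re z ^+ 2 + complex.Im z ^+ 2.
Proof. by case: z => a b; rewrite /= sqr_sqrtr // addr_ge0 ?sqr_ge0. Qed.

Lemma normr_Re_le z : `|complex.Re z| <= normc z.
Proof.
by rewrite -ler_sqr ?nnegrE ?normc_ge0 // sqr_normc real_normK ?num_real // lerDl sqr_ge0.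
Qed.

Lemma normr_Im_le z : `|complex.Im z| <= normc z.
Proof.
by rewrite -ler_sqr ?nnegrE ?normc_ge0 // sqr_normc real_normK ?num_real // lerDr sqr_ge0.
Qed.

Lemma normc_le_ReIm z : normc z <= `|complex.Re z| + `|complex.Im z|.
Proof.
rewrite -ler_sqr ?nnegrE ?normc_ge0 ?addr_ge0 // sqr_normc.
rewrite -(real_normK (num_real (complex.Re z))) -(real_normK (num_real (complex.Im z))).
have := normr_ge0 (complex.Re z); have := normr_ge0 (complex.Im z); nra.
Qed.

Lemma normc_conj z : normc (z^*)%C = normc z.
Proof. by case: z => a b /=; rewrite sqrrN. Qed.

Lemma normc_real (r : R) : normc (r%:C)%C = `|r|.
Proof. by rewrite /= expr0n /= addr0 sqrtr_sqr. Qed.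

Lemma cReD z w : complex.Re (z + w) = complex.Re z + complex.Re w.
Proof. by case: z w => [a b] [c d]. Qed.

Lemma cImD z w : complex.Im (z + w) = complex.Im z + complex.Im w.
Proof. by case: z w => [a b] [c d]. Qed.

Lemma cReM z w : complex.Re (z * w) =
  complex.Re z * complex.Re w - complex.Im z * complex.Im w.
Proof. by case: z w => [a b] [c d]. Qed.

Lemma cImM z w : complex.Im (z * w) =
  complex.Re z * complex.Im w + complex.Im z * complex.Re w.
Proof. by case: z w => [a b] [c d] /=. Qed.

Lemma Re_conjM_le z w :
  complex.Re z * complex.Re w + complex.Im z * complex.Im w <= normc z * normc w.
Proof.
have -> : complex.Re z * complex.Re w + complex.Im z * complex.Im w =
    complex.Re ((z^*)%C * w) by case: z w => [a b] [c d] /=; rewrite mulNr opprK.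
by rewrite -[normc z]normc_conj -normcM (le_trans (ler_norm _)) ?normr_Re_le.
Qed.

Lemma eq_complexE z w : complex.Re z = complex.Re w -> complex.Im z = complex.Im w -> z = w.
Proof. by case: z w => [a b] [c d] /= -> ->. Qed.

End complex_numbers.

Section complex_measurability.
Context {R : realType} {G : topologicalZmodType}.
Implicit Types f g : G -> R[i].

Lemma cmeasurableM f g : cmeasurable f -> cmeasurable g ->
  cmeasurable (fun x => f x * g x).
Proof.
move=> [fr fi] [gr gi]; split.
  under eq_fun do rewrite cReM.
  by apply: measurable_funB; apply: measurable_funM.
under eq_fun do rewrite cImM.
by apply: measurable_funD; apply: measurable_funM.
Qed.

Lemma cmeasurable_cst (c : R[i]) : cmeasurable (fun _ : G => c).
Proof. by split; exact: measurable_cst. Qed.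

Lemma cmeasurable_comp f (phi : G -> G) :
  measurable_fun [set: borel G] (phi : borel G -> borel G) ->
  cmeasurable f -> cmeasurable (f \o phi).
Proof.
by move=> mphi [fr fi]; split; [exact: (measurableT_comp fr mphi)|
  exact: (measurableT_comp fi mphi)].
Qed.

Lemma cmeasurable_conj f : cmeasurable f -> cmeasurable (fun x => (f x)^*%C).
Proof.
move=> [fr fi]; split.
  rewrite (_ : (fun _ => _) = (fun x : borel G => complex.Re (f x))) //.
  by apply/funext => x; case: (f x).
rewrite (_ : (fun _ => _) = (fun x : borel G => - complex.Im (f x))).
  exact: measurableT_comp.
by apply/funext => x; case: (f x).
Qed.

Lemma cmeasurable_real (f : G -> R) :
  measurable_fun [set: borel G] (f : borel G -> R) <->
  cmeasurable (fun x => (f x)%:C%C).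
Proof. by split=> [mf|[]//]; split => //; exact: measurable_cst. Qed.

End complex_measurability.

Section complex_integral.
Context {R : realType} {G : topologicalZmodType}.
Variable mu : {measure set (borel G) -> \bar R}.
Implicit Types (f g F : G -> R[i]).

Lemma cintegrableP F : cintegrable mu F <->
  cmeasurable F /\ (\int[mu]_(x in [set: borel G]) (normc (F x))%:E < +oo)%E.
Proof.
split=> [[ir ii]|[mF Foo]].
  have mF : cmeasurable F.
    by split; apply/measurable_EFinP; [exact: measurable_int ir|exact: measurable_int ii].
  split=> //.
  have mn := cmeasurable_normc mF; have [mr mi] := mF.
  apply: (@le_lt_trans _ _ (\int[mu]_(x in [set: borel G])
     (`|(complex.Re (F x))%:E| + `|(complex.Im (F x))%:E|))%E).
    apply: ge0_le_integral => //.
    - by move=> x _; rewrite lee_fin normc_ge0.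
    - exact/measurable_EFinP.
    - by apply: emeasurable_funD; apply: measurableT_comp => //; apply/measurable_EFinP.
    - by move=> x _; rewrite lee_fin normc_le_ReIm.
  rewrite ge0_integralD //=; last 2 first.
  - by apply/measurable_EFinP; exact: measurableT_comp.
  - by apply/measurable_EFinP; exact: measurableT_comp.
  by apply: lte_add_pinfty; [have /integrableP[] := ir|have /integrableP[] := ii].
have [mr mi] := mF; have mn := cmeasurable_normc mF.
split; apply/integrableP; split; try exact/measurable_EFinP.
  apply: le_lt_trans Foo; apply: ge0_le_integral => //.
  - by apply: measurableT_comp => //; apply/measurable_EFinP.
  - exact/measurable_EFinP.
  - by move=> x _; rewrite lee_fin normr_Re_le.
apply: le_lt_trans Foo; apply: ge0_le_integral => //.
- by apply: measurableT_comp => //; apply/measurable_EFinP.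
- exact/measurable_EFinP.
- by move=> x _; rewrite lee_fin normr_Im_le.
Qed.

Lemma cintegrable_normc F : cintegrable mu F ->
  mu.-integrable [set: borel G] (fun x => (normc (F x))%:E).
Proof.
move=> /cintegrableP[mF Foo]; apply/integrableP; split.
  by apply/measurable_EFinP; exact: cmeasurable_normc.
by under eq_integral do rewrite gee0_abs ?lee_fin ?normc_ge0 //.
Qed.

Lemma le_cintegrable f (h : G -> R) : cmeasurable f ->
  mu.-integrable [set: borel G] (fun x => (h x)%:E) ->
  (forall x, normc (f x) <= h x) -> cintegrable mu f.
Proof.
move=> mf /integrableP[mh hoo] fh; apply/cintegrableP; split => //.
apply: le_lt_trans hoo; apply: ge0_le_integral => //.
- by move=> x _; rewrite lee_fin normc_ge0.
- by apply/measurable_EFinP; exact: cmeasurable_normc.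
- exact: measurableT_comp.
- by move=> x _; rewrite lee_fin (le_trans (fh x)) ?ler_norm.
Qed.

Lemma cintegralD f g : cintegrable mu f -> cintegrable mu g ->
  cintegral mu (fun x => f x + g x) = cintegral mu f + cintegral mu g.
Proof.
move=> [fr fi] [gr gi]; rewrite /cintegral; apply: eq_complexE => /=.
  by under eq_Rintegral do rewrite cReD; rewrite RintegralD.
by under eq_Rintegral do rewrite cImD; rewrite RintegralD.
Qed.

Lemma cintegrableZl (c : R[i]) f : cintegrable mu f -> cintegrable mu (fun x => c * f x).
Proof.
move=> /cintegrableP[mf foo]; apply/cintegrableP; split.
  exact: (cmeasurableM (cmeasurable_cst c) mf).
under eq_integral do rewrite normcM EFinM.
rewrite ge0_integralZl_EFin ?normc_ge0 //.
- by apply: lte_mul_pinfty => //; rewrite lee_fin normc_ge0.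
- by move=> x _; rewrite lee_fin normc_ge0.
- by apply/measurable_EFinP; exact: cmeasurable_normc.
Qed.

Lemma cintegralZl (c : R[i]) f : cintegrable mu f ->
  cintegral mu (fun x => c * f x) = c * cintegral mu f.
Proof.
move=> [fr fi]; rewrite /cintegral; apply: eq_complexE; rewrite ?cReM ?cImM /=.
  under eq_Rintegral do rewrite cReM.
  by rewrite RintegralB ?RintegralZl //;
    [exact: (integrableZl measurableT _ fr)|exact: (integrableZl measurableT _ fi)].
under eq_Rintegral do rewrite cImM.
by rewrite RintegralD ?RintegralZl //;
    [exact: (integrableZl measurableT _ fi)|exact: (integrableZl measurableT _ fr)].
Qed.

Lemma cintegral0 : cintegral mu (fun _ : G => 0) = 0.
Proof. by rewrite /cintegral /= /Rintegral integral0. Qed.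

Lemma eq_cintegral f g : (forall x, f x = g x) -> cintegral mu f = cintegral mu g.
Proof. by move=> /funext ->. Qed.

Lemma ae_eq_cintegral f g : cmeasurable f -> cmeasurable g ->
  {ae mu, forall x : borel G, f x = g x} -> cintegral mu f = cintegral mu g.
Proof.
move=> [fr fi] [gr gi] fg; rewrite /cintegral /Rintegral.
congr (Complex (fine _) (fine _)); apply: ae_eq_integral => //;
  try exact/measurable_EFinP; by apply: filterS fg => x ->.
Qed.

Lemma cintegral_conj f : cintegrable mu f ->
  cintegral mu (fun x => (f x)^*%C) = (cintegral mu f)^*%C.
Proof.
move=> [fr fi]; apply: eq_complexE => /=.
  by apply: eq_Rintegral => x _; case: (f x).
rewrite -[RHS]mulN1r -RintegralZl //.
by apply: eq_Rintegral => x _; case: (f x) => a b /=; rewrite mulN1r.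
Qed.

(* With [z] the integral, [|z|^2] is the integral of [Re (conj z * F)]. *)
Lemma normc_cintegral F : cintegrable mu F ->
  ((normc (cintegral mu F))%:E <= \int[mu]_(x in [set: borel G]) (normc (F x))%:E)%E.
Proof.
move=> iF; have [ir ii] := iF; have iN := cintegrable_normc iF.
set z := cintegral mu F.
have [->|z0] := eqVneq z 0.
  by rewrite normc0; apply: integral_ge0 => x _; rewrite lee_fin normc_ge0.
have nz0 : 0 < normc z.
  by rewrite lt_def normc_ge0 andbT; apply: contra z0 => /eqP/eq0_normc ->.
rewrite -(fineK (integrable_fin_num measurableT iN)) // lee_fin.
rewrite -(ler_pM2l nz0) -expr2 sqr_normc.
have -> : complex.Re z ^+ 2 + complex.Im z ^+ 2 =
   Rintegral mu [set: borel G] (fun x => complex.Re z * complex.Re (F x) +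
     complex.Im z * complex.Im (F x)).
  by rewrite RintegralD ?RintegralZl //;
    [exact: (integrableZl measurableT _ ir)|exact: (integrableZl measurableT _ ii)].
rewrite -[X in _ * X]/(Rintegral mu [set: borel G] (fun x => normc (F x))).
rewrite -RintegralZl //; apply: le_Rintegral => //.
- exact: (integrableD measurableT (integrableZl measurableT _ ir)
    (integrableZl measurableT _ ii)).
- exact: (integrableZl measurableT _ iN).
- by move=> x _; exact: Re_conjM_le.
Qed.

End complex_integral.

(** * Convolution *)

Section convolution.
Context {R : realType} {G : topologicalZmodType}.
Variable mu : {sigma_finite_measure set (borel G) -> \bar R}.
Hypothesis mu_addr : forall (a : G) (A : set (borel G)), measurable A ->
  mu ((fun y : G => y + a) @^-1` A) = mu A.
Hypothesis mu_oppr : forall (A : set (borel G)), measurable A ->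
  mu ((fun y : G => - y) @^-1` A) = mu A.
Hypothesis diff_ae : forall f : G -> R,
  measurable_fun [set: borel G] (f : borel G -> R) ->
  exists2 g : G -> R, diff_measurable_fun g & {ae mu, forall x : borel G, f x = g x}.
Implicit Types f g h : G -> R[i].

Lemma ge0_integral_subl (u : G -> \bar R) (x : G) :
    measurable_fun [set: borel G] (u : borel G -> \bar R) -> (forall y, 0 <= u y)%E ->
  (\int[mu]_(y in [set: borel G]) u (x - y)%R = \int[mu]_(y in [set: borel G]) u y)%E.
Proof.
move=> mf f0; rewrite -(@ge0_integral_oppr _ _ mu mu_oppr u) //.
rewrite -(@ge0_integral_addr _ _ mu mu_addr (fun y => u (- y)) (- x)) //.
  by apply: eq_integral => y _; rewrite opprD opprK addrC.
exact: (measurableT_comp mf (@measurable_oppr_borel G)).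
Qed.

Lemma integral_subl (u : G -> \bar R) (x : G) :
    measurable_fun [set: borel G] (u : borel G -> \bar R) ->
  (\int[mu]_(y in [set: borel G]) u (x - y)%R = \int[mu]_(y in [set: borel G]) u y)%E.
Proof.
move=> mu'; rewrite integralE [RHS]integralE.
congr (_ - _)%E.
- rewrite -(@ge0_integral_subl (u^\+)%E x) //; last exact: measurable_funepos.
  by apply: eq_integral => y _; rewrite !funeposE.
- rewrite -(@ge0_integral_subl (u^\-)%E x) //; last exact: measurable_funeneg.
  by apply: eq_integral => y _; rewrite !funenegE.
Qed.

Lemma integral_addl (u : G -> \bar R) (x : G) :
    measurable_fun [set: borel G] (u : borel G -> \bar R) ->
  (\int[mu]_(y in [set: borel G]) u (y + x)%R = \int[mu]_(y in [set: borel G]) u y)%E.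
Proof.
move=> mu'; rewrite integralE [RHS]integralE.
congr (_ - _)%E.
- rewrite -(@ge0_integral_addr _ _ mu mu_addr (u^\+)%E x) //; last exact: measurable_funepos.
  by apply: eq_integral => y _; rewrite !funeposE.
- rewrite -(@ge0_integral_addr _ _ mu mu_addr (u^\-)%E x) //; last exact: measurable_funeneg.
  by apply: eq_integral => y _; rewrite !funenegE.
Qed.

Lemma cintegral_subl f (x : G) : cmeasurable f ->
  cintegral mu (fun y => f (x - y)) = cintegral mu f.
Proof.
move=> [fr fi]; rewrite /cintegral /Rintegral; congr (Complex (fine _) (fine _)).
  by apply: (@integral_subl (fun y => (complex.Re (f y))%:E)); apply/measurable_EFinP.
by apply: (@integral_subl (fun y => (complex.Im (f y))%:E)); apply/measurable_EFinP.
Qed.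

Lemma cintegral_addr f (x : G) : cmeasurable f ->
  cintegral mu (fun y => f (y + x)) = cintegral mu f.
Proof.
move=> [fr fi]; rewrite /cintegral /Rintegral; congr (Complex (fine _) (fine _)).
  by apply: (@integral_addl (fun y => (complex.Re (f y))%:E)); apply/measurable_EFinP.
by apply: (@integral_addl (fun y => (complex.Im (f y))%:E)); apply/measurable_EFinP.
Qed.

Lemma ae_subl (P : G -> Prop) (x : G) : {ae mu, forall y : borel G, P y} ->
  {ae mu, forall y : borel G, P (x - y)}.
Proof.
move=> [N [mN N0 PN]]; exists ((fun y : G => x - y) @^-1` N); split.
- by rewrite -[X in measurable X]setTI; exact: measurable_subl.
- have -> : (fun y : G => x - y) @^-1` N =
    (fun y : G => - y) @^-1` ((fun y : G => y + x) @^-1` N).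
    by apply/seteqP; split => y /=; rewrite addrC.
  rewrite mu_oppr; first by rewrite mu_addr.
  by rewrite -[X in measurable X]setTI; exact: measurable_addr.
- by move=> y nP; apply: PN.
Qed.

Lemma cmeasurable_subl f (x : G) : cmeasurable f -> cmeasurable (fun y => f (x - y)).
Proof. by move=> mf; apply: (cmeasurable_comp _ mf); exact: measurable_subl. Qed.

Lemma cdiff_ae f : cmeasurable f -> exists g, [/\ cmeasurable g,
  diff_measurable_fun (fun x => complex.Re (g x)),
  diff_measurable_fun (fun x => complex.Im (g x)) &
  {ae mu, forall x : borel G, f x = g x}].
Proof.
move=> [/diff_ae[u du fu] /diff_ae[v dv fv]]; exists (fun x => Complex (u x) (v x)).
split => //; first by split; exact: diff_measurable_fun_borel.
by apply: filterS2 fu fv => x /=; case: (f x) => a b /= -> ->.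
Qed.

Lemma cmeasurable_integrand f g (x : G) : cmeasurable f -> cmeasurable g ->
  cmeasurable (fun y => f y * g (x - y)).
Proof. by move=> mf mg; apply: cmeasurableM => //; exact: cmeasurable_subl. Qed.

Definition cconv f g : G -> R[i] := fun x => cintegral mu (fun y => f y * g (x - y)).

(** Extended real values make absolute convergence at x the condition that this is finite at x. *)
Definition absconv f g : G -> \bar R :=
  fun x => (\int[mu]_(y in [set: borel G]) (normc (f y) * normc (g (x - y)%R))%:E)%E.

(** Equality holds at every point: for each x the map y |-> x - y preserves null sets. A factor may
    therefore be replaced by a version that is measurable after subtraction without changing the
    convolution anywhere. *)
Lemma ae_eq_cconv f f' g g' : cmeasurable f -> cmeasurable f' ->
    cmeasurable g -> cmeasurable g' ->
    {ae mu, forall x : borel G, f x = f' x} ->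
    {ae mu, forall x : borel G, g x = g' x} ->
  cconv f g = cconv f' g'.
Proof.
move=> mf mf' mg mg' ff' gg'; apply/funext => x; apply: ae_eq_cintegral.
- exact: cmeasurable_integrand.
- exact: cmeasurable_integrand.
- by apply: filterS2 ff' (ae_subl x gg') => y /= -> ->.
Qed.

Lemma ae_eq_absconv f f' g g' : cmeasurable f -> cmeasurable f' ->
    cmeasurable g -> cmeasurable g' ->
    {ae mu, forall x : borel G, f x = f' x} ->
    {ae mu, forall x : borel G, g x = g' x} ->
  absconv f g = absconv f' g'.
Proof.
move=> mf mf' mg mg' ff' gg'; apply/funext => x; apply: ge0_ae_eq_integral => //.
- by apply/measurable_EFinP; apply: measurable_funM; apply: cmeasurable_normc => //;
    exact: cmeasurable_subl.
- by apply/measurable_EFinP; apply: measurable_funM; apply: cmeasurable_normc => //;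
    exact: cmeasurable_subl.
- by move=> y _; rewrite lee_fin mulr_ge0 ?normc_ge0.
- by move=> y _; rewrite lee_fin mulr_ge0 ?normc_ge0.
- by apply: filterS2 ff' (ae_subl x gg') => y /= -> ->.
Qed.

Lemma measurable_Rintegral_snd (F : borel G * borel G -> R) : measurable_fun setT F ->
  measurable_fun [set: borel G] (fun x => Rintegral mu [set: borel G] (fun y => F (x, y))).
Proof.
move=> mF; have mF' : measurable_fun setT (EFin \o F) by exact/measurable_EFinP.
apply: (@measurableT_comp _ _ _ _ _ _ (@fine R)) => //.
rewrite (_ : (fun _ => _) = (fun x => \int[mu]_(y in [set: borel G]) (EFin \o F)^\+ (x, y) -
   \int[mu]_(y in [set: borel G]) (EFin \o F)^\- (x, y))%E).
  by apply: emeasurable_funB; apply: measurable_fun_fubini_tonelli_F => //;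
    [exact: measurable_funepos|exact: measurable_funeneg].
by apply/funext => x; rewrite [LHS]integralE; congr (_ - _)%E; apply: eq_integral => y _;
  rewrite ?funeposE ?funenegE.
Qed.

Lemma cmeasurable_cconv f g : cmeasurable f -> cmeasurable g -> cmeasurable (cconv f g).
Proof.
move=> mf mg; have [g' [mg' dr di gg']] := cdiff_ae mg.
rewrite (ae_eq_cconv mf mf mg mg' _ gg'); last exact: aeW.
have [fr fi] := mf.
have m2 (u : borel G -> R) : measurable_fun [set: borel G] u ->
    measurable_fun [set: borel G * borel G] (fun z => u z.2).
  by move=> mu'; exact: measurableT_comp.
split.
  apply: (@measurable_Rintegral_snd (fun z => complex.Re (f z.2 * g' (z.1 - z.2)))).
  under eq_fun do rewrite cReM.
  exact: (measurable_funB (measurable_funM (m2 _ fr) dr) (measurable_funM (m2 _ fi) di)).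
apply: (@measurable_Rintegral_snd (fun z => complex.Im (f z.2 * g' (z.1 - z.2)))).
under eq_fun do rewrite cImM.
exact: (measurable_funD (measurable_funM (m2 _ fr) di) (measurable_funM (m2 _ fi) dr)).
Qed.

Lemma diff_measurable_normc g : diff_measurable_fun (fun x => complex.Re (g x)) ->
    diff_measurable_fun (fun x => complex.Im (g x)) ->
  diff_measurable_fun (fun x => normc (g x)).
Proof.
move=> mr mi; rewrite /diff_measurable_fun.
rewrite (_ : (fun _ => _) = (fun z : borel G * borel G =>
  ((complex.Re (g (z.1 - z.2))) ^+ 2 + (complex.Im (g (z.1 - z.2))) ^+ 2) `^ 2^-1)).
  apply: (@measurableT_comp _ _ _ _ _ _ (fun t : R => t `^ 2^-1)) => //.
  by apply: measurable_funD; apply: measurable_funX.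
apply/funext => z; case: (g _) => a b /=.
by rewrite powR12_sqrt // addr_ge0 ?sqr_ge0.
Qed.

Lemma measurable_absconv f g : cmeasurable f -> cmeasurable g ->
  measurable_fun [set: borel G] (absconv f g : borel G -> \bar R).
Proof.
move=> mf mg; have [g' [mg' dr di gg']] := cdiff_ae mg.
rewrite (ae_eq_absconv mf mf mg mg' _ gg'); last exact: aeW.
apply: (@measurable_conv_ge0 _ _ mu (fun y => (normc (f y))%:E) (fun y => (normc (g' y))%:E)).
- by apply/measurable_EFinP; exact: cmeasurable_normc.
- by apply/measurable_EFinP; exact: diff_measurable_normc.
- by move=> x; rewrite lee_fin normc_ge0.
- by move=> x; rewrite lee_fin normc_ge0.
Qed.

Lemma absconv_ge0 f g x : (0 <= absconv f g x)%E.
Proof. by apply: integral_ge0 => y _; rewrite lee_fin mulr_ge0 ?normc_ge0. Qed.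

Lemma integral_absconv f g : cmeasurable f -> cmeasurable g ->
  (\int[mu]_(x in [set: borel G]) absconv f g x =
   (\int[mu]_(x in [set: borel G]) (normc (f x))%:E) *
   (\int[mu]_(x in [set: borel G]) (normc (g x))%:E))%E.
Proof.
move=> mf mg; have [g' [mg' dr di gg']] := cdiff_ae mg.
rewrite (ae_eq_absconv mf mf mg mg' _ gg'); last exact: aeW.
rewrite (@integral_conv_diff _ _ mu mu_addr (fun y => (normc (f y))%:E)
  (fun y => (normc (g' y))%:E)).
- congr (_ * _)%E; apply: ge0_ae_eq_integral => //.
  + by apply/measurable_EFinP; exact: cmeasurable_normc.
  + by apply/measurable_EFinP; exact: cmeasurable_normc.
  + by move=> x _; rewrite lee_fin normc_ge0.
  + by move=> x _; rewrite lee_fin normc_ge0.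
  + by apply: filterS gg' => x /= ->.
- by apply/measurable_EFinP; exact: cmeasurable_normc.
- by apply/measurable_EFinP; exact: diff_measurable_normc.
- by move=> x; rewrite lee_fin normc_ge0.
- by move=> x; rewrite lee_fin normc_ge0.
Qed.

Lemma cintegrable_integrand f g x : cmeasurable f -> cmeasurable g ->
  cintegrable mu (fun y => f y * g (x - y)) <-> (absconv f g x < +oo)%E.
Proof.
move=> mf mg; rewrite cintegrableP; under eq_integral do rewrite normcM.
by split=> [[]//|]; split => //; exact: cmeasurable_integrand.
Qed.

Lemma normc_cconv_le f g x : cmeasurable f -> cmeasurable g -> (absconv f g x < +oo)%E ->
  ((normc (cconv f g x))%:E <= absconv f g x)%E.
Proof.
move=> mf mg /(cintegrable_integrand x mf mg)/normc_cintegral.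
by under eq_integral do rewrite normcM.
Qed.

Lemma cconvC f g : cmeasurable f -> cmeasurable g -> cconv f g = cconv g f.
Proof.
move=> mf mg; apply/funext => x; rewrite /cconv.
rewrite -(@cintegral_subl (fun y => f y * g (x - y)) x); last exact: cmeasurable_integrand.
by apply: eq_cintegral => y; rewrite subKr mulrC.
Qed.

End convolution.

(** * Fubini's theorem for complex-valued functions *)

Section complex_fubini.
Context {R : realType} {G : topologicalZmodType}.
Variable mu : {sigma_finite_measure set (borel G) -> \bar R}.
Variable F : borel G * borel G -> R[i].
Hypothesis mFr : measurable_fun [set: borel G * borel G] (fun z => complex.Re (F z)).
Hypothesis mFi : measurable_fun [set: borel G * borel G] (fun z => complex.Im (F z)).

Let mswap : measurable_fun [set: borel G * borel G]
  (fun z : borel G * borel G => (z.2, z.1) : borel G * borel G).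
Proof. exact: measurable_fun_pair. Qed.

Lemma cmeasurable_pair1 (x : G) : cmeasurable (fun y : G => F (x, y)).
Proof.
by split; [apply: (measurableT_comp mFr)|apply: (measurableT_comp mFi)];
  exact: measurable_fun_pair.
Qed.

Lemma cmeasurable_cintegral1 : cmeasurable (fun x : G => cintegral mu (fun y : G => F (x, y))).
Proof.
split; first exact: (measurable_Rintegral_snd mu mFr).
exact: (measurable_Rintegral_snd mu mFi).
Qed.

Lemma cmeasurable_cintegral2 : cmeasurable (fun y : G => cintegral mu (fun x : G => F (x, y))).
Proof.
split; first exact: (measurable_Rintegral_snd mu (measurableT_comp mFr mswap)).
exact: (measurable_Rintegral_snd mu (measurableT_comp mFi mswap)).
Qed.

Hypothesis F_int : (\int[mu]_(x in [set: borel G]) \int[mu]_(y in [set: borel G])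
  (normc (F (x, y)))%:E < +oo)%E.

Let integrable_part (u : borel G * borel G -> R) : measurable_fun setT u ->
  (forall z, `|u z| <= normc (F z)) -> (mu \x mu)%E.-integrable setT (EFin \o u).
Proof.
move=> mu' uF; apply/integrable12ltyP; first exact/measurable_EFinP.
apply: le_lt_trans F_int; apply: ge0_le_integral => //.
- by move=> x _; exact: integral_ge0.
- apply: (@measurable_fun_fubini_tonelli_F _ _ _ _ _ mu (fun z => `|(u z)%:E|%E)) => //.
  by apply/measurable_EFinP; exact: measurableT_comp.
- apply: (@measurable_fun_fubini_tonelli_F _ _ _ _ _ mu (fun z => (normc (F z))%:E)) => //.
    apply/measurable_EFinP.
    rewrite (_ : (fun _ => _) = (fun z => (complex.Re (F z) ^+ 2 + complex.Im (F z) ^+ 2) `^ 2^-1)).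
      apply: (@measurableT_comp _ _ _ _ _ _ (fun t : R => t `^ 2^-1)) => //.
      by apply: measurable_funD; apply: measurable_funX.
    apply/funext => z; case: (F _) => a b /=.
    by rewrite powR12_sqrt // addr_ge0 ?sqr_ge0.
  by move=> z; rewrite lee_fin normc_ge0.
- move=> x _; apply: ge0_le_integral => //.
  + apply: measurableT_comp => //; apply/measurable_EFinP.
    by apply: (measurableT_comp mu'); exact: measurable_fun_pair.
  + by apply/measurable_EFinP; apply: cmeasurable_normc; exact: cmeasurable_pair1.
  + by move=> y _; rewrite lee_fin.
Qed.

Let iR : (mu \x mu)%E.-integrable setT (EFin \o (fun z => complex.Re (F z))).
Proof. by apply: integrable_part => // z; exact: normr_Re_le. Qed.

Let iI : (mu \x mu)%E.-integrable setT (EFin \o (fun z => complex.Im (F z))).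
Proof. by apply: integrable_part => // z; exact: normr_Im_le. Qed.

Lemma ae_cintegrable1 : {ae mu, forall x : borel G, cintegrable mu (fun y : G => F (x, y))}.
Proof. by apply: filterS2 (ae_integrable1 iR) (ae_integrable1 iI) => x. Qed.

Lemma ae_cintegrable2 : {ae mu, forall y : borel G, cintegrable mu (fun x : G => F (x, y))}.
Proof. by apply: filterS2 (ae_integrable2 iR) (ae_integrable2 iI) => x. Qed.

Let Rintegral_fubini (u : borel G * borel G -> R) : measurable_fun setT u ->
  (mu \x mu)%E.-integrable setT (EFin \o u) ->
  Rintegral mu [set: borel G] (fun x => Rintegral mu [set: borel G] (fun y => u (x, y))) =
  Rintegral mu [set: borel G] (fun y => Rintegral mu [set: borel G] (fun x => u (x, y))).
Proof.
move=> mu' iu; rewrite {1 3}/Rintegral; congr fine.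
transitivity (\int[mu]_(x in [set: borel G]) \int[mu]_(y in [set: borel G]) (EFin \o u) (x, y))%E.
  apply: ae_eq_integral => //.
  - apply/measurable_EFinP; exact: measurable_Rintegral_snd.
  - exact: (measurable_fubini_F iu).
  - apply: filterS (ae_integrable1 iu) => x ix _.
    by rewrite /Rintegral fineK //; exact: integrable_fin_num.
rewrite (Fubini iu); apply: ae_eq_integral => //.
- exact: (measurable_fubini_G iu).
- apply/measurable_EFinP.
  exact: (measurable_Rintegral_snd mu (measurableT_comp mu' mswap)).
- apply: filterS (ae_integrable2 iu) => x ix _.
  by rewrite /Rintegral fineK //; exact: integrable_fin_num.
Qed.

Lemma cintegral_fubini :
  cintegral mu (fun x : G => cintegral mu (fun y : G => F (x, y))) =
  cintegral mu (fun y : G => cintegral mu (fun x : G => F (x, y))).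
Proof.
rewrite /cintegral /=; congr Complex; first exact: (Rintegral_fubini mFr iR).
exact: (Rintegral_fubini mFi iI).
Qed.

End complex_fubini.

Section convolution_algebra.
Context {R : realType} {G : topologicalZmodType}.
Variable mu : {sigma_finite_measure set (borel G) -> \bar R}.
Hypothesis mu_addr : forall (a : G) (A : set (borel G)), measurable A ->
  mu ((fun y : G => y + a) @^-1` A) = mu A.
Hypothesis mu_oppr : forall (A : set (borel G)), measurable A ->
  mu ((fun y : G => - y) @^-1` A) = mu A.
Hypothesis diff_ae : forall f : G -> R,
  measurable_fun [set: borel G] (f : borel G -> R) ->
  exists2 g : G -> R, diff_measurable_fun g & {ae mu, forall x : borel G, f x = g x}.
Implicit Types f g h : G -> R[i].

Lemma cconvDl f1 f2 g x : cmeasurable f1 -> cmeasurable f2 -> cmeasurable g ->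
    (absconv mu f1 g x < +oo)%E -> (absconv mu f2 g x < +oo)%E ->
  cconv mu (fun y => f1 y + f2 y) g x = cconv mu f1 g x + cconv mu f2 g x.
Proof.
move=> m1 m2 mg i1 i2; rewrite /cconv -cintegralD; last 2 first.
- exact/cintegrable_integrand.
- exact/cintegrable_integrand.
by apply: eq_cintegral => y; rewrite mulrDl.
Qed.

Lemma cconvZl c f g x : cmeasurable f -> cmeasurable g -> (absconv mu f g x < +oo)%E ->
  cconv mu (fun y => c * f y) g x = c * cconv mu f g x.
Proof.
move=> mf mg ifg; rewrite /cconv -cintegralZl; last exact/cintegrable_integrand.
by apply: eq_cintegral => y; rewrite mulrA.
Qed.

Lemma cconv_involution f g (x : G) : cmeasurable f -> cmeasurable g ->
    (absconv mu f g (- x)%R < +oo)%E ->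
  cconv mu (involution f) (involution g) x = involution (cconv mu f g) x.
Proof.
move=> mf mg /(cintegrable_integrand mu _ mf mg) ifg.
rewrite /involution /cconv -cintegral_conj //.
have m1 : cmeasurable (fun y => (f y * g (- x - y))^*%C).
  by apply: cmeasurable_conj; exact: cmeasurable_integrand.
rewrite -(cintegral_subl mu_addr mu_oppr 0 m1).
by apply: eq_cintegral => y; rewrite sub0r rmorphM /= opprB opprK [- x + y]addrC.
Qed.

(* Both sides are iterated integrals of [f y * g (z - y) * h (x - z)]; [g] is
   first replaced by an almost everywhere equal function for which this is
   measurable in the pair [(z, y)]. *)
Lemma cconvA f g h (x : G) : cmeasurable f -> cmeasurable g -> cmeasurable h ->
    (\int[mu]_(z in [set: borel G]) (absconv mu f g z * (normc (h (x - z)%R))%:E) < +oo)%E ->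
  cconv mu (cconv mu f g) h x = cconv mu f (cconv mu g h) x.
Proof.
move=> mf mg mh; have [g' [mg' dr di gg']] := cdiff_ae diff_ae mg.
rewrite (ae_eq_cconv mu_addr mu_oppr mf mf mg mg' _ gg'); last exact: aeW.
rewrite (ae_eq_cconv mu_addr mu_oppr mg mg' mh mh gg'); last exact: aeW.
rewrite (ae_eq_absconv mu_addr mu_oppr mf mf mg mg' _ gg'); last exact: aeW.
move=> {g mg gg'}; move: g' mg' dr di => g mg dr di Foo.
pose F (z : borel G * borel G) : R[i] := f z.2 * g (z.1 - z.2) * h (x - z.1).
have [[fr fi] [hr hi]] := (mf, mh).
have m2 (u : borel G -> R) : measurable_fun [set: borel G] u ->
    measurable_fun [set: borel G * borel G] (fun z => u z.2).
  by move=> mu'; exact: measurableT_comp.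
have m1 (u : borel G -> R) : measurable_fun [set: borel G] u ->
    measurable_fun [set: borel G * borel G] (fun z => u (x - z.1 : G)).
  move=> mu'; apply: (@measurableT_comp _ _ _ _ _ _ u) => //.
  exact: (measurableT_comp (measurable_subl x) (@measurable_fst _ _ (borel G) (borel G))).
have mfgr : measurable_fun [set: borel G * borel G] (fun z => complex.Re (f z.2 * g (z.1 - z.2))).
  under eq_fun do rewrite cReM.
  exact: (measurable_funB (measurable_funM (m2 _ fr) dr) (measurable_funM (m2 _ fi) di)).
have mfgi : measurable_fun [set: borel G * borel G] (fun z => complex.Im (f z.2 * g (z.1 - z.2))).
  under eq_fun do rewrite cImM.
  exact: (measurable_funD (measurable_funM (m2 _ fr) di) (measurable_funM (m2 _ fi) dr)).
have mFr : measurable_fun [set: borel G * borel G] (fun z => complex.Re (F z)).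
  under eq_fun do rewrite cReM.
  exact: (measurable_funB (measurable_funM mfgr (m1 _ hr)) (measurable_funM mfgi (m1 _ hi))).
have mFi : measurable_fun [set: borel G * borel G] (fun z => complex.Im (F z)).
  under eq_fun do rewrite cImM.
  exact: (measurable_funD (measurable_funM mfgr (m1 _ hi)) (measurable_funM mfgi (m1 _ hr))).
have F_int : (\int[mu]_(z in [set: borel G]) \int[mu]_(y in [set: borel G])
    (normc (F (z, y)))%:E < +oo)%E.
  apply: le_lt_trans Foo; rewrite le_eqVlt; apply/orP; left; apply/eqP.
  apply: eq_integral => z _; rewrite /absconv -ge0_integralZr //.
  - by apply: eq_integral => y _; rewrite /F !normcM EFinM.
  - by apply/measurable_EFinP; apply: measurable_funM; apply: cmeasurable_normc => //;
      exact: cmeasurable_subl.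
  - by move=> y _; rewrite lee_fin mulr_ge0 ?normc_ge0.
  - by rewrite lee_fin normc_ge0.
have := cintegral_fubini mFr mFi F_int.
have -> : cintegral mu (fun z => cintegral mu (fun y => F (z, y))) =
    cconv mu (cconv mu f g) h x.
  apply: ae_eq_cintegral; first exact: cmeasurable_cintegral1.
    by apply: cmeasurable_integrand => //; exact: cmeasurable_cconv.
  apply: filterS (ae_cintegrable1 mFr mFi F_int) => z iz.
  (* Integrability of [F (z, _)] yields that of the inner integrand only after division by
     [h (x - z)]; where this value is 0, both sides vanish. *)
  have [h0|h0] := eqVneq (h (x - z)) 0.
    rewrite h0 mulr0 -[RHS](cintegral0 mu); apply: eq_cintegral => y.
    by rewrite /F /= h0 mulr0.
  rewrite mulrC /cconv -cintegralZl.
    by apply: eq_cintegral => y; rewrite mulrC.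
  have := cintegrableZl (h (x - z))^-1 iz.
  congr cintegrable; apply/funext => y.
  by rewrite /F /= mulrCA mulVf ?mulr1.
have -> : cintegral mu (fun y => cintegral mu (fun z => F (z, y))) =
    cconv mu f (cconv mu g h) x; last by [].
apply: ae_eq_cintegral; first exact: cmeasurable_cintegral2.
  by apply: cmeasurable_integrand => //; exact: cmeasurable_cconv.
apply: filterS (ae_cintegrable2 mFr mFi F_int) => y iy.
have [f0|f0] := eqVneq (f y) 0.
  rewrite f0 mul0r -[RHS](cintegral0 mu); apply: eq_cintegral => z.
  by rewrite /F /= f0 !mul0r.
rewrite /cconv -[X in _ = _ * X](cintegral_addr mu_addr (- y)); last exact: cmeasurable_integrand.
rewrite -cintegralZl.
  by apply: eq_cintegral => z; rewrite /F /= mulrA opprB addrA subrK.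
have := cintegrableZl (f y)^-1 iy.
congr cintegrable; apply/funext => z.
by rewrite /F /= opprB addrA subrK !mulrA mulVf // mul1r.
Qed.

End convolution_algebra.

(** * The Banach algebra *)

Lemma ge0_hoelder d (T : measurableType d) (R : realType)
    (mu : {measure set T -> \bar R}) (p q : R) (u v : T -> R) :
    0 < p -> 0 < q -> p^-1 + q^-1 = 1 ->
    measurable_fun setT u -> measurable_fun setT v ->
    (forall x, 0 <= u x) -> (forall x, 0 <= v x) ->
  (\int[mu]_(x in [set: T]) (u x * v x)%:E <=
   (\int[mu]_(x in [set: T]) (u x `^ p)%:E) `^ p^-1 *
   (\int[mu]_(x in [set: T]) (v x `^ q)%:E) `^ q^-1)%E.
Proof.
move=> p0 q0 pq mu' mv u0 v0.
have LE (w : T -> R) (r : R) : (forall x, 0 <= w x) -> ('N[mu]_r%:E[EFin \o w] =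
    (\int[mu]_(x in [set: T]) (w x `^ r)%:E) `^ r^-1)%E.
  move=> w0; rewrite unlock; congr (_ `^ _)%E; apply: eq_integral => x _ /=.
  by rewrite ger0_norm.
have := hoelder mu mu' mv p0 q0 pq; rewrite (LE _ _ u0) (LE _ _ v0) Lnorm1.
congr (_ <= _)%E; apply: eq_integral => x _ /=.
by rewrite ger0_norm // mulr_ge0.
Qed.

(** * Convolution in the weighted space *)

Section weighted_convolution.
Context {R : realType} {G : topologicalZmodType}.
Variable mu : {sigma_finite_measure set (borel G) -> \bar R}.
Hypothesis mu_addr : forall (a : G) (A : set (borel G)), measurable A ->
  mu ((fun y : G => y + a) @^-1` A) = mu A.
Hypothesis mu_oppr : forall (A : set (borel G)), measurable A ->
  mu ((fun y : G => - y) @^-1` A) = mu A.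
Hypothesis diff_ae : forall f : G -> R,
  measurable_fun [set: borel G] (f : borel G -> R) ->
  exists2 g : G -> R, diff_measurable_fun g & {ae mu, forall x : borel G, f x = g x}.
Variables (p q : R) (p1 : 1 < p) (pq : p^-1 + q^-1 = 1).
Variable omega : weight R G.
Hypothesis omega_LPAlg : LPAlg mu omega q.
Implicit Types f g h : G -> R[i].

Let p0 : 0 < p. Proof. exact: lt_trans p1. Qed.

Let q0 : 0 < q.
Proof.
have : 0 < q^-1 by rewrite -(addKr p^-1 q^-1) pq addrC subr_gt0 invf_lt1.
by rewrite invr_gt0.
Qed.

Lemma weight_gt0 x : 0 < omega x.
Proof. exact: (lt_le_trans ltr01 (weight_ge1 omega x)). Qed.

Let weight_ge0 x : 0 <= omega x. Proof. exact/ltW/weight_gt0. Qed.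

(** Its L^1 norm is [Lp_integral]; it is complex-valued so that [absconv] applies to it. *)
Definition weighted_power f : G -> R[i] := fun x => ((normc (f x) * omega x) `^ p)%:C%C.

Lemma normc_weighted_power f x :
  normc (weighted_power f x) = (normc (f x) * omega x) `^ p.
Proof. by rewrite normc_real ger0_norm // powR_ge0. Qed.

Lemma cmeasurable_weighted_power f : cmeasurable f -> cmeasurable (weighted_power f).
Proof.
move=> mf; apply/cmeasurable_real.
apply: (@measurableT_comp _ _ _ _ _ _ (@powR R ^~ p)) => //.
by apply: measurable_funM; [exact: cmeasurable_normc|exact: weight_measurable].
Qed.

Lemma integral_weighted_power f :
  (\int[mu]_(x in [set: borel G]) (normc (weighted_power f x))%:E = Lp_integral mu omega p f)%E.
Proof.
apply: eq_integral => x _; rewrite normc_weighted_power powRM ?normc_ge0 //.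
Qed.

(** Hoelder's inequality for the product of (|f| omega)(y) (|g| omega)(x - y) and omega(y)^-1
    omega(x - y)^-1. By (LPAlg) the q-norm in y of the second factor is at most omega(x)^-1. *)
Lemma absconv_hoelder f g (x : G) : cmeasurable f -> cmeasurable g ->
  (absconv mu f g x <=
   (absconv mu (weighted_power f) (weighted_power g) x) `^ p^-1 * ((omega x)^-1)%:E)%E.
Proof.
move=> mf mg.
pose u (y : borel G) : R := normc (f y) * omega y * (normc (g (x - y)) * omega (x - y)).
pose v (y : borel G) : R := (omega y)^-1 * (omega (x - y))^-1.
have mw (r : R) : measurable_fun setT (fun y : borel G => omega y `^ r).
  by apply: (@measurableT_comp _ _ _ _ _ _ (@powR R ^~ r)) => //; exact: weight_measurable.
have mws (r : R) : measurable_fun setT (fun y : borel G => omega (x - y) `^ r).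
  exact: (measurableT_comp (mw r) (measurable_subl x)).
have mwV : measurable_fun setT (fun y : borel G => (omega y)^-1).
  by have := mw (- 1); under eq_fun do rewrite powR_inv1 //.
have mu' : measurable_fun setT u.
  apply: measurable_funM.
    by apply: measurable_funM; [exact: cmeasurable_normc|exact: weight_measurable].
  apply: measurable_funM; first by apply: cmeasurable_normc; exact: cmeasurable_subl.
  exact: (measurableT_comp (weight_measurable omega) (measurable_subl x)).
have mv : measurable_fun setT v.
  apply: measurable_funM => //.
  exact: (measurableT_comp mwV (measurable_subl x)).
have u0 y : 0 <= u y by rewrite !mulr_ge0 ?normc_ge0.
have v0 y : 0 <= v y by rewrite mulr_ge0 ?invr_ge0.
have := @ge0_hoelder _ _ _ mu p q u v p0 q0 pq mu' mv u0 v0.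
have -> : (\int[mu]_(y in [set: borel G]) (u y * v y)%:E = absconv mu f g x)%E.
  apply: eq_integral => y _; congr EFin; rewrite /u /v.
  have := lt0r_neq0 (weight_gt0 y); have := lt0r_neq0 (weight_gt0 (x - y)) => w1 w2.
  by field; rewrite w1.
have -> : (\int[mu]_(y in [set: borel G]) (u y `^ p)%:E =
    absconv mu (weighted_power f) (weighted_power g) x)%E.
  apply: eq_integral => y _; congr EFin; rewrite !normc_weighted_power.
  by rewrite powRM // mulr_ge0 ?normc_ge0.
move=> /le_trans; apply; apply: lee_pmul => //; try exact: poweR_ge0.
have -> : ((omega x)^-1 = (omega x `^ (- q)) `^ q^-1)%R.
  by rewrite -powRrM mulNr divff ?gt_eqF // powR_inv1.
rewrite -poweR_EFin; apply: gt0_ler_poweR.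
- by rewrite invr_ge0 ltW.
- by rewrite in_itv /= leey andbT integral_ge0 // => y _; rewrite lee_fin powR_ge0.
- by rewrite in_itv /= leey andbT lee_fin powR_ge0.
apply: le_trans (omega_LPAlg x); rewrite le_eqVlt; apply/orP; left; apply/eqP.
apply: eq_integral => y _; congr EFin; rewrite /v powRM ?invr_ge0 //.
by rewrite -!powR_inv1 // -!powRrM !mulN1r.
Qed.

Lemma Lp_integral_fin_num f : finite_Lp mu omega p f ->
  Lp_integral mu omega p f \is a fin_num.
Proof. by move=> [_ foo]; rewrite ge0_fin_numE //; exact: Lp_integral_ge0. Qed.

Lemma Lp_integralM_lty f g : finite_Lp mu omega p f -> finite_Lp mu omega p g ->
  (Lp_integral mu omega p f * Lp_integral mu omega p g < +oo)%E.
Proof.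
move=> ff [_ goo].
exact: (lte_mul_pinfty (Lp_integral_ge0 mu omega p f) (Lp_integral_fin_num ff) goo).
Qed.

Lemma absconv_weighted_lty f g : finite_Lp mu omega p f -> finite_Lp mu omega p g ->
  {ae mu, forall x : borel G,
    (absconv mu (weighted_power f) (weighted_power g) x < +oo)%E}.
Proof.
move=> ff fg; have [[mf _] [mg _]] := (ff, fg).
have mT := measurable_absconv mu_addr mu_oppr diff_ae (cmeasurable_weighted_power mf)
  (cmeasurable_weighted_power mg).
have iT : mu.-integrable [set: borel G] (absconv mu (weighted_power f) (weighted_power g)).
  apply/integrableP; split => //.
  under eq_integral do rewrite gee0_abs ?absconv_ge0 //.
  rewrite integral_absconv //; try exact: cmeasurable_weighted_power.
  by rewrite !integral_weighted_power; exact: Lp_integralM_lty.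
by have := integrable_ae measurableT iT; apply: filterS => x /(_ I) /fin_numPlt/andP[].
Qed.

Lemma absconv_lty f g (x : G) : cmeasurable f -> cmeasurable g ->
  (absconv mu (weighted_power f) (weighted_power g) x < +oo)%E ->
  (absconv mu f g x < +oo)%E.
Proof.
move=> mf mg Too; apply: (le_lt_trans (absconv_hoelder x mf mg)).
rewrite lte_mul_pinfty ?poweR_ge0 ?ltry //.
by rewrite fin_num_poweR // ge0_fin_numE // absconv_ge0.
Qed.

Lemma ae_absconv_lty f g : finite_Lp mu omega p f -> finite_Lp mu omega p g ->
  {ae mu, forall x : borel G, (absconv mu f g x < +oo)%E}.
Proof.
move=> ff fg; apply: filterS (absconv_weighted_lty ff fg) => x.
by apply: absconv_lty; [exact: ff.1|exact: fg.1].
Qed.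

(** Where the right side is finite, so is [absconv mu f g x], and elsewhere there is nothing to
    prove. Hence the bound on [r] is only asked for where the convolution converges, which matters
    because [cconv] has a default value at the other points. *)
Lemma powR_absconv_le f g (x : G) (r : R) : cmeasurable f -> cmeasurable g ->
    0 <= r -> (absconv mu f g x < +oo -> r%:E <= absconv mu f g x)%E ->
  ((r `^ p * omega x `^ p)%:E <= absconv mu (weighted_power f) (weighted_power g) x)%E.
Proof.
move=> mf mg r0 rfg.
have [->|Too] := eqVneq (absconv mu (weighted_power f) (weighted_power g) x) +oo%E.
  exact: leey.
have {}Too : (absconv mu (weighted_power f) (weighted_power g) x < +oo)%E by rewrite ltey.
have {}rfg := le_trans (rfg (absconv_lty mf mg Too)) (absconv_hoelder x mf mg).
have Tfin : absconv mu (weighted_power f) (weighted_power g) x \is a fin_num.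
  by rewrite ge0_fin_numE ?absconv_ge0.
move: rfg (absconv_ge0 mu (weighted_power f) (weighted_power g) x).
rewrite -(fineK Tfin); set T := fine _; rewrite poweR_EFin -EFinM !lee_fin => rT T0.
have -> : T = (T `^ p^-1) `^ p by rewrite -powRrM mulVf ?powRr1 // gt_eqF.
rewrite -powRM // ge0_ler_powR ?nnegrE ?mulr_ge0 ?powR_ge0 ?(ltW p0) //.
by rewrite -ler_pdivlMr ?weight_gt0.
Qed.

(** The pointwise bound is integrated, and Tonelli's theorem factors the right side. The function
    [k] is arbitrary so that the lemma serves both the convolution and the absolute convolution. *)
Lemma finite_Lp_dominated f g (k : G -> R[i]) :
    finite_Lp mu omega p f -> finite_Lp mu omega p g -> cmeasurable k ->
    (forall x, (absconv mu f g x < +oo -> (normc (k x))%:E <= absconv mu f g x)%E) ->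
  (Lp_integral mu omega p k <= Lp_integral mu omega p f * Lp_integral mu omega p g)%E.
Proof.
move=> [mf foo] [mg goo] mk kfg.
rewrite -[X in (_ <= X * _)%E]integral_weighted_power.
rewrite -[X in (_ <= _ * X)%E]integral_weighted_power.
rewrite -(integral_absconv mu_addr mu_oppr diff_ae); try exact: cmeasurable_weighted_power.
apply: ge0_le_integral => //.
- by move=> x _; rewrite lee_fin mulr_ge0 ?powR_ge0.
- apply/measurable_EFinP; apply: measurable_funM.
    apply: (@measurableT_comp _ _ _ _ _ _ (@powR R ^~ p)) => //.
    exact: cmeasurable_normc.
  apply: (@measurableT_comp _ _ _ _ _ _ (@powR R ^~ p)) => //.
  exact: weight_measurable.
- by apply: measurable_absconv => //; exact: cmeasurable_weighted_power.
- by move=> x _; apply: powR_absconv_le => //; [exact: normc_ge0|exact: kfg].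
Qed.

Lemma finite_Lp_le f g (k : G -> R[i]) :
    finite_Lp mu omega p f -> finite_Lp mu omega p g -> cmeasurable k ->
    (forall x, (absconv mu f g x < +oo -> (normc (k x))%:E <= absconv mu f g x)%E) ->
  finite_Lp mu omega p k.
Proof.
move=> ff fg mk kfg; split => //; apply: (le_lt_trans (finite_Lp_dominated ff fg mk kfg)).
exact: Lp_integralM_lty.
Qed.

Lemma finite_Lp_cconv f g : finite_Lp mu omega p f -> finite_Lp mu omega p g ->
  finite_Lp mu omega p (cconv mu f g).
Proof.
move=> ff fg; have [[mf _] [mg _]] := (ff, fg).
apply: (finite_Lp_le ff fg); first exact: cmeasurable_cconv.
by move=> x; exact: normc_cconv_le.
Qed.

Lemma Lp_norm_cconv f g : finite_Lp mu omega p f -> finite_Lp mu omega p g ->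
  Lp_norm mu omega p (cconv mu f g) <= Lp_norm mu omega p f * Lp_norm mu omega p g.
Proof.
move=> ff fg; have [[mf foo] [mg goo]] := (ff, fg).
have fc := finite_Lp_cconv ff fg.
have If k := fine_ge0 (Lp_integral_ge0 mu omega p k).
rewrite /Lp_norm -powRM //.
rewrite ge0_ler_powR ?nnegrE ?mulr_ge0 ?invr_ge0 ?(ltW p0) //.
have [nf ng nc] := And3 (Lp_integral_fin_num ff) (Lp_integral_fin_num fg) (Lp_integral_fin_num fc).
rewrite -(fineM nf ng); apply: (fine_le nc (fin_numM nf ng)).
apply: (finite_Lp_dominated ff fg fc.1) => x.
exact: (normc_cconv_le mf mg).
Qed.

(* The function [absconv mu f g] belongs to L^p(G, omega), so that the triple
   absolute convolution is almost everywhere finite. *)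
Lemma ae_absconv3_lty f g h : finite_Lp mu omega p f -> finite_Lp mu omega p g ->
    finite_Lp mu omega p h ->
  {ae mu, forall x : borel G, (\int[mu]_(z in [set: borel G])
    (absconv mu f g z * (normc (h (x - z)%R))%:E) < +oo)%E}.
Proof.
move=> ff fg fh; have [[mf _] [mg _] [mh _]] := And3 ff fg fh.
pose k (x : G) : R[i] := (fine (absconv mu f g x))%:C%C.
have mk : cmeasurable k.
  apply/cmeasurable_real; apply: (@measurableT_comp _ _ _ _ _ _ (@fine R)) => //.
  exact: measurable_absconv.
have kE x : (absconv mu f g x < +oo)%E -> (normc (k x))%:E = absconv mu f g x.
  move=> oo; rewrite normc_real ger0_norm ?fine_ge0 ?absconv_ge0 // fineK //.
  by rewrite ge0_fin_numE ?absconv_ge0.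
have fk : finite_Lp mu omega p k.
  by apply: (finite_Lp_le ff fg mk) => x oo; rewrite kE.
apply: filterS (ae_absconv_lty fk fh) => x; apply: le_lt_trans.
rewrite le_eqVlt; apply/orP; left; apply/eqP; apply: ge0_ae_eq_integral => //.
- apply: emeasurable_funM; first exact: measurable_absconv.
  by apply/measurable_EFinP; apply: cmeasurable_normc; exact: cmeasurable_subl.
- by apply/measurable_EFinP; apply: measurable_funM; apply: cmeasurable_normc => //;
    exact: cmeasurable_subl.
- by move=> z _; rewrite mule_ge0 ?absconv_ge0 // lee_fin normc_ge0.
- by move=> z _; rewrite lee_fin mulr_ge0 ?normc_ge0.
- by apply: filterS (ae_absconv_lty ff fg) => z oo _; rewrite EFinM kE.
Qed.

Lemma finite_Lp_involution f : finite_Lp mu omega p f ->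
  finite_Lp mu omega p (involution f) /\
  Lp_integral mu omega p (involution f) = Lp_integral mu omega p f.
Proof.
move=> [mf foo].
have mN := @measurable_oppr_borel G.
have E : Lp_integral mu omega p (involution f) = Lp_integral mu omega p f.
  rewrite /Lp_integral -[RHS](ge0_integral_oppr mu_oppr).
  - by apply: eq_integral => x _; rewrite /involution normc_conj weight_sym.
  - apply/measurable_EFinP; apply: measurable_funM.
      apply: (@measurableT_comp _ _ _ _ _ _ (@powR R ^~ p)) => //.
      exact: cmeasurable_normc.
    apply: (@measurableT_comp _ _ _ _ _ _ (@powR R ^~ p)) => //.
    exact: weight_measurable.
  - by move=> x; rewrite lee_fin mulr_ge0 ?powR_ge0.
split; [split; [|by rewrite E]|exact: E].
by apply: cmeasurable_conj; exact: (cmeasurable_comp mN mf).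
Qed.

End weighted_convolution.

Section Lp_algebra.
Context {R : realType} {G : topologicalZmodType}.
Variable mu : {sigma_finite_measure set (borel G) -> \bar R}.
Hypothesis mu_addr : forall (a : G) (A : set (borel G)), measurable A ->
  mu ((fun y : G => y + a) @^-1` A) = mu A.
Hypothesis mu_oppr : forall (A : set (borel G)), measurable A ->
  mu ((fun y : G => - y) @^-1` A) = mu A.
Hypothesis diff_ae : forall f : G -> R,
  measurable_fun [set: borel G] (f : borel G -> R) ->
  exists2 g : G -> R, diff_measurable_fun g & {ae mu, forall x : borel G, f x = g x}.
Variables (p q : R) (p1 : 1 < p) (pq : p^-1 + q^-1 = 1).
Variable omega : weight R G.
Hypothesis omega_LPAlg : LPAlg mu omega q.

Notation LF := (Lp_fun mu omega p1).
Notation L := (Lp mu omega p1).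

Lemma Lp_fun_cmeasurable (f : LF) : cmeasurable f.
Proof. by have [] := Lp_fun_finite f. Qed.

Definition to_Lp_fun (f : G -> R[i]) (ff : finite_Lp mu omega p f) : LF :=
  LpFun (asboolT ff : f \in Lp_pred mu omega p1).

Definition Lp_conv (f g : LF) : LF := to_Lp_fun
  (finite_Lp_cconv mu_addr mu_oppr diff_ae p1 pq omega_LPAlg (Lp_fun_finite f) (Lp_fun_finite g)).

Definition Lp_invol (f : LF) : LF :=
  to_Lp_fun (finite_Lp_involution mu_oppr (Lp_fun_finite f)).1.

Definition Lp_mul (a b : L) : L := Lp_class (Lp_conv (repr a) (repr b)).

Definition Lp_star (a : L) : L := Lp_class (Lp_invol (repr a)).

Lemma Lp_ind (P : L -> Prop) : (forall f : LF, P (Lp_class f)) -> forall a, P a.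
Proof. by move=> Pf a; rewrite -(Lp_reprK a). Qed.

Lemma Lp_mul_class (f g : LF) : Lp_mul (Lp_class f) (Lp_class g) = Lp_class (Lp_conv f g).
Proof.
apply/Lp_classP; apply: aeW => x /=; congr (_ x).
by apply: (ae_eq_cconv mu_addr mu_oppr); try exact: Lp_fun_cmeasurable; exact: Lp_repr_class.
Qed.

Lemma Lp_star_class (f : LF) : Lp_star (Lp_class f) = Lp_class (Lp_invol f).
Proof.
apply/Lp_classP; apply: filterS (ae_subl mu_addr mu_oppr 0 (Lp_repr_class f)) => x.
by rewrite sub0r /= /involution => ->.
Qed.

Lemma Lp_convolution_product : convolution_product Lp_mul.
Proof.
move=> f g; exists (Lp_conv f g); split; last exact: Lp_mul_class.
apply: filterS (ae_absconv_lty mu_addr mu_oppr diff_ae p1 pq omega_LPAlg (Lp_fun_finite f)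
  (Lp_fun_finite g)) => x fgx; split => //.
apply/cintegrable_integrand => //; exact: Lp_fun_cmeasurable.
Qed.

Lemma Lp_involution_map : involution_map Lp_star.
Proof. by move=> f; exists (Lp_invol f); split; last exact: Lp_star_class. Qed.

Let ae_lty (f g : LF) : {ae mu, forall x : borel G, (absconv mu f g x < +oo)%E}.
Proof.
exact: (ae_absconv_lty mu_addr mu_oppr diff_ae p1 pq omega_LPAlg (Lp_fun_finite f)
  (Lp_fun_finite g)).
Qed.

Lemma Lp_mulC : commutative Lp_mul.
Proof.
elim/Lp_ind => f; elim/Lp_ind => g; rewrite !Lp_mul_class.
apply/Lp_classP; apply: aeW => x /=.
by rewrite (cconvC mu_addr mu_oppr); try exact: Lp_fun_cmeasurable.
Qed.

Lemma Lp_mulA : associative Lp_mul.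
Proof.
elim/Lp_ind => f; elim/Lp_ind => g; elim/Lp_ind => h; rewrite !Lp_mul_class.
apply/Lp_classP.
apply: filterS (ae_absconv3_lty mu_addr mu_oppr diff_ae p1 pq omega_LPAlg
  (Lp_fun_finite f) (Lp_fun_finite g) (Lp_fun_finite h)) => x Foo /=.
by rewrite (cconvA mu_addr mu_oppr diff_ae) //; exact: Lp_fun_cmeasurable.
Qed.

Lemma Lp_mulDl : left_distributive Lp_mul +%R.
Proof.
elim/Lp_ind => f1; elim/Lp_ind => f2; elim/Lp_ind => g.
rewrite -Lp_classD !Lp_mul_class -Lp_classD.
apply/Lp_classP; apply: filterS2 (ae_lty f1 g) (ae_lty f2 g) => x o1 o2 /=.
exact: (cconvDl (Lp_fun_cmeasurable f1) (Lp_fun_cmeasurable f2) (Lp_fun_cmeasurable g) o1 o2).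
Qed.

Lemma Lp_mulDr : right_distributive Lp_mul +%R.
Proof. by move=> a b c; rewrite !(Lp_mulC a) Lp_mulDl. Qed.

Lemma Lp_mulZl (k : R[i]) (a b : L) : Lp_mul (k *: a) b = k *: Lp_mul a b.
Proof.
elim/Lp_ind: a => f; elim/Lp_ind: b => g.
rewrite -Lp_classZ !Lp_mul_class -Lp_classZ.
apply/Lp_classP; apply: filterS (ae_lty f g) => x o1 /=.
exact: (cconvZl k (Lp_fun_cmeasurable f) (Lp_fun_cmeasurable g) o1).
Qed.

Lemma Lp_mulZr (k : R[i]) (a b : L) : Lp_mul a (k *: b) = k *: Lp_mul a b.
Proof. by rewrite Lp_mulC Lp_mulZl Lp_mulC. Qed.

Lemma Lp_normM (a b : L) : `|Lp_mul a b| <= `|a| * `|b|.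
Proof.
elim/Lp_ind: a => f; elim/Lp_ind: b => g.
rewrite Lp_mul_class !Lp_class_norm -rmorphM lecR.
exact: (Lp_norm_cconv mu_addr mu_oppr diff_ae p1 pq omega_LPAlg (Lp_fun_finite f)
  (Lp_fun_finite g)).
Qed.

Lemma Lp_starK : involutive Lp_star.
Proof.
elim/Lp_ind => f; rewrite !Lp_star_class; congr Lp_class; apply: val_inj => /=.
by apply/funext => x; rewrite /involution opprK conjcK.
Qed.

Lemma Lp_starD : {morph Lp_star : a b / a + b}.
Proof.
elim/Lp_ind => f; elim/Lp_ind => g.
rewrite -Lp_classD !Lp_star_class -Lp_classD; congr Lp_class; apply: val_inj => /=.
by apply/funext => x; rewrite /involution !fctE rmorphD.
Qed.

Lemma Lp_starZ (k : R[i]) (a : L) : Lp_star (k *: a) = (k^*)%C *: Lp_star a.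
Proof.
elim/Lp_ind: a => f.
rewrite -Lp_classZ !Lp_star_class -Lp_classZ; congr Lp_class; apply: val_inj => /=.
by apply/funext => x; rewrite /involution !fctE rmorphM.
Qed.

Lemma Lp_starM (a b : L) : Lp_star (Lp_mul a b) = Lp_mul (Lp_star b) (Lp_star a).
Proof.
rewrite [RHS]Lp_mulC; elim/Lp_ind: a => f; elim/Lp_ind: b => g.
rewrite Lp_mul_class !Lp_star_class Lp_mul_class.
apply/Lp_classP; apply: filterS (ae_subl mu_addr mu_oppr 0 (ae_lty f g)) => x.
rewrite sub0r => o1 /=.
by rewrite (cconv_involution mu_addr mu_oppr) //; exact: Lp_fun_cmeasurable.
Qed.

Lemma Lp_norm_star (a : L) : `|Lp_star a| = `|a|.
Proof.
elim/Lp_ind: a => f; rewrite Lp_star_class !Lp_class_norm.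
have -> // : Lp_norm mu omega p (Lp_invol f) = Lp_norm mu omega p f.
have -> : (Lp_invol f : G -> R[i]) = involution f by [].
by rewrite /Lp_norm (finite_Lp_involution mu_oppr (Lp_fun_finite f)).2.
Qed.

End Lp_algebra.

(** * Completeness *)

Section real_sequences.
Context {R : realType}.

Lemma cvg_powR (p : R) (u : R^nat) (a : R) : 0 < p -> (forall n, 0 <= u n) ->
  u @ \oo --> a -> (fun n => u n `^ p) @ \oo --> a `^ p.
Proof.
move=> p0 u0 ua; have a0 : 0 <= a.
  rewrite -(cvg_lim (@Rhausdorff R) ua).
  by apply: limr_ge; [apply/cvg_ex; exists a|exact: nearW].
move: a0; rewrite le_eqVlt => /predU1P[a0|a0].
  rewrite -a0 powR0 ?gt_eqF //; apply/cvgrPdist_lt => e e0.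
  have e0' : 0 < e `^ p^-1 by rewrite powR_gt0.
  move/cvgrPdist_lt : ua => /(_ _ e0'); apply: filterS => n.
  rewrite -a0 !sub0r !normrN !ger0_norm ?powR_ge0 // => ue.
  have -> : e = (e `^ p^-1) `^ p by rewrite -powRrM mulVf ?powRr1 ?ltW ?gt_eqF.
  by rewrite gt0_ltr_powR ?nnegrE ?powR_ge0.
apply: (@cvg_comp _ _ _ u (fun x => x `^ p) _ _ _ ua).
have /derivable1_diffP/differentiable_continuous : derivable (fun x : R => x `^ p) a 1.
  by apply: derivable_powR; rewrite in_itv /= a0.
by [].
Qed.

(** The sequence is its first term plus a telescoping series that converges absolutely. *)
Lemma bounded_increments_cvg (u : R^nat) (M : R) :
  (forall n, \sum_(0 <= k < n) `|u k.+1 - u k| <= M) -> cvgn u.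
Proof.
move=> uM; have : cvgn [normed series (telescope u)].
  apply: nondecreasing_is_cvgn.
    apply/nondecreasing_seqP => n; rewrite -subr_ge0.
    rewrite (_ : [normed series (telescope u)] =
      fun n => \sum_(0 <= k < n) `|u k.+1 - u k|) //.
    by rewrite big_nat_recr //= addrAC subrr add0r.
  by exists M => _ [n _ <-]; exact: uM.
move=> /normed_cvg; rewrite telescopeK => /is_cvgD => /(_ (cst (u 0%N))) h.
have hc : cvgn (cst (u 0%N) : R^nat) by exact: is_cvg_cst.
have := h hc; suff -> : [sequence u n - u 0%N]_n + cst (u 0%N) = u by [].
by apply/funext => n; rewrite fctE /= subrK.
Qed.

Lemma sum_half_pow_le (n : nat) : \sum_(0 <= k < n) (2^-1 : R) ^+ k <= 2.
Proof.
have -> : \sum_(0 <= k < n) (2^-1 : R) ^+ k = 2 - 2 * 2^-1 ^+ n.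
  elim: n => [|n IH]; first by rewrite big_nil expr0 mulr1 subrr.
  by rewrite big_nat_recr //= IH exprS; lra.
by rewrite lerBlDr lerDl mulr_ge0 ?exprn_ge0.
Qed.

End real_sequences.

Section cauchy_sequences.
Context {R : realType} {V : normedModType R[i]}.

(** Cauchy filters are reduced to sequences with geometrically small increments, for which an almost
    everywhere limit can be constructed. *)
Lemma complete_of_fast_sequences :
    (forall u : V^nat, (forall n, `|u n.+1 - u n| <= ((2^-1 ^+ n)%:C)%C) ->
      exists l : V, forall n, `|u n - l| <= ((2 * 2^-1 ^+ n)%:C)%C) ->
  forall F : set_system V, ProperFilter F -> cauchy F -> cvg F.
Proof.
move=> fast F FF /cauchyP Fc.
have h0 n : (0 : R[i]) < ((2^-1 ^+ n.+2)%:C)%C by rewrite ltcR exprn_gt0 ?invr_gt0.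
(* Balls of consecutive indices meet because both belong to the proper filter F; the radius 2^-(n+2)
   keeps their centres within 2^-n of each other. *)
have /choice[u uP] : forall n : nat, exists x : V, F (ball x ((2^-1 ^+ n.+2)%:C)%C).
  by move=> n; exact: Fc.
have [n|l ul] := fast u.
  have [y [/= y1 y2]] := filter_ex (filterI (uP n) (uP n.+1)).
  move: y1 y2; rewrite -!ball_normE /= => y1 y2.
  rewrite distrC; apply: (le_trans (ler_distD y _ _)).
  rewrite distrC in y2; apply: (le_trans (lerD (ltW y1) (ltW y2))).
  rewrite -rmorphD lecR !exprS; have : 0 <= (2^-1 : R) ^+ n by rewrite exprn_ge0.
  lra.
apply/cvg_ex; exists l; apply/cvgrPdist_lt => -[e e'] e0.
have [e0' e0''] : e' = 0 /\ 0 < e.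
  by move: e0; rewrite ltcE /= => /andP[/eqP].
have [n nP] : exists n, 3 * (2^-1 : R) ^+ n < e.
  have : (fun n => (2^-1 : R) ^+ n) @ \oo --> 0.
    by apply: cvg_expr; rewrite ger0_norm ?invr_ge0 //; lra.
  move=> /cvgrPdist_lt /(_ (e / 3)); case; first by rewrite divr_gt0.
  move=> n _ /(_ n (leqnn n)) /=; rewrite sub0r normrN ger0_norm ?exprn_ge0 // => ne.
  by exists n; lra.
apply: filterS (uP n) => y; rewrite -ball_normE /= => y1.
apply: (le_lt_trans (ler_distD (u n) _ _)); rewrite (distrC l).
apply: (@le_lt_trans _ _ ((2 * 2^-1 ^+ n + 2^-1 ^+ n.+2)%:C)%C).
  by rewrite rmorphD; apply: lerD => //; exact: ltW.
rewrite e0' -complexr0 ltcR; apply: le_lt_trans nP.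
rewrite !exprS; have : 0 <= (2^-1 : R) ^+ n by rewrite exprn_ge0.
lra.
Qed.

End cauchy_sequences.

Section Lp_complete.
Context {R : realType} {G : topologicalZmodType}.
Variable mu : {measure set (borel G) -> \bar R}.
Variables (p : R) (p1 : 1 < p).
Variable omega : weight R G.

Notation LF := (Lp_fun mu omega p1).
Notation L := (Lp mu omega p1).

Let p0 : 0 < p. Proof. exact: lt_trans p1. Qed.

Lemma finite_Lp0 : finite_Lp mu omega p (0 : G -> R[i]).
Proof. exact: (asboolW (finite_Lp_submod_closed mu omega p1).1). Qed.

Lemma finite_LpD (f g : G -> R[i]) : finite_Lp mu omega p f -> finite_Lp mu omega p g ->
  finite_Lp mu omega p (f + g).
Proof.
move=> ff fg; have [_ /(_ 1 f g)] := finite_Lp_submod_closed mu omega p1.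
rewrite scale1r => /(_ (asboolT ff) (asboolT fg)); exact: asboolW.
Qed.

Lemma finite_LpZ (k : R[i]) (f : G -> R[i]) : finite_Lp mu omega p f ->
  finite_Lp mu omega p (k *: f).
Proof.
move=> ff; have [h0 hZ] := finite_Lp_submod_closed mu omega p1.
have := hZ k f 0 (asboolT ff) h0; rewrite addr0; exact: asboolW.
Qed.

Lemma finite_LpB (f g : G -> R[i]) : finite_Lp mu omega p f -> finite_Lp mu omega p g ->
  finite_Lp mu omega p (f - g).
Proof.
move=> ff fg; have -> : f - g = f + (-1) *: g by rewrite scaleN1r.
exact: (finite_LpD ff (finite_LpZ (-1) fg)).
Qed.

Lemma Lp_norm0 : Lp_norm mu omega p (0 : G -> R[i]) = 0.
Proof.
by rewrite -(scale0r (0 : G -> R[i])) (Lp_normZ p1 0 finite_Lp0) normc0 mul0r.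
Qed.

Lemma Lp_norm_ge0 (f : G -> R[i]) : 0 <= Lp_norm mu omega p f.
Proof. exact: powR_ge0. Qed.

Lemma Lp_integral_fin (f : G -> R[i]) : finite_Lp mu omega p f ->
  Lp_integral mu omega p f \is a fin_num.
Proof. by move=> [_ foo]; rewrite ge0_fin_numE //; exact: Lp_integral_ge0. Qed.

Lemma Lp_integral_powR (f : G -> R[i]) : finite_Lp mu omega p f ->
  Lp_integral mu omega p f = (Lp_norm mu omega p f `^ p)%:E.
Proof.
move=> ff; have If := fine_ge0 (Lp_integral_ge0 mu omega p f).
rewrite /Lp_norm -powRrM mulVf ?gt_eqF // powRr1; last exact: If.
exact: (esym (fineK (Lp_integral_fin ff))).
Qed.

Lemma Lp_norm_le (f : G -> R[i]) (c : R) : cmeasurable f -> 0 <= c ->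
    (Lp_integral mu omega p f <= (c `^ p)%:E)%E ->
  finite_Lp mu omega p f /\ Lp_norm mu omega p f <= c.
Proof.
move=> mf c0 fc; have ff : finite_Lp mu omega p f.
  by split=> //; apply: (le_lt_trans fc); rewrite ltry.
split=> //; move: fc; rewrite (Lp_integral_powR ff) lee_fin => fc.
rewrite leNgt; apply/negP => cf; move: fc; apply/negP; rewrite -ltNge.
by rewrite gt0_ltr_powR ?nnegrE ?Lp_norm_ge0.
Qed.

Lemma finite_Lp_normc (f : G -> R[i]) : finite_Lp mu omega p f ->
  finite_Lp mu omega p (fun x => (normc (f x))%:C%C) /\
  Lp_norm mu omega p (fun x => (normc (f x))%:C%C) = Lp_norm mu omega p f.
Proof.
move=> [mf foo].
have E : Lp_integral mu omega p (fun x => (normc (f x))%:C%C) = Lp_integral mu omega p f.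
  by apply: eq_integral => x _; rewrite normc_real ger0_norm ?normc_ge0.
split; last by rewrite /Lp_norm E.
by split; [apply/cmeasurable_real; exact: cmeasurable_normc|rewrite E].
Qed.

Lemma measurable_Lp_integrand (f : G -> R[i]) : cmeasurable f ->
  measurable_fun [set: borel G] (fun x : borel G => (normc (f x) `^ p * omega x `^ p)%:E).
Proof.
move=> mf; apply/measurable_EFinP; apply: measurable_funM.
  apply: (@measurableT_comp _ _ _ _ _ _ (@powR R ^~ p)) => //.
  exact: cmeasurable_normc.
apply: (@measurableT_comp _ _ _ _ _ _ (@powR R ^~ p)) => //.
exact: weight_measurable.
Qed.

Section fast_sequence.
Variable f : nat -> G -> R[i].
Hypothesis finf : forall n, finite_Lp mu omega p (f n).
Hypothesis fast : forall n, Lp_norm mu omega p (f n.+1 - f n) <= 2^-1 ^+ n.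

Let Lp_dist n k : Lp_norm mu omega p (f n - f (n + k)%N) <= 2 * 2^-1 ^+ n.
Proof.
suff : Lp_norm mu omega p (f n - f (n + k)%N) <= 2^-1 ^+ n * \sum_(0 <= j < k) 2^-1 ^+ j.
  move=> /le_trans; apply; rewrite mulrC ler_wpM2r ?exprn_ge0 //.
  exact: sum_half_pow_le.
elim: k => [|k IH].
  by rewrite addn0 subrr big_nil mulr0 Lp_norm0.
rewrite big_nat_recr //= mulrDr -exprD addnS.
have -> : f n - f (n + k).+1 = (f n - f (n + k)%N) + (-1) *: (f (n + k).+1 - f (n + k)%N).
  by rewrite scaleN1r opprB addrA subrK.
have fb m := finite_LpB (finf n) (finf m).
have fb' := finite_LpB (finf (n + k).+1) (finf (n + k)%N).
apply: (le_trans (Lp_normD p1 (fb _) (finite_LpZ (-1) fb'))).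
apply: lerD => //; rewrite (Lp_normZ p1 _ fb').
by rewrite normcN normc1 mul1r.
Qed.

Let incr N (x : G) : R := \sum_(0 <= k < N) normc (f k.+1 x - f k x).

Let incr_finite N : finite_Lp mu omega p (fun x => (incr N x)%:C%C) /\
  Lp_norm mu omega p (fun x => (incr N x)%:C%C) <= 2.
Proof.
suff [h1 h2] : finite_Lp mu omega p (fun x => (incr N x)%:C%C) /\
  Lp_norm mu omega p (fun x => (incr N x)%:C%C) <= \sum_(0 <= j < N) 2^-1 ^+ j.
  by split => //; apply: (le_trans h2); exact: sum_half_pow_le.
elim: N => [|N [IH1 IH2]].
  have -> : (fun x => (incr 0 x)%:C%C) = 0 :> (G -> R[i]).
    by apply/funext => x; rewrite /incr big_nil.
  by split; [exact: finite_Lp0|rewrite Lp_norm0 big_nil].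
have fb' := finite_LpB (finf N.+1) (finf N).
have [fn fnE] := finite_Lp_normc fb'.
have -> : (fun x => (incr N.+1 x)%:C%C) =
   (fun x => (incr N x)%:C%C) + (fun x => (normc ((f N.+1 - f N) x))%:C%C).
  apply/funext => x.
  transitivity (((incr N x)%:C + (normc ((f N.+1 - f N) x))%:C)%C); last by [].
  have E : f N.+1 x - f N x = (f N.+1 - f N) x by [].
  by rewrite -rmorphD /incr big_nat_recr // E.
split; first exact: (finite_LpD IH1 fn).
have h := Lp_normD p1 IH1 fn; rewrite fnE in h.
have -> : \sum_(0 <= j < N.+1) (2^-1 : R) ^+ j = \sum_(0 <= j < N) 2^-1 ^+ j + 2^-1 ^+ N.
  by rewrite big_nat_recr.
exact: (le_trans h (lerD IH2 (fast N))).
Qed.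

(** Minkowski's inequality bounds the norms of the partial sums [incr N] by 2. By monotone
    convergence the supremum of their weighted powers is integrable, hence finite almost
    everywhere. *)
Let ae_bounded : {ae mu, forall x : borel G, exists M, forall N, incr N x <= M}.
Proof.
pose g N (x : borel G) : \bar R := (normc ((incr N x)%:C%C) `^ p * omega x `^ p)%:E.
have mg N : measurable_fun [set: borel G] (g N).
  by apply: measurable_Lp_integrand; exact: (incr_finite N).1.1.
have incr0 N x : 0 <= incr N x by apply: sumr_ge0 => k _; exact: normc_ge0.
have gE N x : g N x = (incr N x `^ p * omega x `^ p)%:E.
  by rewrite /g normc_real ger0_norm.
have g0 N x : (0 <= g N x)%E by rewrite lee_fin mulr_ge0 ?powR_ge0.
have gnd (x : borel G) : {homo g ^~ x : n m / (n <= m)%N >-> (n <= m)%E}.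
  move=> n m nm; rewrite !gE lee_fin ler_wpM2r ?powR_ge0 //.
  apply: ge0_ler_powR; rewrite ?nnegrE ?(ltW p0) //.
  rewrite /incr [leRHS](big_cat_nat (n := n)) //= lerDl.
  by apply: sumr_ge0 => k _; exact: normc_ge0.
pose S (x : borel G) := ereal_sup (range (g ^~ x)).
have SE x : limn (g ^~ x) = S x.
  by apply/cvg_lim => //; exact: ereal_nondecreasing_cvgn.
have mS : measurable_fun [set: borel G] S.
  rewrite (_ : S = fun x => limn_esup (g ^~ x)).
    exact: measurable_fun_limn_esup.
  apply/funext => x; rewrite is_cvg_limn_esupE; first by rewrite SE.
  by apply: ereal_nondecreasing_is_cvgn.
have S0 x : (0 <= S x)%E by apply: (le_trans (g0 0%N x)); apply: ereal_sup_ubound; exists 0%N.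
have iS : mu.-integrable [set: borel G] S.
  apply/integrableP; split => //; under eq_integral do rewrite gee0_abs //.
  apply: (@le_lt_trans _ _ (2 `^ p)%:E); last by rewrite ltry.
  under eq_integral do rewrite -SE.
  rewrite (monotone_convergence mu measurableT mg) //.
  apply: lime_le.
    apply: ereal_nondecreasing_is_cvgn => n m nm.
    by apply: ge0_le_integral => // x _; exact: gnd.
  apply: nearW => N; have [ff f2] := incr_finite N.
  rewrite -[X in (X <= _)%E]/(Lp_integral mu omega p (fun x => (incr N x)%:C%C)).
  rewrite (Lp_integral_powR ff) lee_fin ge0_ler_powR ?nnegrE ?(ltW p0) //.
  exact: Lp_norm_ge0.
have := integrable_ae measurableT iS; apply: filterS => x /(_ I) Sx.
exists ((fine (S x)) `^ p^-1) => N.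
have NS : incr N x `^ p * omega x `^ p <= fine (S x).
  by rewrite -lee_fin -gE fineK //; apply: ereal_sup_ubound; exists N.
have -> : incr N x = (incr N x `^ p) `^ p^-1 by rewrite -powRrM divff ?powRr1 ?gt_eqF.
apply: ge0_ler_powR.
- by rewrite invr_ge0 ltW.
- by rewrite nnegrE powR_ge0.
- by rewrite nnegrE fine_ge0.
apply: le_trans NS; rewrite -[leLHS]mulr1 ler_wpM2l ?powR_ge0 //.
by rewrite -(powRr0 (omega x)) ler_powR ?weight_ge1 // ltW.
Qed.

(** The Riesz-Fischer argument: bounded increments give a pointwise limit almost everywhere, and
    Fatou's lemma gives the rate. *)
Lemma fast_sequence_limit : exists g : G -> R[i], finite_Lp mu omega p g /\
  forall n, Lp_norm mu omega p (f n - g) <= 2 * 2^-1 ^+ n.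
Proof.
have [N [mN N0 bN]] := ae_bounded.
(* The terms are set to 0 on the exceptional null set, so that they converge everywhere and the
   limit is measurable. *)
pose g n (x : G) : R[i] := if x \in N then 0 else f n x.
have mind : measurable (~` N) by exact: measurableC.
have gE n : g n = fun x => ((\1_(~` N) x)%:C%C * f n x).
  apply/funext => x; rewrite /g indicE in_setC.
  by case: (x \in N); rewrite /= ?mul0r ?mul1r.
have mg n : cmeasurable (g n).
  rewrite gE; apply: cmeasurableM; last exact: (finf n).1.
  by apply/cmeasurable_real; exact: measurable_indic.
have gcvg (x : G) : cvgn (fun n => complex.Re (g n x)) /\ cvgn (fun n => complex.Im (g n x)).
  have [xN|xN] := boolP (x \in N).
    by rewrite /g xN; split; exact: is_cvg_cst.
  have [M xM] : exists M, forall n, incr n x <= M.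
    by apply: contrapT => h; move: xN; rewrite notin_setE; apply; exact: bN.
  rewrite /g (negbTE xN); split; apply: (@bounded_increments_cvg _ _ M) => n;
    apply: le_trans (xM n); apply: ler_sum => k _.
    by rewrite (le_trans _ (normr_Re_le _)) //; case: (f k.+1 x) (f k x) => [a b] [c d].
  by rewrite (le_trans _ (normr_Im_le _)) //; case: (f k.+1 x) (f k x) => [a b] [c d].
pose F (x : G) : R[i] := Complex (limn (fun n => complex.Re (g n x)))
  (limn (fun n => complex.Im (g n x))).
have mF : cmeasurable F.
  split.
    apply: (@measurable_fun_cvg _ (borel G) R setT (fun n (x : borel G) => complex.Re (g n x))) => //.
      by move=> n; have [] := mg n.
    by move=> x _; exact: (gcvg x).1.
  apply: (@measurable_fun_cvg _ (borel G) R setT (fun n (x : borel G) => complex.Im (g n x))) => //.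
    by move=> n; have [] := mg n.
  by move=> x _; exact: (gcvg x).2.
have normcvg n x : (fun m => normc (f n x - g (m + n)%N x)) @ \oo --> normc (f n x - F x).
  have cr : (fun m => complex.Re (g (m + n)%N x)) @ \oo --> complex.Re (F x).
    by rewrite (cvg_shiftn n (fun m => complex.Re (g m x))); exact: (gcvg x).1.
  have ci : (fun m => complex.Im (g (m + n)%N x)) @ \oo --> complex.Im (F x).
    by rewrite (cvg_shiftn n (fun m => complex.Im (g m x))); exact: (gcvg x).2.
  have nE (z : R[i]) : normc z = Num.sqrt (complex.Re z ^+ 2 + complex.Im z ^+ 2).
    by rewrite -sqr_normc sqrtr_sqr ger0_norm // normc_ge0.
  rewrite nE; under eq_fun do rewrite nE.
  apply: (@cvg_comp _ _ _ _ (@Num.sqrt R)); last exact: sqrt_continuous.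
  have cReB (z w : R[i]) : complex.Re (z - w) = complex.Re z - complex.Re w.
    by case: z w => [a b] [c d].
  have cImB (z w : R[i]) : complex.Im (z - w) = complex.Im z - complex.Im w.
    by case: z w => [a b] [c d].
  rewrite cReB cImB; under eq_fun do rewrite cReB cImB.
  have dr : (fun m => complex.Re (f n x) - complex.Re (g (m + n)%N x)) @ \oo -->
      complex.Re (f n x) - complex.Re (F x) by apply: cvgB => //; exact: cvg_cst.
  have di : (fun m => complex.Im (f n x) - complex.Im (g (m + n)%N x)) @ \oo -->
      complex.Im (f n x) - complex.Im (F x) by apply: cvgB => //; exact: cvg_cst.
  exact: (cvgD (cvgM dr dr) (cvgM di di)).
have gf n : {ae mu, forall x : borel G, g n x = f n x}.
  exists N; split => // x; apply: contra_notP => xN.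
  by rewrite /= /g memNset.
(* Fatou's lemma in m for f n - f (m + n), whose norms are bounded by [Lp_dist] uniformly in m. *)
have key n : (Lp_integral mu omega p (f n - F)%R <= ((2 * 2^-1 ^+ n) `^ p)%:E)%E.
  pose u m (x : borel G) : \bar R := (normc (f n x - g (m + n)%N x) `^ p * omega x `^ p)%:E.
  have mfg m : cmeasurable (f n - g m).
    apply: cmeasurableD; first exact: (finf n).1.
    by rewrite -scaleN1r; exact: (cmeasurableZ (-1) (mg m)).
  have mu' m : measurable_fun [set: borel G] (u m).
    exact: (measurable_Lp_integrand (mfg (m + n)%N)).
  have u0 m (x : borel G) : [set: borel G] x -> (0 <= u m x)%E.
    by move=> _; rewrite lee_fin mulr_ge0 ?powR_ge0.
  have -> : Lp_integral mu omega p (f n - F)%R =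
      (\int[mu]_(x in [set: borel G]) limn_einf (u ^~ x))%E.
    apply: eq_integral => x _; apply/esym; apply: (cvg_limn_einf_sup _).1.
    apply: cvg_EFin; first exact: nearW.
    apply: cvgM; last exact: cvg_cst.
    by apply: cvg_powR => // m; exact: normc_ge0.
  apply: (le_trans (fatou mu measurableT mu' u0)).
  rewrite limn_einf_lim; apply: lime_le; first exact: is_cvg_einfs.
  apply: nearW => m; apply: (@le_trans _ _ (\int[mu]_(x in [set: borel G]) u m x)%E).
    by apply: ereal_inf_lbound; exists m => //=.
  have ffm := finite_LpB (finf n) (finf (m + n)%N).
  have -> : (\int[mu]_(x in [set: borel G]) u m x = Lp_integral mu omega p (f n - f (m + n)%N)%R)%E.
    apply: ge0_ae_eq_integral => //.
    - exact: (measurable_Lp_integrand ffm.1).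
    - exact: u0.
    - by move=> x _; rewrite lee_fin mulr_ge0 ?powR_ge0.
    - by apply: filterS (gf (m + n)%N) => x gx _; rewrite /u gx.
  rewrite (Lp_integral_powR ffm) lee_fin; apply: ge0_ler_powR.
  - exact: ltW.
  - by rewrite nnegrE Lp_norm_ge0.
  - by rewrite nnegrE mulr_ge0 ?exprn_ge0.
  - by rewrite addnC; exact: Lp_dist.
have c0 n : 0 <= 2 * (2^-1 : R) ^+ n by rewrite mulr_ge0 ?exprn_ge0.
have mfF n : cmeasurable (f n - F).
  apply: cmeasurableD; first exact: (finf n).1.
  by rewrite -scaleN1r; exact: (cmeasurableZ (-1) mF).
exists F; split; last by move=> n; exact: (Lp_norm_le (mfF n) (c0 n) (key n)).2.
have -> : F = f 0%N - (f 0%N - F) by rewrite opprB addrC subrK.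
exact: (finite_LpB (finf 0%N) (Lp_norm_le (mfF 0%N) (c0 0%N) (key 0%N)).1).
Qed.

End fast_sequence.

Lemma Lp_classB (f g : LF) : Lp_class (f - g) = Lp_class f - Lp_class g.
Proof. by rewrite -scaleN1r Lp_classD Lp_classZ scaleN1r. Qed.

Lemma Lp_banach (F : set_system L) : ProperFilter F -> cauchy F -> cvg F.
Proof.
apply: complete_of_fast_sequences => u uf.
have ur n : Lp_class (repr (u n)) = u n by exact: Lp_reprK.
have fu n := Lp_fun_finite (repr (u n)).
have fast n : Lp_norm mu omega p (repr (u n.+1) - repr (u n) : LF) <= 2^-1 ^+ n.
  have E : u n.+1 - u n = Lp_class (repr (u n.+1) - repr (u n)) by rewrite Lp_classB !ur.
  by have := uf n; rewrite E Lp_class_norm lecR.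
have [g [fg gP]] := @fast_sequence_limit (fun n => repr (u n)) fu fast.
pose g' : LF := LpFun (asboolT fg : g \in Lp_pred mu omega p1).
exists (Lp_class g') => n.
have -> : u n - Lp_class g' = Lp_class (repr (u n) - g') by rewrite Lp_classB ur.
by rewrite Lp_class_norm lecR; exact: gP.
Qed.

End Lp_complete.

(** * Functions supported in a power of the neighbourhood *)

Section bounded_support.
Context {R : realType} {G : topologicalZmodType}.
Variable mu : {sigma_finite_measure set (borel G) -> \bar R}.
Hypothesis mu_addr : forall (a : G) (A : set (borel G)), measurable A ->
  mu ((fun y : G => y + a) @^-1` A) = mu A.
Hypothesis mu_oppr : forall (A : set (borel G)), measurable A ->
  mu ((fun y : G => - y) @^-1` A) = mu A.
Hypothesis diff_ae : forall f : G -> R,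
  measurable_fun [set: borel G] (f : borel G -> R) ->
  exists2 g : G -> R, diff_measurable_fun g & {ae mu, forall x : borel G, f x = g x}.
Variable B : (set G)^nat.
Hypothesis B_measurable : forall n, measurable (B n : set (borel G)).
Hypothesis B_lty : forall n, (mu (B n : set (borel G)) < +oo)%E.
Hypothesis B_add : forall m n x y, B m x -> B n y -> B (m + n) (x + y).
Hypothesis B_opp : forall n x, B n x -> B n (- x).
Hypothesis B_le : forall m n, (m <= n)%N -> B m `<=` B n.
Implicit Types f g h u v : G -> R[i].

(** The sets [B n] will be the n-fold sums of a compact symmetric neighbourhood. On these functions
    all convolution integrals converge at every point, so the algebraic identities hold everywhere
    and not only almost everywhere. *)
Definition bsupp n f := [/\ cmeasurable f, exists M, forall x, normc (f x) <= M &
  forall x, ~ B n x -> f x = 0].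

Lemma bsupp_cmeasurable n f : bsupp n f -> cmeasurable f.
Proof. by case. Qed.

Lemma bsupp_bound n f : bsupp n f -> exists2 M, 0 < M & forall x, normc (f x) <= M.
Proof.
case=> _ [M fM] _; exists (`|M| + 1) => [|x]; first by rewrite ltr_wpDl.
by rewrite (le_trans (fM x)) // (le_trans (ler_norm M)) // lerDl.
Qed.

Lemma bsupp_le m n f : (m <= n)%N -> bsupp m f -> bsupp n f.
Proof.
move=> mn [mf bf sf]; split => // x nBx; apply: sf => Bx; apply: nBx.
exact: (B_le mn Bx).
Qed.

Lemma bsupp_integrable n f : bsupp n f -> cintegrable mu f.
Proof.
move=> bf; have [M M0 fM] := bsupp_bound bf; have [mf _ sf] := bf.
apply: (@le_cintegrable _ _ mu f (fun x => M * \1_(B n) x)) => //.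
  have iB : mu.-integrable [set: borel G] (EFin \o \1_(B n : set (borel G))).
    apply/integrableP; split; first by apply/measurable_EFinP; exact: measurable_indic.
    rewrite (eq_integral (fun x => (\1_(B n : set (borel G)) x)%:E)).
      by rewrite integral_indic ?setIT; [exact: B_lty|exact: measurableT|exact: B_measurable].
    by move=> x _; rewrite /= ger0_norm.
  exact: (integrableZl measurableT M iB).
move=> x; rewrite indicE; have [Bx|Bx] := pselect (B n x).
  by rewrite mem_set // mulr1.
by rewrite memNset // mulr0 sf // normc0.
Qed.

Lemma bsuppD n f g : bsupp n f -> bsupp n g -> bsupp n (fun x => f x + g x).
Proof.
move=> [mf [M fM] sf] [mg [M' gM] sg]; split.
- exact: cmeasurableD.
- exists (M + M') => x; exact: (le_trans (le_normcD _ _) (lerD (fM x) (gM x))).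
- by move=> x nB; rewrite sf // sg // addr0.
Qed.

Lemma bsuppM n f g : bsupp n f -> cmeasurable g -> (exists M, forall x, normc (g x) <= M) ->
  bsupp n (fun x => f x * g x).
Proof.
move=> [mf [M fM] sf] mg [M' gM]; split.
- exact: cmeasurableM.
- by exists (M * M') => x; rewrite normcM ler_pM ?normc_ge0.
- by move=> x nB; rewrite sf // mul0r.
Qed.

Lemma bsuppZ n (c : R[i]) f : bsupp n f -> bsupp n (fun x => c * f x).
Proof.
move=> [mf [M fM] sf]; split.
- exact: (cmeasurableM (cmeasurable_cst c) mf).
- by exists (normc c * M) => x; rewrite normcM ler_wpM2l ?normc_ge0.
- by move=> x nB; rewrite sf // mulr0.
Qed.

Lemma bsupp_involution n f : bsupp n f -> bsupp n (involution f).
Proof.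
move=> [mf [M fM] sf]; split.
- by apply: cmeasurable_conj; exact: (cmeasurable_comp (@measurable_oppr_borel G) mf).
- by exists M => x; rewrite normc_conj.
- by move=> x nB; rewrite /involution sf ?conjc0 // => /B_opp; rewrite opprK.
Qed.

Lemma bsupp_real_normc n f : bsupp n f -> bsupp n (fun x => (normc (f x))%:C%C).
Proof.
move=> [mf [M fM] sf]; split.
- by apply/cmeasurable_real; exact: cmeasurable_normc.
- by exists M => x; rewrite normc_real ger0_norm ?normc_ge0.
- by move=> x nB; rewrite sf // normc0.
Qed.

Lemma absconv_le n f g M x : bsupp n f -> cmeasurable g -> 0 <= M ->
    (forall x, normc (g x) <= M) ->
  (absconv mu f g x <= M%:E * \int[mu]_(y in [set: borel G]) (normc (f y))%:E)%E.
Proof.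
move=> bf mg M0 gM; have mf := bsupp_cmeasurable bf.
rewrite -ge0_integralZl_EFin //; last 2 first.
- by move=> y _; rewrite lee_fin normc_ge0.
- by apply/measurable_EFinP; exact: cmeasurable_normc.
apply: ge0_le_integral => //.
- by move=> y _; rewrite lee_fin mulr_ge0 ?normc_ge0.
- by apply/measurable_EFinP; apply: measurable_funM; apply: cmeasurable_normc => //;
    exact: cmeasurable_subl.
- by apply: measurable_funeM; apply/measurable_EFinP; exact: cmeasurable_normc.
- by move=> y _; rewrite -EFinM lee_fin mulrC ler_wpM2r ?normc_ge0.
Qed.

Lemma bsupp_absconv_lty n f g x : bsupp n f -> cmeasurable g ->
    (exists M, forall x, normc (g x) <= M) -> (absconv mu f g x < +oo)%E.
Proof.
move=> bf mg [M gM]; have [M' M'0 gM'] : exists2 M', 0 <= M' & forall x, normc (g x) <= M'.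
  by exists `|M| => // y; rewrite (le_trans (gM y)) ?ler_norm.
apply: (le_lt_trans (absconv_le x bf mg M'0 gM')).
apply: lte_mul_pinfty => //.
by have [] := (cintegrableP mu f).1 (bsupp_integrable bf).
Qed.

Lemma bsupp_absconv_lty2 n m f g x : bsupp n f -> bsupp m g -> (absconv mu f g x < +oo)%E.
Proof. by move=> bf [mg bg _]; exact: (bsupp_absconv_lty x bf). Qed.

Lemma bsupp_cconv n m f g : bsupp n f -> bsupp m g -> bsupp (n + m) (cconv mu f g).
Proof.
move=> bf bg; have [mf _ sf] := bf; have [mg _ sg] := bg.
have [M M0 gM] := bsupp_bound bg.
split; first exact: (cmeasurable_cconv mu_addr mu_oppr diff_ae).
  have Ifin : (\int[mu]_(y in [set: borel G]) (normc (f y))%:E)%E \is a fin_num.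
    by apply: integrable_fin_num => //; apply: cintegrable_normc; exact: bsupp_integrable bf.
  exists (M * fine (\int[mu]_(y in [set: borel G]) (normc (f y))%:E)%E) => x.
  rewrite -lee_fin EFinM fineK //.
  apply: le_trans (absconv_le x bf mg (ltW M0) gM).
  by apply: normc_cconv_le => //; exact: bsupp_absconv_lty2 bf bg.
move=> x nB; rewrite -[RHS](cintegral0 mu); apply: eq_cintegral => y.
have [By|By] := pselect (B n y); last by rewrite sf // mul0r.
by rewrite sg ?mulr0 // => Bxy; apply: nB; rewrite -(subrK y x) addrC addnC;
  rewrite addrC; apply: B_add => //.
Qed.

(** The absolute convolution of [f] and [g] is the convolution of |f| and |g|, again bounded with
    bounded support; so the triple integral is finite at every x. *)
Lemma bsupp_cconvA n m k f g h x : bsupp n f -> bsupp m g -> bsupp k h ->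
  cconv mu (cconv mu f g) h x = cconv mu f (cconv mu g h) x.
Proof.
move=> bf bg bh; have [[mf _ _] [mg _ _] [mh _ _]] := And3 bf bg bh.
apply: (cconvA mu_addr mu_oppr diff_ae) => //.
have bF := bsupp_cconv (bsupp_real_normc bf) (bsupp_real_normc bg).
apply: le_lt_trans (bsupp_absconv_lty2 x bF bh).
rewrite le_eqVlt; apply/orP; left; apply/eqP; apply: eq_integral => z _.
rewrite EFinM; congr (_ * _)%E.
have ofg := bsupp_absconv_lty2 z bf bg.
have -> : cconv mu (fun x => (normc (f x))%:C%C) (fun x => (normc (g x))%:C%C) z =
    ((fine (absconv mu f g z))%:C)%C.
  rewrite /cconv /cintegral; congr Complex.
    rewrite /Rintegral /absconv; congr fine; apply: eq_integral => y _.
    by rewrite cReM /= mulr0 subr0.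
  rewrite /Rintegral (_ : (fun _ => _) = cst 0%E) ?integral0 //.
  by apply/funext => y; rewrite cImM /= mulr0 mul0r addr0.
by rewrite normc_real ger0_norm ?fine_ge0 ?absconv_ge0 // fineK // ge0_fin_numE ?absconv_ge0.
Qed.

Lemma bsupp_cconvC n m f g : bsupp n f -> bsupp m g -> cconv mu f g = cconv mu g f.
Proof. by move=> [mf _ _] [mg _ _]; exact: (cconvC mu_addr mu_oppr). Qed.

Lemma bsupp_cconv_involution n m f g : bsupp n f -> bsupp m g ->
  cconv mu (involution f) (involution g) = involution (cconv mu f g).
Proof.
move=> bf bg; apply/funext => x; have [[mf _ _] [mg _ _]] := (bf, bg).
by apply: (cconv_involution mu_addr mu_oppr) => //; exact: bsupp_absconv_lty2 bf bg.
Qed.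

End bounded_support.

(** * Convolution operators on L^2 *)

Section square_norm.
Context {R : realType} {G : topologicalZmodType}.
Variable mu : {sigma_finite_measure set (borel G) -> \bar R}.
Hypothesis mu_addr : forall (a : G) (A : set (borel G)), measurable A ->
  mu ((fun y : G => y + a) @^-1` A) = mu A.
Hypothesis mu_oppr : forall (A : set (borel G)), measurable A ->
  mu ((fun y : G => - y) @^-1` A) = mu A.
Hypothesis diff_ae : forall f : G -> R,
  measurable_fun [set: borel G] (f : borel G -> R) ->
  exists2 g : G -> R, diff_measurable_fun g & {ae mu, forall x : borel G, f x = g x}.
Variable B : (set G)^nat.
Hypothesis B_measurable : forall n, measurable (B n : set (borel G)).
Hypothesis B_lty : forall n, (mu (B n : set (borel G)) < +oo)%E.
Hypothesis B_add : forall m n x y, B m x -> B n y -> B (m + n) (x + y).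
Hypothesis B_opp : forall n x, B n x -> B n (- x).
Hypothesis B_le : forall m n, (m <= n)%N -> B m `<=` B n.
Implicit Types f g h u v : G -> R[i].
Local Notation bsupp := (bsupp B).

Definition sqmod f : G -> R[i] := fun x => (normc (f x) ^+ 2)%:C%C.

Lemma normc_sqmod f x : normc (sqmod f x) = normc (f x) ^+ 2.
Proof. by rewrite normc_real ger0_norm ?sqr_ge0. Qed.

Lemma bsupp_sqmod n f : bsupp n f -> bsupp n (sqmod f).
Proof.
move=> bf; have [mf [M fM] _] := bsupp_real_normc bf.
rewrite (_ : sqmod f = (fun x => (normc (f x))%:C%C * (normc (f x))%:C%C)).
  by apply: bsuppM (bsupp_real_normc bf) mf _; exists M.
by apply/funext => x; rewrite /sqmod expr2 rmorphM.
Qed.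

Lemma bsupp_normc_lty n f : bsupp n f ->
  (\int[mu]_(x in [set: borel G]) (normc (f x))%:E < +oo)%E.
Proof.
by move=> bf; have [] := (cintegrableP mu f).1 (bsupp_integrable B_measurable B_lty bf).
Qed.

(** The L^2 norm is that of Haar measure, without the weight, and is kept squared throughout. *)
Definition sqnorm f : R :=
  fine (\int[mu]_(x in [set: borel G]) (normc (f x) ^+ 2)%:E)%E.

Lemma sqnorm_ge0 f : 0 <= sqnorm f.
Proof. by rewrite fine_ge0 // integral_ge0 // => x _; rewrite lee_fin sqr_ge0. Qed.

Lemma sqnormE n f : bsupp n f ->
  (\int[mu]_(x in [set: borel G]) (normc (f x) ^+ 2)%:E = (sqnorm f)%:E)%E.
Proof.
move=> bf; rewrite fineK // ge0_fin_numE; last first.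
  by apply: integral_ge0 => x _; rewrite lee_fin sqr_ge0.
rewrite (eq_integral (fun x : borel G => (normc (sqmod f x))%:E)).
  exact: bsupp_normc_lty (bsupp_sqmod bf).
by move=> x _; rewrite normc_sqmod.
Qed.

(** The inner product of L^2, the integral of u times the conjugate of v, as the value of a
    convolution at 0. In this form the adjoint of convolution by [g] comes from associativity and
    commutativity. *)
Definition ip u v : R[i] := cconv mu (involution v) u 0.

Lemma involutionK u : involution (involution u) = u.
Proof. by apply/funext => x; rewrite /involution opprK conjcK. Qed.

Lemma ip_self n u : bsupp n u -> ip u u = (sqnorm u)%:C%C.
Proof.
move=> bu; have [msq _ _] := bsupp_sqmod bu.
rewrite /ip /cconv (eq_cintegral mu (g := fun y => sqmod u (0 - y))); last first.
  move=> y; rewrite sub0r /sqmod /involution sqr_normc; case: (u (- y)) => a b /=.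
  by apply/eqP; rewrite eq_complex /=; apply/andP; split; apply/eqP; ring.
rewrite (cintegral_subl mu_addr mu_oppr 0 msq) /cintegral /sqnorm /Rintegral.
congr Complex; rewrite [X in fine X](_ : _ = 0%E) //.
by rewrite integral0_eq.
Qed.

Lemma ip_conj n m u v : bsupp n u -> bsupp m v -> ip v u = (ip u v)^*%C.
Proof.
move=> bu bv; have iu := bsupp_involution B_opp bu; have iv := bsupp_involution B_opp bv.
have -> : (ip u v)^*%C = involution (cconv mu (involution v) u) 0.
  by rewrite /involution oppr0.
rewrite -(bsupp_cconv_involution mu_addr mu_oppr B_measurable B_lty iv bu).
rewrite involutionK /ip.
by rewrite (bsupp_cconvC mu_addr mu_oppr iu bv).
Qed.

Lemma ipDl n m k u u' v : bsupp n u -> bsupp m u' -> bsupp k v ->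
  ip (fun x => u x + u' x) v = ip u v + ip u' v.
Proof.
move=> bu bu' bv; have iv := bsupp_involution B_opp bv.
have [[mu0 _ _] [mu' _ _] [mv _ _]] := And3 bu bu' iv.
rewrite /ip (cconvC mu_addr mu_oppr mv (cmeasurableD mu0 mu')).
rewrite (cconvDl mu0 mu' mv).
- by rewrite (cconvC mu_addr mu_oppr mu0 mv) (cconvC mu_addr mu_oppr mu' mv).
- exact: (bsupp_absconv_lty2 B_measurable B_lty _ bu iv).
- exact: (bsupp_absconv_lty2 B_measurable B_lty _ bu' iv).
Qed.

Lemma ipZl n k c u v : bsupp n u -> bsupp k v -> ip (fun x => c * u x) v = c * ip u v.
Proof.
move=> bu bv; have iv := bsupp_involution B_opp bv.
have [[mu0 _ _] [mv _ _]] := (bu, iv).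
have [mcu _ _] := bsuppZ c bu.
rewrite /ip (cconvC mu_addr mu_oppr mv mcu) (cconvZl c mu0 mv).
- by rewrite (cconvC mu_addr mu_oppr mu0 mv).
- exact: (bsupp_absconv_lty2 B_measurable B_lty _ bu iv).
Qed.

Lemma ip_adjoint n m k g u v : bsupp n g -> bsupp m u -> bsupp k v ->
  ip (cconv mu g u) v = ip u (cconv mu (involution g) v).
Proof.
move=> bg bu bv; have iv := bsupp_involution B_opp bv; have ig := bsupp_involution B_opp bg.
rewrite /ip -(bsupp_cconvA mu_addr mu_oppr diff_ae B_measurable B_lty B_add _ iv bg bu).
rewrite -(bsupp_cconv_involution mu_addr mu_oppr B_measurable B_lty ig bv) involutionK.
by rewrite (bsupp_cconvC mu_addr mu_oppr iv bg).
Qed.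

(** Young's inequality for L^1 and L^2: splitting |g| |v| as |g|^(1/2) times |g|^(1/2) |v|,
    Cauchy-Schwarz bounds |g * v|^2 pointwise by c times the convolution of |g| and |v|^2, which is
    then integrated. *)
Lemma sqnorm_cconv n m g v (c : R) : bsupp n g -> bsupp m v ->
    (\int[mu]_(y in [set: borel G]) (normc (g y))%:E <= c%:E)%E ->
  sqnorm (cconv mu g v) <= c ^+ 2 * sqnorm v.
Proof.
move=> bg bv gc; have [[mg _ sg] [mv _ _]] := (bg, bv).
have bs := bsupp_sqmod bv; have [ms _ _] := bs.
have c0 : 0 <= c.
  by rewrite -lee_fin (le_trans _ gc) // integral_ge0 // => y _; rewrite lee_fin normc_ge0.
have cs x : ((normc (cconv mu g v x) ^+ 2)%:E <= c%:E * absconv mu g (sqmod v) x)%E.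
  have lty1 := bsupp_absconv_lty2 B_measurable B_lty x bg bv.
  have lty2 := bsupp_absconv_lty2 B_measurable B_lty x bg bs.
  have fin2 : absconv mu g (sqmod v) x = (fine (absconv mu g (sqmod v) x))%:E.
    by rewrite fineK // ge0_fin_numE ?absconv_ge0.
  have A0 : 0 <= fine (absconv mu g (sqmod v) x) by rewrite fine_ge0 // absconv_ge0.
  suff : ((normc (cconv mu g v x))%:E <=
      (c `^ 2^-1 * fine (absconv mu g (sqmod v) x) `^ 2^-1)%:E)%E.
    rewrite fin2 -EFinM !lee_fin => h.
    have := lerXn2r 2 _ _ h; rewrite !nnegrE => /(_ (normc_ge0 _)).
    rewrite mulr_ge0 ?powR_ge0 // => /(_ isT) /le_trans; apply.
    by rewrite exprMn -!powR_mulrn ?powR_ge0 // -!powRrM mulVf // !powRr1.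
  apply: le_trans (normc_cconv_le mg mv lty1) _.
  have sq r : 0 <= r -> (r `^ 2^-1) `^ 2 = r :> R.
    by move=> r0; rewrite -powRrM mulVf // powRr1.
  have mq : measurable_fun [set: borel G] (fun y : borel G => normc (g y) `^ 2^-1).
    apply: (@measurableT_comp _ _ _ _ _ _ (fun t : R => t `^ 2^-1)) => //.
    exact: cmeasurable_normc.
  have mvx : measurable_fun [set: borel G] (fun y : borel G => normc (v (x - y))).
    by apply: cmeasurable_normc; exact: cmeasurable_subl.
  have pq2 : (2^-1 + 2^-1 : R) = 1 by lra.
  have := ge0_hoelder mu (ltr0Sn R 1) (ltr0Sn R 1) pq2 mq (measurable_funM mq mvx).
  move=> /(_ (fun y => powR_ge0 _ _)).
  move=> /(_ (fun y => mulr_ge0 (powR_ge0 _ _) (normc_ge0 _))).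
  rewrite (eq_integral (fun y : borel G => (normc (g y) * normc (v (x - y)))%:E)); last first.
    by move=> y _; rewrite mulrA -expr2 -powR_mulrn ?powR_ge0 // sq ?normc_ge0.
  move=> /le_trans; apply; rewrite EFinM; apply: lee_pmul.
  - exact: poweR_ge0.
  - exact: poweR_ge0.
  - rewrite -poweR_EFin; apply: gt0_ler_poweR => //.
    + by rewrite in_itv/= leey andbT integral_ge0 // => y _; rewrite lee_fin powR_ge0.
    + by rewrite in_itv/= leey andbT lee_fin.
    + rewrite (eq_integral (fun y : borel G => (normc (g y))%:E)) // => y _.
      by rewrite sq ?normc_ge0.
  - rewrite -poweR_EFin -fin2; apply: gt0_ler_poweR => //.
    + by rewrite in_itv/= leey andbT integral_ge0 // => y _; rewrite lee_fin powR_ge0.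
    + by rewrite in_itv/= leey andbT absconv_ge0.
    + rewrite le_eqVlt; apply/orP; left; apply/eqP; apply: eq_integral => y _.
      rewrite powRM ?powR_ge0 ?normc_ge0 // sq ?normc_ge0 // normc_sqmod.
      by rewrite powR_mulrn ?normc_ge0.
have bgv := bsupp_cconv mu_addr mu_oppr diff_ae B_measurable B_lty B_add bg bv.
rewrite -lee_fin -(sqnormE bgv).
apply: (@le_trans _ _ (\int[mu]_(x in [set: borel G]) (c%:E * absconv mu g (sqmod v) x))%E).
  apply: ge0_le_integral => //.
  - by move=> x _; rewrite lee_fin sqr_ge0.
  - apply/measurable_EFinP; apply: measurable_funX; apply: cmeasurable_normc.
    by have [] := bgv.
  - by apply: measurable_funeM; exact: (measurable_absconv mu_addr mu_oppr diff_ae).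
rewrite ge0_integralZl_EFin //; last 2 first.
- by move=> x _; exact: absconv_ge0.
- exact: (measurable_absconv mu_addr mu_oppr diff_ae).
rewrite (integral_absconv mu_addr mu_oppr diff_ae mg ms) expr2 -mulrA EFinM.
apply: lee_wpmul2l; rewrite ?lee_fin // EFinM; apply: lee_pmul => //.
- by apply: integral_ge0 => x _; rewrite lee_fin normc_ge0.
- by apply: integral_ge0 => x _; rewrite lee_fin normc_ge0.
- rewrite -(sqnormE bv) (eq_integral (fun x : borel G => (normc (v x) ^+ 2)%:E)) //.
  by move=> x _; rewrite normc_sqmod.
Qed.

Lemma integral_normc_involution g : cmeasurable g ->
  (\int[mu]_(y in [set: borel G]) (normc (involution g y))%:E =
   \int[mu]_(y in [set: borel G]) (normc (g y))%:E)%E.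
Proof.
move=> mg; rewrite -(ge0_integral_subl mu_addr mu_oppr 0 (u := fun y => (normc (g y))%:E)).
- by apply: eq_integral => y _; rewrite /involution normc_conj sub0r.
- by apply/measurable_EFinP; exact: cmeasurable_normc.
- by move=> y; rewrite lee_fin normc_ge0.
Qed.

(* The operator b - z is normal on L^2 and b = g* g has its spectrum in [0, c^2]. *)
Lemma sqnorm_shift n m g w (c s : R) (z : R[i]) : bsupp n g -> bsupp m w ->
    (\int[mu]_(y in [set: borel G]) (normc (g y))%:E <= c%:E)%E ->
    normc z <= s -> normc ((c ^+ 2)%:C%C - z) <= s ->
  sqnorm (fun x => cconv mu (cconv mu (involution g) g) w x + - z * w x) <=
  s ^+ 2 * sqnorm w.
Proof.
move=> bg bw gc zs Mzs; have ig := bsupp_involution B_opp bg.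
have bcc k l f h := @bsupp_cconv _ _ mu mu_addr mu_oppr diff_ae B B_measurable B_lty B_add k l f h.
have bgw := bcc _ _ _ _ bg bw.
have bggw := bcc _ _ _ _ ig bgw.
have -> : cconv mu (cconv mu (involution g) g) w = cconv mu (involution g) (cconv mu g w).
  apply/funext => x.
  exact: (bsupp_cconvA mu_addr mu_oppr diff_ae B_measurable B_lty B_add _ ig bg bw).
set bw' := cconv mu (involution g) (cconv mu g w).
have bzw := bsuppZ (- z) bw.
pose k := maxn (n + (n + m)) m.
have b1 : bsupp k bw' by apply: (bsupp_le B_le) bggw; rewrite leq_maxl.
have b2 : bsupp k (fun x => - z * w x) by apply: (bsupp_le B_le) bzw; rewrite leq_maxr.
set w' := (fun x => _); have bw'' : bsupp k w' by exact: bsuppD b1 b2.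
have P_le : sqnorm bw' <= c ^+ 2 * sqnorm (cconv mu g w).
  by apply: (sqnorm_cconv ig bgw); rewrite integral_normc_involution //; case: bg.
have Q_le : sqnorm (cconv mu g w) <= c ^+ 2 * sqnorm w by exact: (sqnorm_cconv bg bw).
have ipbw : ip bw' w = (sqnorm (cconv mu g w))%:C%C.
  by rewrite (ip_adjoint ig bgw bw) involutionK (ip_self bgw).
(* Expansion of [ip w' w']. The value [ip bw' w] is real, being the squared norm of the convolution
   of [g] and [w], so the cross terms add up to -2 Re(z) times it. *)
have e : (sqnorm w')%:C%C = ((sqnorm bw')%:C%C - z * (sqnorm (cconv mu g w))%:C%C)^*%C
    - z * ((sqnorm (cconv mu g w))%:C%C - z * (sqnorm w)%:C%C)^*%C.
  rewrite -(ip_self bw'') (ipDl b1 b2 bw'') (ipZl (- z) bw bw'').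
  rewrite (ip_conj bw'' b1) (ip_conj bw'' bw).
  rewrite (ipDl b1 b2 b1) (ipDl b1 b2 bw) (ipZl (- z) bw b1) (ipZl (- z) bw bw).
  rewrite (ip_self b1) (ip_self bw) ipbw (ip_conj b1 bw) ipbw conjc_real.
  by rewrite !mulNr.
have Q0 := sqnorm_ge0 (cconv mu g w); have W0 := sqnorm_ge0 w.
move: (sqnorm w') (sqnorm bw') (sqnorm (cconv mu g w)) (sqnorm w) e P_le Q_le Q0 W0.
move=> N P Q W e P_le Q_le Q0 W0.
have s0 : 0 <= s by apply: le_trans zs; exact: normc_ge0.
have {}zs : normc z ^+ 2 <= s ^+ 2 by rewrite lerXn2r ?nnegrE ?normc_ge0.
have {}Mzs : normc ((c ^+ 2)%:C%C - z) ^+ 2 <= s ^+ 2 by rewrite lerXn2r ?nnegrE ?normc_ge0.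
clear w' bw'' b2 bzw; case: z zs Mzs e => a b zs Mzs e.
have {e} -> : N = P - 2 * a * Q + (a ^+ 2 + b ^+ 2) * W.
  have := congr1 (@complex.Re R) e; rewrite /= => ->; ring.
move: zs Mzs; rewrite /normc /= !sqr_sqrtr ?addr_ge0 ?sqr_ge0 // => zs Mzs.
(* Since P <= c^2 Q, the left side is at most (c^2 - 2 a) Q + |z|^2 W. This is affine in Q, and 0 <=
   Q <= c^2 W; its values at the two ends are |z|^2 W and |c^2 - z|^2 W. *)
have [h|h] := leP (c ^+ 2 - 2 * a) 0; nra.
Qed.

End square_norm.

Lemma root_gt1 (R : realType) (a : R) (k : nat) : 1 < a -> exists2 t : R, 1 < t & t ^+ k <= a.
Proof.
move=> a1; have a0 : 0 < a by exact: lt_trans a1.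
(* The root of order [k.+1] also makes sense for k = 0, and t^k <= t^(k+1) = a. *)
pose t := a `^ (k.+1%:R)^-1.
have tk : t ^+ k.+1 = a.
  by rewrite -powR_mulrn ?powR_ge0 // -powRrM mulVf // powRr1 // ltW.
have t1 : 1 < t.
  rewrite ltNge; apply/negP => t1.
  by move: a1; rewrite -tk ltNge exprn_ile1 // powR_ge0.
exists t => //; rewrite -tk exprS ler_peMl ?exprn_ge0 ?powR_ge0 //; exact: ltW.
Qed.

(** * Comparison of the L^1 and L^p norms *)

Section subexponential_growth.
Context {R : realType} {G : topologicalZmodType}.
Variable mu : {sigma_finite_measure set (borel G) -> \bar R}.
Hypothesis mu_addr : forall (a : G) (A : set (borel G)), measurable A ->
  mu ((fun y : G => y + a) @^-1` A) = mu A.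
Hypothesis mu_oppr : forall (A : set (borel G)), measurable A ->
  mu ((fun y : G => - y) @^-1` A) = mu A.
Hypothesis diff_ae : forall f : G -> R,
  measurable_fun [set: borel G] (f : borel G -> R) ->
  exists2 g : G -> R, diff_measurable_fun g & {ae mu, forall x : borel G, f x = g x}.
Variable B : (set G)^nat.
Hypothesis B_measurable : forall n, measurable (B n : set (borel G)).
Hypothesis B_lty : forall n, (mu (B n : set (borel G)) < +oo)%E.
Hypothesis B_add : forall m n x y, B m x -> B n y -> B (m + n) (x + y).
Hypothesis B_opp : forall n x, B n x -> B n (- x).
Hypothesis B_le : forall m n, (m <= n)%N -> B m `<=` B n.
Variables (p q : R) (p1 : 1 < p) (pq : p^-1 + q^-1 = 1).
Variable omega : weight R G.
Hypothesis omega_LPAlg : LPAlg mu omega q.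
Hypothesis B_growth : forall t : R, 1 < t -> exists2 c : R, 1 <= c &
  forall n, (mu (B n : set (borel G)) <= (c * t ^+ n)%:E)%E /\
    forall x, B n x -> omega x <= c * t ^+ n.
Implicit Types f g h u v : G -> R[i].
Local Notation bsupp := (bsupp B).

Let p0 : 0 < p. Proof. exact: lt_trans p1. Qed.
Let q0 : 0 < q.
Proof.
have : 0 < q^-1 by rewrite -(ltrD2l p^-1) pq addr0 invf_lt1.
by rewrite invr_gt0.
Qed.

(** Its integral is the mass J(n); it is complex-valued so that [absconv] applies. *)
Definition truncated_weight n : G -> R[i] :=
  fun x => (\1_(B n) x * omega x `^ (- q))%:C%C.

Lemma weight_powN_le1 x : omega x `^ (- q) <= 1.
Proof.
rewrite powRN invf_le1 ?powR_gt0 ?weight_gt0 //.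
apply: (@le_trans _ _ (1 `^ q)); first by rewrite powR1.
apply: ge0_ler_powR; rewrite ?nnegrE ?(ltW q0) //.
- by rewrite ltW // weight_gt0.
- exact: weight_ge1.
Qed.

Lemma normc_truncated_weight n x :
  normc (truncated_weight n x) = \1_(B n) x * omega x `^ (- q).
Proof. by rewrite normc_real ger0_norm // mulr_ge0 // powR_ge0. Qed.

Lemma bsupp_truncated_weight n : bsupp n (truncated_weight n).
Proof.
split.
- apply/cmeasurable_real; apply: measurable_funM.
    exact: (measurable_indic (B_measurable n)).
  apply: (@measurableT_comp _ _ _ _ _ _ (fun t : R => t `^ (- q))) => //.
  exact: weight_measurable.
- exists 1 => x; rewrite normc_truncated_weight mulr_ile1 ?powR_ge0 ?weight_powN_le1 //.
- by move=> x nB; rewrite /truncated_weight indicE memNset // mul0r.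
Qed.

Let tw_mass n : R :=
  fine (\int[mu]_(x in [set: borel G]) (normc (truncated_weight n x))%:E)%E.

Let tw_massE n : (\int[mu]_(x in [set: borel G]) (normc (truncated_weight n x))%:E =
  (tw_mass n)%:E)%E.
Proof.
rewrite /tw_mass fineK // ge0_fin_numE.
  exact: (bsupp_normc_lty B_measurable B_lty (bsupp_truncated_weight n)).
by apply: integral_ge0 => x _; rewrite lee_fin normc_ge0.
Qed.

Let tw_mass_le n : ((tw_mass n)%:E <= mu (B n : set (borel G)))%E.
Proof.
rewrite -tw_massE.
have -> : mu (B n : set (borel G)) =
    (\int[mu]_(x in [set: borel G]) (\1_(B n : set (borel G)) x)%:E)%E.
  by rewrite integral_indic ?setIT; [|exact: measurableT|exact: B_measurable].
apply: ge0_le_integral => //.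
- by move=> x _; rewrite lee_fin normc_ge0.
- apply/measurable_EFinP; apply: cmeasurable_normc.
  by have [] := bsupp_truncated_weight n.
- by apply/measurable_EFinP; exact: (measurable_indic (B_measurable n)).
- by move=> x _; rewrite lee_fin normc_truncated_weight ler_piMr ?weight_powN_le1.
Qed.

(** The truncated weight convolved with itself is at most omega^-q on B (n + n), by (LPAlg), and
    vanishes elsewhere. Its integral is J(n)^2. *)
Let tw_mass_double n : tw_mass n ^+ 2 <= tw_mass (n + n).
Proof.
have [mw _ sw] := bsupp_truncated_weight n.
rewrite -lee_fin -tw_massE expr2 EFinM -!tw_massE.
rewrite -(integral_absconv mu_addr mu_oppr diff_ae mw mw).
apply: ge0_le_integral => //.
- by move=> x _; exact: absconv_ge0.
- exact: (measurable_absconv mu_addr mu_oppr diff_ae).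
- apply/measurable_EFinP; apply: cmeasurable_normc.
  by have [] := bsupp_truncated_weight (n + n).
move=> x _; rewrite normc_truncated_weight; have [Bx|Bx] := pselect (B (n + n) x).
  rewrite indicE mem_set // mul1r; apply: le_trans (omega_LPAlg x).
  apply: ge0_le_integral => //.
  - by move=> y _; rewrite lee_fin mulr_ge0 ?normc_ge0.
  - apply/measurable_EFinP; apply: measurable_funM; apply: cmeasurable_normc => //.
    exact: cmeasurable_subl.
  - apply/measurable_EFinP.
    have mo : cmeasurable (fun x => (omega x `^ (- q))%:C%C).
      apply/cmeasurable_real.
      apply: (@measurableT_comp _ _ _ _ _ _ (fun t : R => t `^ (- q))) => //.
      exact: weight_measurable.
    apply: measurable_funM; first by have [] := mo.
    by have [] := cmeasurable_subl x mo.
  - move=> y _; rewrite lee_fin !normc_truncated_weight.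
    by rewrite ler_pM ?mulr_ge0 ?powR_ge0 // ler_piMl ?powR_ge0 // indicE; case: (_ \in _).
rewrite indicE memNset // mul0r le_eqVlt; apply/orP; left; apply/eqP.
rewrite /absconv integral0_eq // => y _; congr (_%:E).
have [By|By] := pselect (B n y); last by rewrite sw // normc0 mul0r.
rewrite (sw (x - y)) ?normc0 ?mulr0 // => Bxy; apply: Bx.
by rewrite -(subrK y x) addrC; exact: B_add.
Qed.

(* The masses satisfy J(2n) >= J(n)^2 while growing subexponentially. *)
Lemma truncated_weight_mass n :
  (\int[mu]_(x in [set: borel G]) (normc (truncated_weight n x))%:E <= 1)%E.
Proof.
rewrite tw_massE lee_fin leNgt; apply/negP => J1.
(* If J(n) > 1, the midpoint of 1 and J(n) leaves room for some t > 1 with t^n < J(n). Repeated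
   doubling then bounds (J(n) / t^n)^(2^k) by c for every k, although the base exceeds 1. *)
have [t t1 tJ] : exists2 t : R, 1 < t & t ^+ n < tw_mass n.
  have [|t t1 tJ] := @root_gt1 R ((1 + tw_mass n) / 2) n; first by lra.
  by exists t => //; rewrite (le_lt_trans tJ) //; lra.
have t0 : 0 < t ^+ n by rewrite exprn_gt0 // (lt_trans _ t1).
have [c c1 cP] := B_growth t1.
have J0 : 0 < tw_mass n by exact: lt_trans J1.
have pow k : tw_mass n ^+ (2 ^ k) <= tw_mass (2 ^ k * n).
  elim: k => [|k IH]; first by rewrite expn0 mul1n expr1.
  rewrite (_ : (2 ^ k.+1 * n = 2 ^ k * n + 2 ^ k * n)%N); last first.
    by rewrite expnS mul2n -addnn mulnDl.
  rewrite expnSr exprM.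
  apply: le_trans (tw_mass_double _); apply: lerXn2r => //.
  - by rewrite nnegrE exprn_ge0 // ltW.
  - by rewrite nnegrE (le_trans _ IH) // exprn_ge0 // ltW.
have a1 : 1 < tw_mass n / t ^+ n by rewrite ltr_pdivlMr // mul1r.
have [d d0 dP] := natr_le_exp a1.
have bd k : k%:R <= d * c.
  apply: le_trans (dP k) _; rewrite ler_pM2l //.
  apply: (@le_trans _ _ ((tw_mass n / t ^+ n) ^+ (2 ^ k))).
    by rewrite ler_weXn2l ?(ltW a1) // ltnW // ltn_expl.
  rewrite expr_div_n ler_pdivrMr; last by rewrite exprn_gt0.
  apply: le_trans (pow k) _; rewrite -exprM (mulnC n) -lee_fin; apply: le_trans (tw_mass_le _) _.
  by have [] := cP (2 ^ k * n)%N.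
have := bd (Num.truncn (d * c)).+1.
by rewrite leNgt Num.Theory.truncnS_gt.
Qed.

(** One factor [a] bounds the weight, the other the power 1/p of the measure of the support, as a >=
    1 and p > 1. *)
Lemma Lp_norm_bsupp n f (M a : R) : bsupp n f -> (forall x, normc (f x) <= M) -> 1 <= a ->
    (mu (B n : set (borel G)) <= a%:E)%E -> (forall x, B n x -> omega x <= a) ->
  finite_Lp mu omega p f /\ Lp_norm mu omega p f <= M * a ^+ 2.
Proof.
move=> [mf _ sf] fM a1 mua oa.
have M0 : 0 <= M by exact: le_trans (normc_ge0 _) (fM 0).
have a0 : 0 <= a by exact: le_trans ler01 a1.
apply: (Lp_norm_le p1 mf); first by rewrite mulr_ge0 ?sqr_ge0.
apply: (@le_trans _ _ (\int[mu]_(x in [set: borel G])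
    (((M * a) `^ p)%:E * (\1_(B n : set (borel G)) x)%:E))%E).
  apply: ge0_le_integral.
  - exact: measurableT.
  - by move=> x _; rewrite lee_fin mulr_ge0 ?powR_ge0.
  - exact: measurable_Lp_integrand.
  - by apply: measurable_funeM; apply/measurable_EFinP; exact: (measurable_indic (B_measurable n)).
  - move=> x _; rewrite -EFinM lee_fin indicE; have [Bx|Bx] := pselect (B n x).
      rewrite mem_set // mulr1 powRM // ler_pM ?powR_ge0 //.
        by rewrite ge0_ler_powR ?nnegrE ?normc_ge0 ?(ltW p0).
      by rewrite ge0_ler_powR ?nnegrE ?(ltW p0) ?oa // ltW // weight_gt0.
    by rewrite memNset // mulr0 sf // normc0 powR0 ?mul0r // gt_eqF.
rewrite ge0_integralZl_EFin ?powR_ge0 //; last first.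
  by apply/measurable_EFinP; exact: (measurable_indic (B_measurable n)).
rewrite integral_indic ?setIT; [|exact: measurableT|exact: B_measurable].
apply: (@le_trans _ _ (((M * a) `^ p)%:E * a%:E)%E).
  by apply: lee_wpmul2l; rewrite // lee_fin powR_ge0.
rewrite -EFinM lee_fin expr2 mulrA [leRHS]powRM ?mulr_ge0 // ler_wpM2l ?powR_ge0 //.
by rewrite -[leLHS](powRr1 a0) ler_powR // ltW.
Qed.

Lemma bsupp_finite_Lp n f : bsupp n f -> finite_Lp mu omega p f.
Proof.
move=> bf; have [M _ fM] := bsupp_bound bf.
have [c c1 /(_ n)[mc oc]] := B_growth (ltr1n R 2).
have a1 : 1 <= c * 2 ^+ n by rewrite mulr_ege1 // exprn_ege1 // ler1n.
exact: (Lp_norm_bsupp bf fM a1 mc oc).1.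
Qed.

(** Hoelder's inequality for |g| omega and the restriction of omega^-1 to [B n], whose q-norm is
    J(n)^(1/q) <= 1. *)
Lemma l1_le_Lp_norm n g : bsupp n g ->
  (\int[mu]_(y in [set: borel G]) (normc (g y))%:E <= (Lp_norm mu omega p g)%:E)%E.
Proof.
move=> bg; have fg := bsupp_finite_Lp bg; have [mg _ sg] := bg.
pose u (x : borel G) := normc (g x) * omega x.
pose v (x : borel G) := \1_(B n : set (borel G)) x * (omega x)^-1.
have u0 x : 0 <= u x by rewrite mulr_ge0 ?normc_ge0 // ltW // weight_gt0.
have v0 x : 0 <= v x by rewrite mulr_ge0 // invr_ge0 ltW // weight_gt0.
have mv : measurable_fun [set: borel G] v.
  apply: measurable_funM; first exact: (measurable_indic (B_measurable n)).
  rewrite (_ : (fun x : borel G => (omega x)^-1) = (fun x : borel G => omega x `^ (- 1))).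
    apply: (@measurableT_comp _ _ _ _ _ _ (fun t : R => t `^ (- 1))) => //.
    exact: weight_measurable.
  by apply/funext => x; rewrite powR_inv1 // ltW // weight_gt0.
have := ge0_hoelder mu p0 q0 pq (measurable_absw omega mg) mv u0 v0.
rewrite (eq_integral (fun x : borel G => (normc (g x))%:E)); last first.
  move=> x _; congr (_%:E); rewrite /u /v indicE; have [Bx|Bx] := pselect (B n x).
    by rewrite mem_set // mul1r mulfK // gt_eqF // weight_gt0.
  by rewrite sg // normc0 !mul0r.
move=> /le_trans; apply.
rewrite -[leRHS]mule1; apply: lee_pmul.
- exact: poweR_ge0.
- exact: poweR_ge0.
- rewrite -(Lp_integralE mu omega p g) (Lp_integral_powR p1 fg) poweR_EFin.
  by rewrite -powRrM divff ?gt_eqF // powRr1 // Lp_norm_ge0.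
- apply: (@le_trans _ _ (1 `^ q^-1)%E); last by rewrite poweR_EFin powR1.
  apply: gt0_ler_poweR.
  + by rewrite invr_ge0 ltW.
  + by rewrite in_itv/= leey andbT integral_ge0 // => x _; rewrite lee_fin powR_ge0.
  + by rewrite in_itv/= leey andbT.
  apply: le_trans (truncated_weight_mass n).
  rewrite le_eqVlt; apply/orP; left; apply/eqP; apply: eq_integral => x _.
  rewrite normc_truncated_weight /v; congr (_%:E).
  have w0 : 0 <= (omega x)^-1 by rewrite invr_ge0 ltW // weight_gt0.
  rewrite powRM // powRN; congr (_ * _).
    by rewrite indicE; case: (_ \in _); rewrite /= ?powR1 // powR0 // gt_eqF.
  by rewrite -powR_inv1 ?(ltW (weight_gt0 _ _)) // -powRrM mulN1r powRN.
Qed.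

End subexponential_growth.

(** * Powers of g* g - z *)

Section iteration.
Context {R : realType} {G : topologicalZmodType}.
Variable mu : {sigma_finite_measure set (borel G) -> \bar R}.
Hypothesis mu_addr : forall (a : G) (A : set (borel G)), measurable A ->
  mu ((fun y : G => y + a) @^-1` A) = mu A.
Hypothesis mu_oppr : forall (A : set (borel G)), measurable A ->
  mu ((fun y : G => - y) @^-1` A) = mu A.
Hypothesis diff_ae : forall f : G -> R,
  measurable_fun [set: borel G] (f : borel G -> R) ->
  exists2 g : G -> R, diff_measurable_fun g & {ae mu, forall x : borel G, f x = g x}.
Variable B : (set G)^nat.
Hypothesis B_measurable : forall n, measurable (B n : set (borel G)).
Hypothesis B_lty : forall n, (mu (B n : set (borel G)) < +oo)%E.
Hypothesis B_add : forall m n x y, B m x -> B n y -> B (m + n) (x + y).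
Hypothesis B_opp : forall n x, B n x -> B n (- x).
Hypothesis B_le : forall m n, (m <= n)%N -> B m `<=` B n.
Variables (p q : R) (p1 : 1 < p) (pq : p^-1 + q^-1 = 1).
Variable omega : weight R G.
Hypothesis omega_LPAlg : LPAlg mu omega q.
Hypothesis B_growth : forall t : R, 1 < t -> exists2 c : R, 1 <= c &
  forall n, (mu (B n : set (borel G)) <= (c * t ^+ n)%:E)%E /\
    forall x, B n x -> omega x <= c * t ^+ n.
Implicit Types f g h u v : G -> R[i].
Local Notation bsupp := (bsupp B).

Lemma sqnorm_involution g : cmeasurable g -> sqnorm mu (involution g) = sqnorm mu g.
Proof.
move=> mg; congr fine.
rewrite -(ge0_integral_subl mu_addr mu_oppr 0 (u := fun y => (normc (g y) ^+ 2)%:E)).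
- by apply: eq_integral => y _; rewrite /involution normc_conj sub0r.
- by apply/measurable_EFinP; apply: measurable_funX; exact: cmeasurable_normc.
- by move=> y; rewrite lee_fin sqr_ge0.
Qed.

(** Cauchy-Schwarz in the form 2 a b <= e a^2 + b^2 / e. The parameter [e] is left free to balance
    the two squared norms. *)
Lemma normc_cconv_sqnorm n m f v (e : R) x : bsupp n f -> bsupp m v -> 0 < e ->
  normc (cconv mu f v x) <= (e * sqnorm mu f + e^-1 * sqnorm mu v) / 2.
Proof.
move=> bf bv e0; have [[mf _ _] [mv _ _]] := (bf, bv).
have msq h : cmeasurable h -> measurable_fun [set: borel G]
    (fun y : borel G => (normc (h y) ^+ 2)%:E).
  by move=> mh; apply/measurable_EFinP; apply: measurable_funX; exact: cmeasurable_normc.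
have lty := bsupp_absconv_lty2 B_measurable B_lty x bf bv.
rewrite -lee_fin; apply: le_trans (normc_cconv_le mf mv lty) _.
apply: (@le_trans _ _ (\int[mu]_(y in [set: borel G])
   ((e / 2)%:E * (normc (f y) ^+ 2)%:E + (e^-1 / 2)%:E * (normc (v (x - y)) ^+ 2)%:E))%E).
  apply: ge0_le_integral => //.
  - by move=> y _; rewrite lee_fin mulr_ge0 ?normc_ge0.
  - apply/measurable_EFinP; apply: measurable_funM; apply: cmeasurable_normc => //.
    exact: cmeasurable_subl.
  - apply: emeasurable_funD; apply: measurable_funeM; first exact: msq.
    exact: (msq (fun y => v (x - y)) (cmeasurable_subl x mv)).
  - move=> y _; rewrite -!EFinM -EFinD lee_fin.
    move: (normc (f y)) (normc (v (x - y))) => a b.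
    have := sqr_ge0 (e * a - b); have ei : e * e^-1 = 1 by rewrite divff // gt_eqF.
    have ei0 : 0 < e^-1 by rewrite invr_gt0.
    move=> h; have : 0 <= e^-1 * (e * a - b) ^+ 2 by rewrite mulr_ge0 // ltW.
    rewrite (_ : e^-1 * (e * a - b) ^+ 2 =
      (e * e^-1) * e * a ^+ 2 - 2 * (e * e^-1) * (a * b) + e^-1 * b ^+ 2); last by ring.
    rewrite ei; lra.
have e20 : 0 <= e / 2 by rewrite divr_ge0 // ltW.
have ei20 : 0 <= e^-1 / 2 by rewrite divr_ge0 // invr_ge0 ltW.
rewrite ge0_integralD //; last 4 first.
- by move=> y _; rewrite -EFinM lee_fin mulr_ge0 // sqr_ge0.
- by apply: measurable_funeM; exact: msq.
- by move=> y _; rewrite -EFinM lee_fin mulr_ge0 // sqr_ge0.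
- by apply: measurable_funeM; exact: (msq (fun y => v (x - y)) (cmeasurable_subl x mv)).
rewrite !ge0_integralZl_EFin //; last 4 first.
- by move=> y _; rewrite lee_fin sqr_ge0.
- exact: (msq (fun y => v (x - y)) (cmeasurable_subl x mv)).
- by move=> y _; rewrite lee_fin sqr_ge0.
- exact: msq.
rewrite (ge0_integral_subl mu_addr mu_oppr (u := fun y => (normc (v y) ^+ 2)%:E)); last 2 first.
- exact: msq.
- by move=> y; rewrite lee_fin sqr_ge0.
rewrite (sqnormE B_measurable B_lty bf) (sqnormE B_measurable B_lty bv).
rewrite -!EFinM -EFinD lee_fin; lra.
Qed.

Variables (N : nat) (g : G -> R[i]) (z : R[i]).
Hypothesis bg : bsupp N g.

Definition gram : G -> R[i] := cconv mu (involution g) g.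

Fixpoint shift_iter n : G -> R[i] :=
  if n is m.+1 then fun x => cconv mu gram (shift_iter m) x + - z * shift_iter m x else g.

(** This is (b - z)^n b with b = g* g, written as g* times (b - z)^n g: the right factor is
    controlled in L^2, and convolution by g* makes the bound pointwise. *)
Definition gram_iter n : G -> R[i] := cconv mu (involution g) (shift_iter n).

Let big := bsupp_involution B_opp bg.
Let bcc k l f h :=
  @bsupp_cconv _ _ mu mu_addr mu_oppr diff_ae B B_measurable B_lty B_add k l f h.

Lemma bsupp_gram : bsupp (N + N) gram.
Proof. exact: bcc big bg. Qed.

Lemma bsupp_shift_iter n : bsupp (n * (N + N) + N) (shift_iter n).
Proof.
elim: n => [|n IH]; first by rewrite mul0n.
rewrite mulSn -addnA; apply: bsuppD; first exact: bcc bsupp_gram IH.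
by apply: (bsupp_le B_le) (bsuppZ _ IH); rewrite leq_addl.
Qed.

Lemma bsupp_gram_iter n : bsupp (n.+1 * (N + N)) (gram_iter n).
Proof.
have := bcc big (bsupp_shift_iter n).
by rewrite (_ : (N + (n * (N + N) + N) = n.+1 * (N + N))%N) // mulSn addnCA addnC.
Qed.

Lemma gram_iterS n x :
  gram_iter n.+1 x = cconv mu gram (gram_iter n) x + - z * gram_iter n x.
Proof.
have bw := bsupp_shift_iter n; have bb := bsupp_gram; have bbw := bcc bb bw.
have [[mi _ _] [mw _ _] [mbw _ _]] := And3 big bw bbw.
have [mzw _ _] := bsuppZ (- z) bw.
rewrite /gram_iter /= (cconvC mu_addr mu_oppr mi (cmeasurableD mbw mzw)).
rewrite (cconvDl mbw mzw mi); last 2 first.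
- exact: (bsupp_absconv_lty2 B_measurable B_lty _ bbw big).
- exact: (bsupp_absconv_lty2 B_measurable B_lty _ (bsuppZ _ bw) big).
rewrite (cconvZl _ mw mi); last exact: (bsupp_absconv_lty2 B_measurable B_lty _ bw big).
rewrite (bsupp_cconvA mu_addr mu_oppr diff_ae B_measurable B_lty B_add _ bb bw big).
by rewrite (cconvC mu_addr mu_oppr mw mi).
Qed.

Variables (c s : R).
Hypothesis g_l1 : (\int[mu]_(y in [set: borel G]) (normc (g y))%:E <= c%:E)%E.
Hypothesis zs : normc z <= s.
Hypothesis Mzs : normc ((c ^+ 2)%:C%C - z) <= s.

Lemma sqnorm_shift_iter n : sqnorm mu (shift_iter n) <= s ^+ 2 ^+ n * sqnorm mu g.
Proof.
elim: n => [|n IH]; first by rewrite mul1r.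
have /le_trans -> // := sqnorm_shift mu_addr mu_oppr diff_ae B_measurable B_lty B_add B_opp
  B_le bg (bsupp_shift_iter n) g_l1 zs Mzs.
by rewrite (exprS (s ^+ 2) n) -mulrA ler_wpM2l // sqr_ge0.
Qed.

Lemma normc_gram_iter_le n x : 0 < s -> normc (gram_iter n x) <= s ^+ n * sqnorm mu g.
Proof.
move=> s0; have sn : 0 < s ^+ n by rewrite exprn_gt0.
(* The choice e = s^n balances the terms, because the squared norm of [shift_iter n] is at most
   s^(2n) times that of [g]. *)
apply: le_trans (normc_cconv_sqnorm x big (bsupp_shift_iter n) sn) _.
rewrite sqnorm_involution; last by have [] := bg.
have sh : (s ^+ n)^-1 * sqnorm mu (shift_iter n) <= s ^+ n * sqnorm mu g.
  rewrite ler_pdivrMl // mulrA -exprD addnn -mul2n exprM; exact: sqnorm_shift_iter.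
by rewrite ler_pdivrMr //; lra.
Qed.

Lemma Lp_norm_gram_iter (t : R) : 0 < s -> s < t ->
  exists C : R, forall n, Lp_norm mu omega p (gram_iter n) <= C * t ^+ n.
Proof.
move=> s0 st; have ts1 : 1 < t / s by rewrite ltr_pdivlMr // mul1r.
(* The support lies in [B (n.+1 * (N + N))] and [Lp_norm_bsupp] squares its growth bound, so
   tau^(4N) <= t / s makes this cost at most a constant times (t / s)^(n+1). *)
have [tau tau1 tauP] := root_gt1 ((N + N) * 2) ts1.
have [d d1 dP] := B_growth tau1.
exists (sqnorm mu g * d ^+ 2 * (t / s)) => n; have [mB oB] := dP (n.+1 * (N + N))%N.
have a1 : 1 <= d * tau ^+ (n.+1 * (N + N)) by rewrite mulr_ege1 // exprn_ege1 // ltW.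
have := (Lp_norm_bsupp B_measurable p1 (bsupp_gram_iter n)
  (fun x => normc_gram_iter_le n x s0) a1 mB oB).2.
move=> /le_trans; apply.
have -> : sqnorm mu g * d ^+ 2 * (t / s) * t ^+ n =
    s ^+ n * sqnorm mu g * (d ^+ 2 * (t / s) ^+ n.+1).
  have -> : t ^+ n = s ^+ n * (t / s) ^+ n.
    by rewrite -exprMn mulrCA divff ?mulr1 // gt_eqF.
  by rewrite (exprS (t / s) n); ring.
rewrite ler_wpM2l ?mulr_ge0 ?exprn_ge0 ?sqnorm_ge0 ?(ltW s0) //.
rewrite exprMn ler_wpM2l ?sqr_ge0 // -exprM -mulnA mulnC exprM.
by apply: lerXn2r => //; rewrite nnegrE ?exprn_ge0 ?(le_trans ler01 (ltW _)) //.
Qed.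

End iteration.

(** * Neumann series in a commutative Banach algebra *)

Lemma separating_disc (R : realType) (l : R[i]) (M : R) : 0 < M -> ~ 0 <= l ->
  exists z s, [/\ 0 < s, normc z <= s, normc (M%:C%C - z) <= s & s < normc (l - z)].
Proof.
case: l => x y M0 l0; have [y0|y0] := eqVneq y 0.
  have x0 : x < 0 by rewrite ltNge; apply/negP => x0; apply: l0; rewrite lecE /= y0 eqxx.
  (* For negative [l], the disc with diameter [0, M]. *)
  exists ((M / 2)%:C%C), (M / 2); split; first by rewrite divr_gt0.
  - by rewrite normc_real ger0_norm // divr_ge0 // ltW.
  - rewrite -rmorphB normc_real (_ : M - M / 2 = M / 2); last by field.
    by rewrite ger0_norm // divr_ge0 // ltW.
  - rewrite (_ : Complex x y - _ = (x - M / 2)%:C%C); last first.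
      by apply/eqP; rewrite eq_complex /= y0 subr0 !eqxx.
    by rewrite normc_real ltr0_norm; lra.
(* The centre is i w and the circle passes through M. Since -2 y w = M^2, the square of |l - z| is
   |l|^2 + M^2 + w^2, which exceeds s^2 by |l|^2. *)
pose w := - (M ^+ 2 / (2 * y)).
have wy : 2 * y * w = - M ^+ 2 by rewrite /w; field.
have s0 : 0 < M ^+ 2 + w ^+ 2 by rewrite ltr_pwDl ?exprn_gt0 ?sqr_ge0.
exists (Complex 0 w), (Num.sqrt (M ^+ 2 + w ^+ 2)); split.
- by rewrite sqrtr_gt0.
- by rewrite /= ler_sqrt ?(ltW s0) // expr0n /= add0r lerDr sqr_ge0.
- by rewrite /normc /= ler_sqrt ?(ltW s0) // subr0 sub0r sqrrN.
- rewrite /= subr0 ltr_sqrt; last first.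
    have : 0 < y ^+ 2 by rewrite exprn_even_gt0.
    have := sqr_ge0 x; have := sqr_ge0 M; have := sqr_ge0 w.
    rewrite (_ : (y - w) ^+ 2 = y ^+ 2 - 2 * y * w + w ^+ 2); last by ring.
    by rewrite wy; lra.
  have : 0 < y ^+ 2 by rewrite exprn_even_gt0.
  have := sqr_ge0 x.
  rewrite (_ : (y - w) ^+ 2 = y ^+ 2 - 2 * y * w + w ^+ 2); last by ring.
  by rewrite wy; lra.
Qed.

Section real_norm.
Context {R : realType} {A : normedModType R[i]}.
Implicit Types a b c : A.

(** Norms here are complex numbers; this is the same norm as a real number. *)
Definition rnorm a : R := complex.Re `|a|.

Lemma rnormE a : `|a| = (rnorm a)%:C%C.
Proof.
have := normr_ge0 a; rewrite lecE /= /rnorm; case: (`|a|) => x y /= /andP[/eqP -> _].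
by [].
Qed.

Lemma rnorm_ge0 a : 0 <= rnorm a.
Proof. by rewrite -lecR -rnormE normr_ge0. Qed.

Lemma rnorm_le a (x : R) : (rnorm a <= x) = (`|a| <= x%:C%C).
Proof. by rewrite rnormE lecR. Qed.

Lemma rnormD a b : rnorm (a + b) <= rnorm a + rnorm b.
Proof. by rewrite rnorm_le rmorphD /= -!rnormE ler_normD. Qed.

Lemma rnormN a : rnorm (- a) = rnorm a.
Proof. by rewrite /rnorm normrN. Qed.

Lemma rnormB a b : rnorm (a - b) <= rnorm a + rnorm b.
Proof. by rewrite -(rnormN b) rnormD. Qed.

Lemma rnormZ (k : R[i]) a : rnorm (k *: a) = normc k * rnorm a.
Proof.
have : (rnorm (k *: a))%:C%C = (normc k * rnorm a)%:C%C.
  by rewrite -rnormE normrZ rmorphM /= -rnormE.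
by case.
Qed.

Lemma rnorm0_eq0 a : rnorm a = 0 -> a = 0.
Proof. by move=> a0; apply/eqP; rewrite -normr_eq0 rnormE a0. Qed.

End real_norm.

(** * Resolvents and perturbation *)

Section commutative_banach_algebra.
Context {R : realType} {A : normedModType R[i]}.
Variable mul : A -> A -> A.
Hypothesis complete : forall F : set_system A, ProperFilter F -> cauchy F -> cvg F.
Hypothesis mulC : commutative mul.
Hypothesis mulA : associative mul.
Hypothesis mulDl : left_distributive mul +%R.
Hypothesis mulZl : forall (k : R[i]) a b, mul (k *: a) b = k *: mul a b.
Hypothesis normM : forall a b, `|mul a b| <= `|a| * `|b|.
Implicit Types (a b c d v : A) (z l : R[i]).

Lemma rnormM a b : rnorm (mul a b) <= rnorm a * rnorm b.
Proof. by rewrite rnorm_le rmorphM /= -!rnormE. Qed.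

Lemma mulDr_comm : right_distributive mul +%R.
Proof. by move=> a b c; rewrite !(mulC a) mulDl. Qed.

Lemma mulZr_comm (k : R[i]) a b : mul a (k *: b) = k *: mul a b.
Proof. by rewrite !(mulC a) mulZl. Qed.

Lemma mulBl a b c : mul (a - b) c = mul a c - mul b c.
Proof. by rewrite mulDl -scaleN1r mulZl scaleN1r. Qed.

Lemma mulBr a b c : mul a (b - c) = mul a b - mul a c.
Proof. by rewrite !(mulC a) mulBl. Qed.

(** Multiplication by b - z, as an operator because the algebra may lack a unit. *)
Definition shift b z v : A := mul b v - z *: v.

Lemma shiftD b z a c : shift b z (a + c) = shift b z a + shift b z c.
Proof. by rewrite /shift mulDr_comm scalerDr opprD addrACA. Qed.

Lemma shiftZ b z k a : shift b z (k *: a) = k *: shift b z a.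
Proof. by rewrite /shift mulZr_comm scalerBr !scalerA mulrC. Qed.

Lemma shiftB b z a c : shift b z (a - c) = shift b z a - shift b z c.
Proof. by rewrite -scaleN1r shiftD shiftZ scaleN1r. Qed.

Lemma shiftM b z a c : shift b z (mul a c) = mul (shift b z a) c.
Proof. by rewrite /shift mulBl mulA mulZl. Qed.

Lemma shift0 b z : shift b z 0 = 0.
Proof. by rewrite -(scale0r (0 : A)) shiftZ !scale0r. Qed.

Lemma rnorm_shift_le b z a : rnorm (shift b z a) <= (rnorm b + normc z) * rnorm a.
Proof.
by rewrite (le_trans (rnormB _ _)) // mulrDl lerD ?rnormM // rnormZ.
Qed.

Lemma iter_shiftD b z n a c :
  iter n (shift b z) (a + c) = iter n (shift b z) a + iter n (shift b z) c.
Proof. by elim: n => //= n ->; exact: shiftD. Qed.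

Lemma iter_shiftZ b z n k a : iter n (shift b z) (k *: a) = k *: iter n (shift b z) a.
Proof. by elim: n => //= n ->; exact: shiftZ. Qed.

Lemma iter_shiftM b z n a c :
  iter n (shift b z) (mul a c) = mul (iter n (shift b z) a) c.
Proof. by elim: n => //= n ->; exact: shiftM. Qed.

(** One factor of (b - z)^(n+1) a is expanded as b a - z a. The first term is bounded by hypothesis;
    the second is absorbed by induction because |z| < t. The constant D satisfies (t - |z|) D >=
    C. *)
Lemma iter_shift_bounded b z (t C : R) : normc z < t ->
    (forall n, rnorm (iter n (shift b z) b) <= C * t ^+ n) ->
  exists D : R, forall n a, rnorm (iter n (shift b z) a) <= D * t ^+ n * rnorm a.
Proof.
move=> zt bC; have t0 : 0 < t by rewrite (le_lt_trans _ zt) // normc_ge0.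
have tz : 0 < t - normc z by rewrite subr_gt0.
have C0 : 0 <= C by have := bC 0; rewrite mulr1; apply: le_trans; exact: rnorm_ge0.
exists (1 + C / (t - normc z)) => n a; elim: n => [|n IH] /=.
  by rewrite mulr1 ler_peMl ?rnorm_ge0 // lerDl divr_ge0 // ltW.
rewrite -[shift b z (iter n _ a)]/(iter n.+1 _ a) iterSr {1}/shift.
rewrite iter_shiftD -scaleNr iter_shiftZ iter_shiftM.
apply: le_trans (rnormD _ _) _; rewrite rnormZ normcN.
apply: (@le_trans _ _ (C * t ^+ n * rnorm a +
    normc z * ((1 + C / (t - normc z)) * t ^+ n * rnorm a))).
  apply: lerD; first by rewrite (le_trans (rnormM _ _)) // ler_wpM2r ?rnorm_ge0.
  by rewrite ler_wpM2l // normc_ge0.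
rewrite -subr_ge0 exprS (_ : _ - _ = (t - normc z) * t ^+ n * rnorm a); last first.
  by field; rewrite gt_eqF.
by rewrite !mulr_ge0 ?rnorm_ge0 ?exprn_ge0 // ltW.
Qed.

(* [shift b z] and multiplication by [d - b] commute. *)
Lemma iter_shift_perturb b d z (t e D : R) : 0 <= t -> rnorm (d - b) <= e ->
    (forall n a, rnorm (iter n (shift b z) a) <= D * t ^+ n * rnorm a) ->
  forall n a, rnorm (iter n (shift d z) a) <= D * (t + e) ^+ n * rnorm a.
Proof.
move=> t0 de bD; have e0 : 0 <= e by rewrite (le_trans _ de) // rnorm_ge0.
(* The induction needs the mixed powers (b - z)^k (d - z)^n: one more factor d - z = (b - z) + (d -
   b) either raises k or costs [e]. *)
suff h n : forall k a, rnorm (iter k (shift b z) (iter n (shift d z) a)) <=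
    D * t ^+ k * (t + e) ^+ n * rnorm a.
  by move=> n a; have := h n 0 a; rewrite mulr1.
elim: n => [|n IH] k a; first by rewrite mulr1; exact: bD.
rewrite iterS; set y := iter n _ a.
have -> : shift d z y = shift b z y + mul (d - b) y.
  by rewrite /shift mulBl addrAC addrCA subrr addr0.
rewrite iter_shiftD -iterSr mulC iter_shiftM.
apply: le_trans (rnormD _ _) _.
apply: (@le_trans _ _ (D * t ^+ k.+1 * (t + e) ^+ n * rnorm a +
    D * t ^+ k * (t + e) ^+ n * rnorm a * e)); last first.
  by rewrite (exprS t k) (exprS (t + e) n) le_eqVlt; apply/orP; left; apply/eqP; ring.
apply: lerD; first exact: IH.
apply: le_trans (rnormM _ _) _; apply: ler_pM; rewrite ?rnorm_ge0 //.
exact: IH.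
Qed.

Lemma geometric_cvg (r : R) (D : R) : 0 <= r -> r < 1 ->
  (fun n => D * r ^+ n) @ \oo --> (0 : R).
Proof.
move=> r0 r1; rewrite -[X in _ --> X](mulr0 D); apply: cvgM; first exact: cvg_cst.
by apply: cvg_expr; rewrite ger0_norm.
Qed.

Lemma geometric_limit (u : A^nat) (r D : R) : 0 <= r -> r < 1 ->
    (forall m n, (n <= m)%N -> rnorm (u m - u n) <= D * r ^+ n) ->
  exists c, forall n, rnorm (c - u n) <= D * r ^+ n.
Proof.
move=> r0 r1 uD.
have posC (e : R[i]) : 0 < e -> exists2 e' : R, 0 < e' & e = e'%:C%C.
  case: e => x y; rewrite ltcE /= => /andP[/eqP y0 x0].
  by exists x; rewrite // y0.
have small (e : R) : 0 < e -> exists n, D * r ^+ n < e.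
  move=> e0; have /cvgrPdist_lt/(_ _ e0)[n _ /(_ n (leqnn n))/=] := geometric_cvg D r0 r1.
  by rewrite sub0r normrN => ne; exists n; exact: le_lt_trans (ler_norm _) ne.
have cu : cauchy (u @ \oo).
  apply/cauchyP => _ /posC[e e0 ->]; have [n ne] := small _ e0.
  exists (u n), n => // m /= nm; rewrite -ball_normE /= distrC rnormE ltcR.
  exact: le_lt_trans (uD _ _ nm) ne.
have /cvg_ex[c /cvgrPdist_lt uc] : cvg (u @ \oo) by exact: complete cu.
exists c => n; apply/ler_addgt0Pr => e e0.
have [|N _ /(_ (maxn n N) (leq_maxr _ _))] := uc e%:C%C; first by rewrite ltcR.
rewrite /= rnormE ltcR => /ltW ce.
rewrite -(subrK (u (maxn n N)) c) -addrA addrC.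
apply: le_trans (rnormD _ _) _; apply: lerD => //.
exact: uD (leq_maxl _ _).
Qed.

(** The Neumann series of the resolvent at [l]: the partial sums [cn] converge geometrically, and
    they solve the equation up to the remainder l^-n times [y n]. *)
Lemma shift_surjective b z l (D r : R) v : 0 <= r -> r < normc l ->
    (forall n a, rnorm (iter n (shift b z) a) <= D * r ^+ n * rnorm a) ->
  exists c, shift b z c - l *: c = v.
Proof.
move=> r0 rl bD; have l0 : 0 < normc l by exact: le_lt_trans rl.
have nl0 : l != 0 by apply/eqP => l1; move: l0; rewrite l1 normc0 ltxx.
pose rho := r / normc l.
have rho0 : 0 <= rho by rewrite divr_ge0 // ltW.
have rho1 : rho < 1 by rewrite ltr_pdivrMr // mul1r.
pose y n := iter n (shift b z) v.
pose cn n : A := \sum_(0 <= k < n) (- (l ^- k.+1) *: y k).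
have normcX k : normc (l ^+ k) = normc l ^+ k.
  by elim: k => [|k IH]; rewrite ?normc1 // !exprS normcM IH.
have normcV k : normc (l ^- k) = normc l ^- k.
  have lk : l ^+ k != 0 by rewrite expf_neq0.
  apply: (mulfI (x := normc (l ^+ k))); last first.
    by rewrite -normcM divff // normc1 normcX divff // expf_neq0 // gt_eqF.
  by rewrite normcX expf_neq0 // gt_eqF.
pose E := D * rnorm v.
have yl n : normc l ^- n * rnorm (y n) <= E * rho ^+ n.
  rewrite /rho expr_div_n ler_pdivrMl ?exprn_gt0 // /E.
  have L0 : normc l ^+ n != 0 by rewrite expf_neq0 // gt_eqF.
  apply: le_trans (bD n v) _; rewrite le_eqVlt; apply/orP; left; apply/eqP.
  by move: (normc l ^+ n) (r ^+ n) L0 => L X L0; field.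
(* Nonnegativity is read off from [yl] at 0, as [D] comes without a sign. *)
have E0 : 0 <= E.
  by have := yl 0; rewrite mulr1; apply: le_trans; rewrite mulr_ge0 ?rnorm_ge0 // invr_ge0.
clearbody E.
(* F rho^n is the sum of the geometric tail that dominates the terms from index n on. Keeping the
   exact difference in [cB] lets the induction close. *)
pose F := E / normc l / (1 - rho).
have F0 : 0 <= F by rewrite !divr_ge0 // ?subr_ge0 ltW.
have cB m n : rnorm (cn (n + m)%N - cn n) <= F * rho ^+ n - F * rho ^+ (n + m).
  elim: m => [|m IH]; first by rewrite addn0 !subrr /rnorm normr0.
  rewrite addnS {1}/cn big_nat_recr //= -/(cn _) addrAC.
  apply: le_trans (rnormD _ _) _; apply: le_trans (lerD IH (lexx _)) _.
  have step : normc l ^- (n + m).+1 * rnorm (y (n + m)%N) <= E / normc l * rho ^+ (n + m).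
    have il0 : 0 <= (normc l)^-1 by rewrite invr_ge0 ltW.
    have := ler_wpM2l il0 (yl (n + m)%N); rewrite !mulrA (mulrC _ E).
    by rewrite exprS invfM.
  rewrite rnormZ normcN normcV; apply: le_trans (lerD (lexx _) step) _.
  rewrite exprS le_eqVlt; apply/orP; left; apply/eqP; rewrite /F.
  by field; rewrite (gt_eqF l0) gt_eqF // subr_gt0.
have cB' m n : (n <= m)%N -> rnorm (cn m - cn n) <= F * rho ^+ n.
  move=> nm; rewrite -(subnKC nm); apply: le_trans (cB _ _) _.
  by rewrite gerBl mulr_ge0 // exprn_ge0.
have [c cd] := geometric_limit rho0 rho1 cB'; exists c.
have res n : shift b z (cn n) - l *: cn n = v - l ^- n *: y n.
  elim: n => [|n IH].
    by rewrite /cn big_geq // shift0 scaler0 subr0 invr1 scale1r subrr.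
  rewrite /cn big_nat_recr //= -/(cn n) shiftD scalerDr opprD addrACA IH.
  rewrite shiftZ -[shift b z (y n)]/(y n.+1) -addrA; congr (_ + _).
  have e : l * l ^- n.+1 = l ^- n by rewrite exprS invfM mulrA divff // mul1r.
  by rewrite !scaleNr scalerN opprK scalerA e addrCA addNr addr0.
apply/eqP; rewrite -subr_eq0; apply/eqP/rnorm0_eq0; apply/eqP.
rewrite eq_le rnorm_ge0 andbT.
(* The first summand accounts for replacing [c] by [cn n], the second for the remainder. *)
pose H := (rnorm b + normc z + normc l) * F + E.
have bound n : rnorm (shift b z c - l *: c - v) <= H * rho ^+ n.
  rewrite (_ : shift b z c - l *: c - v =
      shift b z (c - cn n) - l *: (c - cn n) - l ^- n *: y n); last first.
    move: (res n) => /eqP; rewrite shiftB scalerBr.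
    move: (l ^- n *: y n) => X; rewrite eq_sym subr_eq => /eqP ->.
    rewrite opprD addrA; congr (_ - X).
    by rewrite !opprD !opprK addrACA.
  apply: le_trans (rnormB _ _) _; rewrite mulrDl; apply: lerD; last by rewrite rnormZ normcV.
  apply: le_trans (rnormB _ _) _; rewrite rnormZ -mulrA mulrDl; apply: lerD.
    apply: le_trans (rnorm_shift_le _ _ _) _.
    by rewrite ler_wpM2l // addr_ge0 ?rnorm_ge0 ?normc_ge0.
  by rewrite ler_wpM2l // ltW.
have hcvg := geometric_cvg H rho0 rho1.
have := cvg_lim (@Rhausdorff R) hcvg => <-.
apply: limr_ge; first by apply/cvg_ex; exists 0; exact: hcvg.
by apply: nearW.
Qed.

Lemma resolvent_exists b d z l (t e C : R) v : 0 <= e -> rnorm (d - b) <= e ->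
    normc z < t -> t + e < normc (l - z) ->
    (forall n, rnorm (iter n (shift b z) b) <= C * t ^+ n) ->
  exists c, mul d c - l *: c = v.
Proof.
move=> e0 de zt tl bC; have t0 : 0 <= t.
  by rewrite ltW // (le_lt_trans _ zt) // normc_ge0.
have [D bD] := iter_shift_bounded zt bC.
have [c cv] := shift_surjective v (addr_ge0 t0 e0) tl (iter_shift_perturb t0 de bD).
exists c; rewrite -cv /shift scalerBl opprB.
by rewrite addrA subrK.
Qed.

Lemma not_spectrum d l : l != 0 -> (forall v, exists c, mul d c - l *: c = v) ->
  ~ spectrum mul d l.
Proof.
move=> l0 surj [[e eP] | [_]]; apply.
  have [c ce] := surj e; exists c.
  have h : mul (d - l *: e) c = e by rewrite mulBl mulZl (eP c).1.
  by split; [|rewrite mulC].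
(* In the unitization (d, -l) (c, -l^-1) = (d c - l c - l^-1 d, 1), so this right side makes the
   first component vanish. *)
have [c cv] := surj (l^-1 *: d); exists (c, - l^-1).
have h : mul d c + - l *: c + - l^-1 *: d = 0.
  by rewrite !scaleNr cv subrr.
rewrite /unitization_mul /= mulrNN mulfV // mulNr mulrN opprK mulVf //.
split; first by rewrite h.
by rewrite mulC -addrA (addrC (- l^-1 *: d)) addrA h.
Qed.

Variable star : A -> A.
Hypothesis starD : {morph star : a b / a + b}.
Hypothesis starZ : forall (k : R[i]) a, star (k *: a) = (k^*)%C *: star a.
Hypothesis norm_star : forall a, `|star a| = `|a|.

(** Here [c] is any upper bound of the norm, so that one disc serves all elements near a given
    one. *)
Definition disc_bound g := forall z (c s t : R), rnorm g <= c ->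
  normc z <= s -> normc ((c ^+ 2)%:C%C - z) <= s -> 0 < s -> s < t ->
  exists C : R, forall n,
    rnorm (iter n (shift (mul (star g) g) z) (mul (star g) g)) <= C * t ^+ n.

Lemma rnorm_gram_diff a g :
  rnorm (mul (star a) a - mul (star g) g) <= rnorm (a - g) * (rnorm a + rnorm g).
Proof.
have starN b : star (- b) = - star b.
  by rewrite -scaleN1r starZ rmorphN rmorph1 scaleN1r.
have -> : mul (star a) a - mul (star g) g = mul (star (a - g)) a + mul (star g) (a - g).
  by rewrite starD starN mulBl mulBr addrA subrK.
apply: le_trans (rnormD _ _) _; rewrite mulrDr; apply: lerD.
  by apply: le_trans (rnormM _ _) _; rewrite /rnorm norm_star.
by apply: le_trans (rnormM _ _) _; rewrite mulrC /rnorm norm_star.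
Qed.

Lemma symmetric_of_dense_disc_bound :
    (forall a (e : R), 0 < e -> exists2 g, rnorm (a - g) <= e & disc_bound g) ->
  symmetric_star_algebra mul star.
Proof.
move=> dense a l al; apply/negPn/negP => /negP l0; move: al.
have ln0 : l != 0 by apply: contra_not_neq l0 => ->.
apply: not_spectrum => // v; set c := rnorm a + 1.
have c0 : 0 < c by rewrite ltr_wpDl ?rnorm_ge0.
have [z [s [s0 zs Mzs sl]]] := separating_disc (exprn_gt0 2 c0) l0.
(* With t = s + e, perturbing by at most [e] leads to the rate s + 2 e, still below |l - z|. *)
pose e := (normc (l - z) - s) / 4.
have e0 : 0 < e by rewrite divr_gt0 // subr_gt0.
have c2 : 0 < 1 + 2 * c by rewrite addr_gt0 // mulr_gt0.
(* The bound 1 ensures |g| <= c; the other one makes |a - g| (|a| + |g|) <= 2 c d at most [e]. *)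
pose d := Num.min 1 (e / (1 + 2 * c)).
have d0 : 0 < d by rewrite lt_min ltr01 divr_gt0.
have [g ag gP] := dense a d d0.
have d1 : d <= 1 by rewrite ge_min lexx.
have de : d * (1 + 2 * c) <= e by rewrite -ler_pdivlMr // ge_min lexx orbT.
have gc : rnorm g <= c.
  rewrite -[g](subrK a) addrC (le_trans (rnormD _ _)) // lerD2l.
  by rewrite -rnormN opprB (le_trans ag).
have [|C gC] := gP z c s (s + e) gc zs Mzs s0; first by rewrite ltrDl.
apply: (resolvent_exists v (ltW e0) _ _ _ gC).
- apply: le_trans (rnorm_gram_diff _ _) _; apply: le_trans de.
  apply: ler_pM; rewrite ?addr_ge0 ?rnorm_ge0 // (@le_trans _ _ (2 * c)) //; last by rewrite lerDr.
  by rewrite mulr2n mulrDl mul1r lerD // lerDl.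
- by rewrite (le_lt_trans zs) // ltrDl.
- by rewrite /e; move: sl; lra.
Qed.

End commutative_banach_algebra.

(** * Symmetry *)

Section symmetry.
Context {R : realType} {G : topologicalZmodType}.
Variable mu : {sigma_finite_measure set (borel G) -> \bar R}.
Hypothesis mu_addr : forall (a : G) (A : set (borel G)), measurable A ->
  mu ((fun y : G => y + a) @^-1` A) = mu A.
Hypothesis mu_oppr : forall (A : set (borel G)), measurable A ->
  mu ((fun y : G => - y) @^-1` A) = mu A.
Hypothesis diff_ae : forall f : G -> R,
  measurable_fun [set: borel G] (f : borel G -> R) ->
  exists2 g : G -> R, diff_measurable_fun g & {ae mu, forall x : borel G, f x = g x}.
Variable B : (set G)^nat.
Hypothesis B_measurable : forall n, measurable (B n : set (borel G)).
Hypothesis B_lty : forall n, (mu (B n : set (borel G)) < +oo)%E.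
Hypothesis B_add : forall m n x y, B m x -> B n y -> B (m + n) (x + y).
Hypothesis B_opp : forall n x, B n x -> B n (- x).
Hypothesis B_le : forall m n, (m <= n)%N -> B m `<=` B n.
Variables (p q : R) (p1 : 1 < p) (pq : p^-1 + q^-1 = 1).
Variable omega : weight R G.
Hypothesis omega_LPAlg : LPAlg mu omega q.
Hypothesis B_growth : forall t : R, 1 < t -> exists2 c : R, 1 <= c &
  forall n, (mu (B n : set (borel G)) <= (c * t ^+ n)%:E)%E /\
    forall x, B n x -> omega x <= c * t ^+ n.
Hypothesis B_cover : \bigcup_n B n = setT.
Implicit Types f g h u v : G -> R[i].
Local Notation bsupp := (bsupp B).

Local Notation Lmul := (Lp_mul mu_addr mu_oppr diff_ae pq omega_LPAlg (p1 := p1)).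
Local Notation Lstar := (Lp_star mu_oppr (omega := omega) (p1 := p1)).

Let p0 : 0 < p. Proof. exact: lt_trans p1. Qed.

Definition truncation f n : G -> R[i] :=
  fun x => f x * (\1_(B n `&` [set x | normc (f x) <= n%:R]) x)%:C%C.

Let measurable_truncation_set f n : cmeasurable f ->
  measurable (B n `&` [set x | normc (f x) <= n%:R] : set (borel G)).
Proof.
move=> mf; apply: measurableI; first exact: B_measurable.
rewrite -[X in measurable X]setTI.
have -> : [set x | normc (f x) <= n%:R] =
    (fun x : borel G => normc (f x)) @^-1` [set r | r <= n%:R] by [].
apply: (cmeasurable_normc mf) => //.
by rewrite (_ : [set r | r <= n%:R] = `]-oo, n%:R]%classic).
Qed.

Lemma bsupp_truncation f n : cmeasurable f -> bsupp n (truncation f n).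
Proof.
move=> mf; split.
- apply: cmeasurableM => //; apply/cmeasurable_real.
  exact: (measurable_indic (measurable_truncation_set n mf)).
- exists n%:R => x; rewrite /truncation indicE.
  have [[Bx fx]|h] := pselect ((B n `&` [set x | normc (f x) <= n%:R]) x).
    by rewrite mem_set // mulr1.
  by rewrite memNset // mulr0 normc0.
- move=> x nB; rewrite /truncation indicE memNset ?mulr0 // => -[].
  by move=> /nB.
Qed.

(** At each point the truncation is eventually exact, and |f|^p omega^p dominates, so dominated
    convergence applies. *)
Lemma truncation_dense f (e : R) : finite_Lp mu omega p f -> 0 < e ->
  exists n, Lp_norm mu omega p (f - truncation f n) <= e.
Proof.
move=> ff e0; have [mf fin] := ff.
pose h (x : borel G) := (normc (f x) `^ p * omega x `^ p)%:E.
pose hn n (x : borel G) :=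
  (normc ((f - truncation f n) x) `^ p * omega x `^ p)%:E.
have mfn n : cmeasurable (f - truncation f n).
  have [mt _ _] := bsupp_truncation n mf.
  have := cmeasurableD mf (cmeasurableZ (-1) mt).
  by rewrite scaleN1r.
have h0 x : (0 <= h x)%E by rewrite lee_fin mulr_ge0 ?powR_ge0.
have ih : mu.-integrable [set: borel G] h.
  apply/integrableP; split; first exact: (measurable_Lp_integrand p omega mf).
  rewrite (eq_integral h); first exact: fin.
  by move=> x _; rewrite gee0_abs.
have lim x : hn ^~ x @ \oo --> (0 : \bar R)%E.
  have [N _ BN] : (\bigcup_n B n) x by rewrite B_cover.
  have [m fm] : exists m : nat, normc (f x) <= m%:R.
    by exists (Num.truncn (normc (f x))).+1; rewrite ltW // truncnS_gt.
  apply: cvg_near_cst; exists (maxn N m) => // n /= nm.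
  rewrite /hn /truncation; congr (_%:E).
  rewrite -[(f - _) x]/(f x - f x * (\1_(B n `&` [set x | normc (f x) <= n%:R]) x)%:C%C).
  rewrite indicE mem_set; first by rewrite mulr1 subrr normc0 powR0 ?mul0r // gt_eqF.
  split; first by apply: B_le BN; rewrite (leq_trans (leq_maxl _ _) nm).
  by rewrite /= (le_trans fm) // ler_nat (leq_trans (leq_maxr _ _) nm).
have dom n x : (`|hn n x| <= h x)%E.
  rewrite gee0_abs ?lee_fin ?mulr_ge0 ?powR_ge0 // ler_wpM2r ?powR_ge0 //.
  rewrite ge0_ler_powR ?nnegrE ?normc_ge0 ?(ltW p0) //.
  rewrite -[(f - _) x]/(f x - f x * (\1_(B n `&` [set x | normc (f x) <= n%:R]) x)%:C%C).
  rewrite indicE; case: (_ \in _); last by rewrite mulr0 subr0.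
  by rewrite mulr1 subrr normc0 normc_ge0.
have [_ _] := dominated_convergence measurableT
  (fun n => measurable_Lp_integrand p omega (mfn n)) (measurable_cst 0%E)
  (aeW mu (fun x _ => lim x)) ih (aeW mu (fun x n _ => dom n x)).
rewrite integral0 => /(_ [set y | (y < (e `^ p)%:E)%E]) [].
  apply: open_nbhs_nbhs; split; first exact: open_ereal_lt_ereal.
  by rewrite /= lte_fin powR_gt0.
move=> n _ /(_ n (leqnn n)) /= lt_e; exists n.
exact: (Lp_norm_le p1 (mfn n) (ltW e0) (ltW lt_e)).2.
Qed.

Lemma rnorm_Lp_class (f : Lp_fun mu omega p1) : rnorm (Lp_class f) = Lp_norm mu omega p f.
Proof. by rewrite /rnorm Lp_class_norm. Qed.

(** Links the abstract iteration to functions: the representative is [gram_iter] itself, to which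
    the pointwise estimates apply. *)
Lemma iter_shift_Lp_class N z (f : Lp_fun mu omega p1) n : bsupp N f ->
  exists2 h : Lp_fun mu omega p1, (h : G -> R[i]) = gram_iter mu f z n &
    iter n (shift Lmul (Lmul (Lstar (Lp_class f)) (Lp_class f)) z)
      (Lmul (Lstar (Lp_class f)) (Lp_class f)) = Lp_class h.
Proof.
move=> bf; pose b := Lp_conv mu_addr mu_oppr diff_ae pq omega_LPAlg (Lp_invol mu_oppr f) f.
have -> : Lmul (Lstar (Lp_class f)) (Lp_class f) = Lp_class b.
  by rewrite (Lp_star_class mu_addr) Lp_mul_class.
elim: n => [|n [h hE hP]]; first by exists b.
exists (Lp_conv mu_addr mu_oppr diff_ae pq omega_LPAlg b h - z *: h).
  apply/funext => x.
  rewrite (gram_iterS mu_addr mu_oppr diff_ae B_measurable B_lty B_add B_opp B_le z bf n x).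
  by rewrite mulNr -hE.
by rewrite iterS hP /shift Lp_mul_class -Lp_classZ -Lp_classB.
Qed.

Lemma bsupp_disc_bound N (f : Lp_fun mu omega p1) : bsupp N f ->
  disc_bound Lmul Lstar (Lp_class f).
Proof.
move=> bf z c s t fc zs Mzs s0 st.
have fl1 : (\int[mu]_(y in [set: borel G]) (normc (f y))%:E <= c%:E)%E.
  apply: le_trans (l1_le_Lp_norm mu_addr mu_oppr diff_ae B_measurable B_lty B_add p1 pq
    omega_LPAlg B_growth bf) _.
  by rewrite lee_fin -rnorm_Lp_class.
have [C CP] := Lp_norm_gram_iter mu_addr mu_oppr diff_ae B_measurable B_lty B_add B_opp B_le
  p1 B_growth bf fl1 zs Mzs s0 st.
exists C => n; have [h hE ->] := iter_shift_Lp_class z n bf.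
by rewrite rnorm_Lp_class hE.
Qed.

Lemma Lp_symmetric : symmetric_star_algebra Lmul Lstar.
Proof.
apply: symmetric_of_dense_disc_bound.
- exact: Lp_banach.
- exact: Lp_mulC.
- exact: Lp_mulA.
- exact: Lp_mulDl.
- exact: Lp_mulZl.
- exact: Lp_normM.
- exact: Lp_starD.
- exact: Lp_starZ.
- exact: Lp_norm_star.
move=> a e e0; rewrite -(Lp_reprK a); move: (repr a) => f {a}.
have [n fn] := truncation_dense (Lp_fun_finite f) e0.
have bt := bsupp_truncation n (Lp_fun_cmeasurable f).
exists (Lp_class (to_Lp_fun p1 (bsupp_finite_Lp B_measurable p1 B_growth bt))).
  by rewrite -Lp_classB rnorm_Lp_class.
exact: (bsupp_disc_bound (f := to_Lp_fun p1 _) bt).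
Qed.

End symmetry.

Section weight_growth.
Context {R : realType} {G : topologicalZmodType}.
Variable omega : weight R G.

(** Condition (S) controls only large n. As the sumsets increase, K^n lies in K^(N+1+n), which
    covers all n at the price of the constant t^(N+1). *)
Lemma condition_S_growth (K : set G) (t : R) : condition_S omega -> generating_nbhs K ->
  1 < t -> exists2 c : R, 1 <= c & forall n x, nfold_sum K n x -> omega x <= c * t ^+ n.
Proof.
move=> S gK t1; have [K0 _ _] := gK; have {}K0 := nbhs_singleton K0.
have t0 : 0 <= t by rewrite ltW // (lt_trans _ t1).
have [|N _ NP] := S K gK [set y | (y < t%:E)%E].
  apply: open_nbhs_nbhs; split; first exact: open_ereal_lt_ereal.
  by rewrite /= lte_fin.
have large n x : (N < n)%N -> nfold_sum K n x -> omega x <= t ^+ n.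
  move=> Nn nx; have n0 : (0 < n)%N by exact: leq_ltn_trans Nn.
  have : ((omega x `^ n%:R^-1)%:E < t%:E)%E.
    by apply: le_lt_trans (NP n (ltnW Nn)); apply: ereal_sup_ubound; exists x.
  rewrite lte_fin => /ltW h.
  have w0 : 0 <= omega x by rewrite (le_trans _ (weight_ge1 omega x)).
  rewrite -[leLHS](powRr1 w0) -(@mulVf _ n%:R) ?pnatr_eq0 -?lt0n // powRrM.
  rewrite powR_mulrn ?powR_ge0 //; apply: lerXn2r => //; rewrite nnegrE ?powR_ge0 //.
exists (t ^+ N.+1); first by rewrite exprn_ege1 // ltW.
move=> n x nx; rewrite -exprD; have {}nx := nfold_sum_le K0 (leq_addl N.+1 n) nx.
by apply: large nx; rewrite addSn ltnS leq_addr.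
Qed.

End weight_growth.

Theorem theorem3p5 (R : realType) (G : topologicalZmodType)
    (mu : {measure set (borel G) -> \bar R})
    (G_hausdorff : hausdorff_space G)
    (G_locally_compact : locally_compact [set: G])
    (G_compactly_generated : compactly_generated G)
    (mu_haar : haar_measure mu)
    (G_polynomial_growth : polynomial_growth mu)
    (p q : R) (p1 : 1 < p) (pq : p^-1 + q^-1 = 1)
    (omega : weight R G)
    (omega_continuous : continuous (omega : G -> R))
    (omega_LPAlg : LPAlg mu omega q)
    (omega_S : condition_S omega) :
  exists (mul : Lp mu omega p1 -> Lp mu omega p1 -> Lp mu omega p1)
         (star : Lp mu omega p1 -> Lp mu omega p1),
    [/\ convolution_product mul,
        involution_map star,
        banach_star_algebra mul star &
        symmetric_star_algebra mul star].
Proof.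
have [K [cK gK oK growK]] := symmetric_generating_compact G_hausdorff G_polynomial_growth.
pose B n := nfold_sum K n.
have K0 : K 0 by have [K0 _ _] := gK; exact: nbhs_singleton K0.
have B_compact n : compact (B n) by exact: nfold_sum_compact.
have B_cover : \bigcup_n B n = setT by have [] := gK.
(* The sumsets of [K] are compact and cover [G], so [mu] is sigma-finite; it is replaced by the same
   measure carrying this structure, as the Fubini arguments require. *)
have [m mE] : exists m : {sigma_finite_measure set (borel G) -> \bar R},
    (m : {measure set (borel G) -> \bar R}) = mu.
  exists (haar_sigma_finite_measure G_hausdorff mu_haar B_compact B_cover).
  by clear G_polynomial_growth growK omega_LPAlg; case: mu mu_haar.
subst mu.
have m_addr := haar_addr mu_haar.
have m_oppr := haar_oppr G_hausdorff G_locally_compact mu_haar B_compact B_cover.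
have m_diff := diff_measurable_fun_ae G_hausdorff G_locally_compact mu_haar B_compact B_cover.
have B_measurable n : measurable (B n : set (borel G)).
  exact: (compact_measurable G_hausdorff).
have B_lty n : (m (B n : set (borel G)) < +oo)%E by exact: haar_compact mu_haar _ (B_compact n).
have B_add k n x y : B k x -> B n y -> B (k + n)%N (x + y) by exact: nfold_sumD.
have B_opp n x : B n x -> B n (- x) by exact: nfold_sumN.
have B_le k n : (k <= n)%N -> B k `<=` B n by exact: nfold_sum_le.
have B_growth t : 1 < t -> exists2 c : R, 1 <= c & forall n,
    (m (B n : set (borel G)) <= (c * t ^+ n)%:E)%E /\ forall x, B n x -> omega x <= c * t ^+ n.
  move=> t1; have tn n : 0 <= t ^+ n by rewrite exprn_ge0 // ltW // (lt_trans _ t1).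
  have [c cP] := growK t t1; have [d d1 dP] := condition_S_growth omega_S gK t1.
  exists (Num.max c d) => [|n]; first by rewrite le_max d1 orbT.
  split; first by rewrite (le_trans (cP n)) // lee_fin ler_wpM2r // le_max lexx.
  by move=> x Bx; rewrite (le_trans (dP n x Bx)) // ler_wpM2r // le_max lexx orbT.
exists (Lp_mul m_addr m_oppr m_diff pq omega_LPAlg), (Lp_star m_oppr (omega := omega) (p1 := p1)); split.
- exact: Lp_convolution_product.
- exact: Lp_involution_map.
- split.
  + exact: Lp_banach.
  + exact: Lp_mulA.
  + exact: Lp_mulDl.
  + exact: Lp_mulDr.
  + exact: Lp_mulZl.
  + exact: Lp_mulZr.
  + exact: Lp_normM.
  + exact: Lp_starK.
  + exact: Lp_starD.
  + exact: Lp_starZ.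
  + exact: Lp_starM.
  + exact: Lp_norm_star.
- exact: (Lp_symmetric B_measurable B_lty B_add B_opp B_le B_growth B_cover).
Qed.
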